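(* Let $n\ge1$, $i\ge0$ and $k\ge1$ be integers, let $Y$ be a Banach space, $T\in\mathscr D'(\mathbf R^n,Y)$, $0<r<\infty$, and $\Phi\in\mathscr D_{\mathbf B(0,r)}(\mathbf R^n,\mathbf R)$ such that $\Phi\ast Q=Q$ whenever $Q:\mathbf R^n\to\mathbf R$ is a polynomial function of degree at most $k-1$. Let $0\le\kappa<\infty$, let $C$ be a compact convex subset of $\mathbf R^n$, let $K=\bigcup\{\mathbf B(c,kr):c\in C\}$, and suppose $$|(\mathrm D^oT)(\phi)|\le\kappa\sup_{x\in\mathbf R^n}\|\mathrm D^i\phi(x)\|\quad\text{for }\phi\in\mathscr D_K(\mathbf R^n,Y)\text{ and }o\in\boldsymbol\Xi(n,k).$$ Let $a\in C$ and let $P:\mathbf R^n\to Y^\ast$ be the polynomial function of degree at most $k-1$ satisfying $$\langle y,\mathrm D^\xi P(a)\rangle=(\mathrm D^\xi T)_b(\Phi(b-a)y)$$ whenever $m=0,\dots,k-1$, $\xi\in\boldsymbol\Xi(n,m)$ and $y\in Y$. Then, for $m=0,\dots,k-1$ and $\xi\in\boldsymbol\Xi(n,m)$, there holds $$\Big|(\mathrm D^\xi T)(\theta)-\int\langle\theta,\mathrm D^\xi P\rangle\,d\mathscr L^n\Big|\le\Gamma_m\kappa\sup_{x\in\mathbf R^n}\|\mathrm D^i\theta(x)\|\quad\text{for }\theta\in\mathscr D_C(\mathbf R^n,Y),$$ where $$\Gamma_m=\Big(n\,\boldsymbol\alpha(n)\sup_{x\in\mathbf R^n}\|\mathrm D^i\Phi(x)\|\Big)^{k-m}\prod_{\mu=1}^{k-m}(2\mu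 r+\operatorname{diam}C)^{1+n+i}.$$
   Context: All vector spaces are real. $Y^\ast$ is the Banach space of continuous linear functionals on $Y$, and $\langle y,\upsilon\rangle=\upsilon(y)$ (also applied pointwise to functions). $\mathscr L^n$ is Lebesgue measure; $\mathbf B(a,r)$ is the closed ball in $\mathbf R^n$; $\boldsymbol\alpha(n)=\mathscr L^n(\mathbf B(0,1))$. $\mathscr D(\mathbf R^n,Y)$ is the space of compactly supported $C^\infty$ functions $\mathbf R^n\to Y$ with its usual locally convex (inductive limit) topology, $\mathscr D'(\mathbf R^n,Y)$ is the space of continuous linear maps $T:\mathscr D(\mathbf R^n,Y)\to\mathbf R$, and $\mathscr D_K(\mathbf R^n,Y)=\{\phi\in\mathscr D(\mathbf R^n,Y):\operatorname{spt}\phi\subset K\}$ for compact $K$. $R_b(\phi(b))$ means $R(\phi)$, with $b$ the running variable. The full derivative $\mathrm D^i\phi(x)$ is a symmetric $i$-linear map on $(\mathbf R^n)^i$ with norm $\|\psi\|=\sup\{|\psi(v_1,\dots,v_i)|:|v_j|\le1\}$. $\boldsymbol\Xi(n,m)$ is the set of multi-indices $\xi=(\xi_1,\dots,\xi_n)$ of nonnegative integers with sum $m$; $\mathrm D^\xi$ is the corresponding partial derivative, and for distributions $(\mathrm D^\xi T)(\phi)=(-1)^mT(\mathrm D^\xi\phi)$. $(\Phi\ast Q)(x)=\int\Phi(b)Q(x-b)\,d\mathscr L^nb$. *)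

(* Defs.v *)
From HB Require Import structures.
From mathcomp Require Import all_boot all_order all_algebra.
From mathcomp Require Import all_classical all_reals all_analysis.

Set Implicit Arguments.
Unset Strict Implicit.
Unset Printing Implicit Defensive.

Import Order.TTheory GRing.Theory Num.Theory.
Import numFieldNormedType.Exports.

Local Open Scope classical_set_scope.
Local Open Scope ring_scope.

Section euclidean.
Context {R : realType} {n : nat}.
Implicit Types (x v : 'rV[R]_n) (A : set 'rV[R]_n).

(* The library norm on 'rV_n is the sup norm; it is used only for the topology
   and for differentiability, which depend on it only up to equivalence.  All
   metric quantities below use the Euclidean norm. *)
Definition enorm v : R := Num.sqrt (\sum_j v ord0 j ^+ 2).

Definition ecball x (r : R) : set 'rV[R]_n := [set y | enorm (y - x) <= r].

Definition ediam A : R :=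
  sup [set enorm (p.1 - p.2) | p in A `*` A].

Definition ethicken A (r : R) : set 'rV[R]_n := \bigcup_(c in A) ecball c r.

End euclidean.

(* The sigma-algebra on 'rV_n generated by the coordinates, i.e. the Borel
   one when T = R. *)
Section measurable_rV.
Context {d} {T : sigmaRingType d}.
Variable n : nat.

Let coors : 'I_n -> 'rV[T]_n -> T := fun i x => x ord0 i.

Let rV_set0 : g_sigma_preimage coors set0.
Proof. exact: sigma_algebra0. Qed.

Let rV_setC A : g_sigma_preimage coors A -> g_sigma_preimage coors (~` A).
Proof. exact: sigma_algebraC. Qed.

Let rV_bigcup (F : _^nat) : (forall i, g_sigma_preimage coors (F i)) ->
  g_sigma_preimage coors (\bigcup_i (F i)).
Proof. exact: sigma_algebra_bigcup. Qed.

HB.instance Definition _ := @isMeasurable.Build (measure_tuple_display d)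
  'rV[T]_n (g_sigma_preimage coors) rV_set0 rV_setC rV_bigcup.

End measurable_rV.

Section lebesgue_rV.
Context {R : realType}.

Definition rV_cons n (p : R * 'rV[R]_n) : 'rV[R]_n.+1 :=
  row_mx (p.1%:M : 'M[R]_1) p.2.

Lemma measurable_coord_rV n (i : 'I_n) :
  measurable_fun [set: 'rV[R]_n] (fun x : 'rV[R]_n => x ord0 i).
Proof.
move=> _ Y mY; rewrite setTI; apply: sub_sigma_algebra => /=.
rewrite -bigcup_seq/=; exists i => /=; first by rewrite mem_index_enum.
by exists Y => //; rewrite setTI.
Qed.

Lemma measurable_fun_rVP d (T : measurableType d) n (f : T -> 'rV[R]_n) :
  (forall i, measurable_fun [set: T] (fun t => f t ord0 i)) ->
  measurable_fun [set: T] f.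
Proof.
move=> mf _; suff : measurable `<=`
    [set B : set 'rV[R]_n | measurable ([set: T] `&` f @^-1` B)] by [].
apply: smallest_sub.
  split => /=.
  - by rewrite preimage_set0 setI0.
  - move=> B; rewrite !setTI setTD preimage_setC => mB; exact: measurableC.
  - move=> F mF; rewrite preimage_bigcup setI_bigcupr; exact: bigcupT_measurable.
rewrite -bigcup_seq => B [i _ [C mC <-]] /=; rewrite [X in _ @^-1` X]setTI.
exact: mf.
Qed.

Lemma measurable_rV_cons n : measurable_fun [set: R * 'rV[R]_n] (@rV_cons n).
Proof.
apply: measurable_fun_rVP => i.
have [j ij|j ij] := @split_ordP 1 n i.
- rewrite [X in measurable_fun _ X](_ : _ = fst); first exact: measurable_fst.
  apply/funext => p; rewrite ij.
  by apply: etrans (@row_mxEl _ _ 1 n _ _ _ _) _; rewrite (ord1 j) mxE mulr1n.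
- rewrite [X in measurable_fun _ X](_ : _ = (fun x : 'rV[R]_n => x ord0 j) \o snd).
    by apply: (measurableT_comp (measurable_coord_rV j)); exact: measurable_snd.
  by apply/funext => p; rewrite ij; exact: (@row_mxEr _ _ 1 n).
Qed.

Section step.
Local Open Scope ereal_scope.
Variables (n : nat) (mu : {sigma_finite_measure set 'rV[R]_n -> \bar R}).

Definition lebesgue_rVS : set 'rV[R]_n.+1 -> \bar R :=
  pushforward (lebesgue_measure \x mu) (@rV_cons n).

Let nu : {measure set 'rV[R]_n.+1 -> \bar R} :=
  measure_function_pushforward__canonical__measure_function_Measure
    (lebesgue_measure \x mu) (@measurable_rV_cons n).

HB.instance Definition _ := isMeasure.Build _ _ _ lebesgue_rVS
  (measure0 nu) (measure_ge0 nu) (@measure_semi_sigma_additive _ _ _ nu).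

Let sigma_finite_rVS : sigma_finite [set: 'rV[R]_n.+1] lebesgue_rVS.
Proof.
have /sigma_finiteP[F [TF ndF Foo]] := sigma_finiteT (@lebesgue_measure R).
have /sigma_finiteP[G [TG ndG Goo]] := sigma_finiteT mu.
pose g (x : 'rV[R]_n.+1) : R * 'rV[R]_n :=
  (x ord0 ord0, \row_j x ord0 (lift ord0 j)).
have mg : measurable_fun setT g.
  apply/measurable_fun_pair; first exact: measurable_coord_rV.
  apply: measurable_fun_rVP => i; under eq_fun do rewrite mxE.
  exact: measurable_coord_rV.
have gK p : g (rV_cons p) = p.
  case: p => a x; congr pair.
    rewrite (_ : ord0 = lshift n (ord0 : 'I_1)); last exact: val_inj.
    by apply: etrans (@row_mxEl _ _ 1 n _ _ _ _) _; rewrite mxE mulr1n.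
  apply/rowP => j; rewrite mxE.
  rewrite (_ : lift _ _ = rshift 1 j); last exact: val_inj.
  exact: (@row_mxEr _ _ 1 n).
exists (fun k => g @^-1` (F k `*` G k)).
  apply/esym; rewrite -subTset => x _.
  have [i _ Fi] : (\bigcup_k F k) (g x).1 by rewrite -TF.
  have [j _ Gj] : (\bigcup_k G k) (g x).2 by rewrite -TG.
  exists (maxn i j) => //; split.
    by move: Fi; exact/subsetPset/ndF/leq_maxl.
  by move: Gj; exact/subsetPset/ndG/leq_maxr.
move=> k; have [mF Fk] := Foo k; have [mG Gk] := Goo k; split.
  by rewrite -[X in measurable X]setTI; apply: mg => //; exact: measurableX.
rewrite /lebesgue_rVS /pushforward -comp_preimage.
rewrite (_ : g \o _ = id); last by apply/funext => p; exact: gK.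
by rewrite preimage_id product_measure1E// lte_mul_pinfty// ge0_fin_numE.
Qed.

HB.instance Definition _ :=
  Measure_isSigmaFinite.Build _ _ _ lebesgue_rVS sigma_finite_rVS.

End step.

(* n-dimensional Lebesgue measure, as the n-fold product of the
   one-dimensional one. *)
Fixpoint lebesgue_rV n : {sigma_finite_measure set 'rV[R]_n -> \bar R} :=
  match n with
  | 0 => dirac (0 : 'rV[R]_0)
  | n'.+1 => lebesgue_rVS (lebesgue_rV n')
  end.

End lebesgue_rV.

Definition unit_ball_volume (R : realType) (n : nat) : R :=
  fine (lebesgue_rV n (ecball 0 1)).

Section dual.
Context {R : realType} (Y : normedModType R).

Definition dual_pred : {pred Y -> R^o} :=
  [pred f : Y -> R^o | `[< linear f /\ continuous f >] ].

Record dual_space := Dual { dual_fun :> Y -> R^o ; _ : dual_fun \in dual_pred }.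

HB.instance Definition _ := [isSub for dual_fun].
HB.instance Definition _ := [Choice of dual_space by <:].

Lemma dualP (f : dual_space) : linear f /\ continuous f.
Proof. by case: f => f /= /asboolP. Qed.

Lemma dual_submod_closed : submod_closed dual_pred.
Proof.
split; first by apply/asboolP; split; [move=> a x y; rewrite /= scaler0 addr0|
  move=> x; exact: cvg_cst].
move=> a f g /asboolP[lf cf] /asboolP[lg cg]; apply/asboolP; split.
  move=> b x y /=; rewrite !fctE lf lg !scalerDr !scalerA addrACA.
  by rewrite [a * b]mulrC.
move=> x; apply: cvgD; last exact: cg.
apply: cvgZr; exact: cf.
Qed.

HB.instance Definition _ :=
  GRing.isSubmodClosed.Build R (Y -> R^o) dual_pred dual_submod_closed.
HB.instance Definition _ := [SubChoice_isSubLmodule of dual_space by <:].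

Definition dual_norm (f : dual_space) : R :=
  sup [set `|f y| | y in [set y | `|y| <= 1]].

Let dual_has_sup (f : dual_space) :
  has_sup [set `|f y| | y in [set y | `|y| <= 1]].
Proof.
have [lf cf] := dualP f.
pose lff := GRing.isLinear.Build R Y R^o *:%R f lf.
pose F : {linear Y -> R^o} := HB.pack (f : Y -> R^o) lff.
split; first by exists `|f 0|; exists 0 => //=; rewrite normr0.
have /linear_boundedP : bounded_near F (nbhs 0).
  exact/(linear_bounded_continuous F).
move=> /pinfty_ex_gt0[M M0 FM]; exists M => _ [y /= y1 <-].
by rewrite (le_trans (FM y))// ler_piMr// ltW.
Qed.

Let dual_norm_ub (f : dual_space) y : `|y| <= 1 -> `|f y| <= dual_norm f.
Proof. by move=> y1; apply: (ub_le_sup (dual_has_sup f).2); exists y. Qed.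

Let dual_norm_le (f : dual_space) M :
  (forall y, `|y| <= 1 -> `|f y| <= M) -> dual_norm f <= M.
Proof.
move=> fM; apply: ge_sup; first exact: (dual_has_sup f).1.
by move=> _ [y /= y1 <-]; exact: fM.
Qed.

Let dual_normD f g : dual_norm (f + g) <= dual_norm f + dual_norm g.
Proof.
apply: dual_norm_le => y y1; apply: le_trans (ler_normD (f y) (g y)) _.
by apply: lerD; exact: dual_norm_ub.
Qed.

Let dual_normZ (l : R) (f : dual_space) : dual_norm (l *: f) = `|l| * dual_norm f.
Proof.
apply/eqP; rewrite eq_le; apply/andP; split.
  apply: dual_norm_le => y y1; rewrite (normrM l (f y)).
  by rewrite ler_wpM2l// dual_norm_ub.
have [->|l0] := eqVneq l 0.
  rewrite normr0 mul0r; apply: le_trans (dual_norm_ub _ (y := 0) _) => //.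
  by rewrite normr0.
rewrite -ler_pdivlMl ?normr_gt0//; apply: dual_norm_le => y y1.
rewrite ler_pdivlMl ?normr_gt0// -normrM.
exact: (@dual_norm_ub (l *: f) y).
Qed.

Let dual_norm0_eq0 f : dual_norm f = 0 -> f = 0.
Proof.
move=> f0; apply: val_inj; apply/funext => y /=.
have [lf _] := dualP f.
have f00 : (f : Y -> R^o) 0 = 0.
  by have := lf (-1) 0 0; rewrite scaler0 addr0 scaleN1r addNr.
have [->|y0] := eqVneq y 0; first exact: f00.
have := @dual_norm_ub f (`|y|^-1 *: y).
rewrite normrZ normfV normr_id mulVf ?normr_eq0// => /(_ (lexx _)).
rewrite f0 normr_le0.
have := lf `|y|^-1 y 0; rewrite addr0 f00 addr0 => ->.
by rewrite scaler_eq0 invr_eq0 normr_eq0 (negbTE y0) => /eqP.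
Qed.

HB.instance Definition _ := Lmodule_isNormed.Build R dual_space
  dual_normD dual_normZ dual_norm0_eq0.

End dual.

Section iterated_derivatives.
Context {R : realType} {n : nat} {Y : normedModType R}.
Implicit Types (f g : 'rV[R]_n -> Y) (vs : seq 'rV[R]_n).

Definition iter_derive vs f : 'rV[R]_n -> Y := foldr (fun v g => 'D_v g) f vs.

(* D^i f(x) as a map of i vectors: for f of class C^i,
   D^i f(x)(v_1, ..., v_i) = D_{v_1} (... (D_{v_i} f)) (x). *)
Definition Dfull (i : nat) f (x : 'rV[R]_n) (v : i.-tuple 'rV[R]_n) : Y :=
  iter_derive v f x.

(* C^oo: since the domain has finite dimension, the (j+1)-st Frechet derivative
   of f exists iff all the maps x |-> D^j f(x)(v_1, ..., v_j) are Frechet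
   differentiable. *)
Definition smooth f :=
  forall j (v : j.-tuple 'rV[R]_n) x, differentiable (Dfull f ^~ v) x.

Definition multilinear_norm (i : nat) (psi : i.-tuple 'rV[R]_n -> Y) : R :=
  sup [set `|psi v| | v in [set v | forall j, enorm (tnth v j) <= 1]].

(* sup_x || D^i f(x) ||; only used on test functions, for which the supremum
   is finite. *)
Definition supD (i : nat) f : R :=
  sup [set multilinear_norm (Dfull (i := i) f x) | x in setT].

Definition spt f : set 'rV[R]_n := closure [set x | f x != 0].

(* Multi-indices are finite functions 'I_n -> nat. *)
Definition partialD (xi : {ffun 'I_n -> nat}) f : 'rV[R]_n -> Y :=
  iter_derive (flatten [seq nseq (xi j) (delta_mx ord0 j) | j <- enum 'I_n]) f.

End iterated_derivatives.

Definition Xi (n m : nat) : set {ffun 'I_n -> nat} :=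
  [set xi | (\sum_j xi j)%N = m].
Arguments Xi n m _ : clear implicits.

Definition polynomial_fun (R : realType) (n d : nat) (V : lmodType R)
    (P : 'rV[R]_n -> V) : Prop :=
  exists c : {ffun 'I_n -> 'I_d.+1} -> V, forall x,
    P x = \sum_(xi : {ffun 'I_n -> 'I_d.+1} | (\sum_j xi j <= d)%N) (\prod_j x ord0 j ^+ xi j) *: c xi.

Definition convolution (R : realType) (n : nat) (f g : 'rV[R]_n -> R)
    (x : 'rV[R]_n) : R :=
  (\int[lebesgue_rV n]_b (f b * g (x - b)))%R.

Section smooth_theory.
Context {R : realType} {n : nat} {Y : normedModType R}.
Implicit Types (f g : 'rV[R]_n -> Y) (vs : seq 'rV[R]_n).

Lemma iter_derive_cat us vs f : iter_derive (us ++ vs) f = iter_derive us (iter_derive vs f).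
Proof. by rewrite /iter_derive foldr_cat. Qed.

Lemma smoothP f : smooth f <-> forall vs x, differentiable (iter_derive vs f) x.
Proof.
split=> sf; last by move=> j v x; exact: sf.
by move=> vs x; exact: (sf _ (in_tuple vs) x).
Qed.

Lemma smooth_iter_derive vs f : smooth f -> smooth (iter_derive vs f).
Proof. by move=> /smoothP sf; apply/smoothP=> us x; rewrite -iter_derive_cat. Qed.

Lemma iter_derive_linear vs a f g : smooth f -> smooth g ->
  iter_derive vs (a *: f + g) = a *: iter_derive vs f + iter_derive vs g.
Proof.
move=> /smoothP sf /smoothP sg; elim: vs => //= v vs ->.
apply/funext => x; rewrite deriveD ?deriveZ//.
  exact: diff_derivable.
- by apply: diff_derivable; apply: differentiableZ; exact: sf.
- by apply: diff_derivable; exact: sg.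
Qed.

Lemma smooth_linear a f g : smooth f -> smooth g -> smooth (a *: f + g).
Proof.
move=> sf sg; apply/smoothP => vs x; rewrite iter_derive_linear//.
apply: differentiableD; first by apply: differentiableZ; move/smoothP: sf.
by move/smoothP: sg.
Qed.

Lemma iter_derive0 vs : iter_derive vs (0 : 'rV[R]_n -> Y) = 0.
Proof.
elim: vs => //= v vs ->; apply/funext => x; exact: derive_cst.
Qed.

Lemma smooth0 : smooth (0 : 'rV[R]_n -> Y).
Proof.
by apply/smoothP=> vs x; rewrite iter_derive0; exact: differentiable_cst.
Qed.

Lemma spt_derive v f : spt ('D_v f) `<=` spt f.
Proof.
rewrite {1}/spt closureE; apply: smallest_sub; first exact: closed_closure.
move=> x; apply: contraPP => xf.
have : \forall y \near x, f y = 0.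
  have : nbhs x (~` spt f) by apply: open_nbhs_nbhs; split => //;
    exact/closed_openC/closed_closure.
  apply: filterS => y yf; apply: contrapT => fy0; apply: yf.
  by apply: subset_closure; exact/eqP.
move=> fx; apply/negP; rewrite negbK; apply/eqP.
rewrite (near_eq_derive _ (g := cst 0))//; exact: derive_cst.
Qed.

End smooth_theory.

Section test_functions.
Context {R : realType} (n : nat) (Y : normedModType R).

Definition testfun_pred : {pred 'rV[R]_n -> Y} :=
  [pred f : 'rV[R]_n -> Y | `[< smooth f /\ compact (spt f) >] ].

Record testfun :=
  TestFun { testfun_fun :> 'rV[R]_n -> Y ; _ : testfun_fun \in testfun_pred }.

HB.instance Definition _ := [isSub for testfun_fun].
HB.instance Definition _ := [Choice of testfun by <:].

Lemma testfunP (f : testfun) : smooth f /\ compact (spt f).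
Proof. by case: f => f /= /asboolP. Qed.

Lemma spt_linear a (f g : 'rV[R]_n -> Y) :
  spt (a *: f + g) `<=` spt f `|` spt g.
Proof.
rewrite {1}/spt closureE; apply: smallest_sub.
  by apply: closedU; exact: closed_closure.
move=> x /= fgx; have [fx|fx] := eqVneq (f x) 0; last first.
  by left; exact: subset_closure.
right; apply: subset_closure => /=; apply: contra_neq fgx => gx.
by rewrite !fctE fx gx scaler0 addr0.
Qed.

Lemma testfun_submod_closed : submod_closed testfun_pred.
Proof.
split.
  apply/asboolP; split; first exact: smooth0.
  rewrite /spt (_ : [set x | _] = set0) ?closure0; first exact: compact0.
  by rewrite -subset0 => x /=; rewrite eqxx.
move=> a f g /asboolP[sf cf] /asboolP[sg cg]; apply/asboolP; split.
  exact: smooth_linear.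
apply: subclosed_compact (compactU cf cg) (@spt_linear a f g).
exact: closed_closure.
Qed.

HB.instance Definition _ := GRing.isSubmodClosed.Build R ('rV[R]_n -> Y)
  testfun_pred testfun_submod_closed.
HB.instance Definition _ := [SubChoice_isSubLmodule of testfun by <:].

End test_functions.
Arguments testfun_pred {R} n Y _.

Section operations.
Context {R : realType} {n : nat} {Y : normedModType R}.

Lemma testfun_iter_derive (vs : seq 'rV[R]_n) (f : testfun n Y) :
  iter_derive vs f \in testfun_pred n Y.
Proof.
have [sf cf] := testfunP f; apply/asboolP; split; first exact: smooth_iter_derive.
suff : spt (iter_derive vs f) `<=` spt f.
  by apply: subclosed_compact cf; exact: closed_closure.
by elim: vs => //= v vs; apply: subset_trans; exact: spt_derive.
Qed.

Definition testfun_partialD (xi : {ffun 'I_n -> nat}) (f : testfun n Y) :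
  testfun n Y := TestFun (testfun_iter_derive _ f : partialD xi f \in _).

Lemma iter_derive_shift_scale vs (f : testfun n R^o) (a : 'rV[R]_n) (y : Y) :
  iter_derive vs (fun b => f (b - a) *: y) = fun b => iter_derive vs f (b - a) *: y.
Proof.
have [/smoothP sf _] := testfunP f.
elim: vs => //= v vs ->; apply/funext => x.
apply: cvg_lim => //=.
have /cvg_ex[l] := @diff_derivable _ _ _ _ _ v (sf vs (x - a)).
move=> fl; have := fl => /cvg_lim; rewrite -/(derive _ _ _) => -> //.
have : h^-1 *: (iter_derive vs f (h *: v + (x - a)) - iter_derive vs f (x - a)) *: y
   @[h --> 0^'] --> l *: y.
  by apply: cvgZl; exact: fl.
apply: cvg_trans; apply: near_eq_cvg; near=> h.
by rewrite /= -scalerBl scalerA addrA.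
Unshelve. all: by end_near. Qed.

Lemma testfun_shift_scale_subproof (f : testfun n R^o) (a : 'rV[R]_n) (y : Y) :
  (fun b => f (b - a) *: y) \in testfun_pred n Y.
Proof.
have [/smoothP sf cf] := testfunP f; apply/asboolP; split.
  apply/smoothP => vs x; rewrite iter_derive_shift_scale.
  apply: differentiableZl.
  apply: (@differentiable_comp _ _ _ _ (fun b => b - a) (iter_derive vs f)).
    exact: differentiableB.
  exact: sf.
have cb : compact [set b + a | b in spt f].
  apply: continuous_compact => //.
  apply: continuous_subspaceT => b.
  by apply: differentiable_continuous; exact: differentiableD.
apply: (subclosed_compact (@closed_closure _ _) cb).
rewrite {1}/spt closureE; apply: smallest_sub.
  by apply: compact_closed cb; exact: norm_hausdorff.
move=> b /= fb; exists (b - a); last by rewrite subrK.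
apply: subset_closure => /=; apply: contra_neq fb => ->.
by rewrite scale0r.
Qed.

Definition testfun_shift_scale f a y : testfun n Y :=
  TestFun (testfun_shift_scale_subproof f a y).

End operations.

Section testfun_bounded.
Context {R : realType} {n : nat} {Y : normedModType R}.
Implicit Types (f g : testfun n Y) (v : 'rV[R]_n) (vs : seq 'rV[R]_n).

Lemma iter_derive_lincomb vs (I : Type) (r : seq I) (c : I -> R)
    (F : I -> testfun n Y) :
  iter_derive vs (\sum_(i <- r) c i *: F i : testfun n Y) =
  \sum_(i <- r) c i *: iter_derive vs (F i).
Proof.
elim: r => [|i r ih]; first by rewrite !big_nil iter_derive0.
rewrite !big_cons -ih -iter_derive_linear//.
- by have [] := testfunP (F i).
- by have [] := testfunP (\sum_(j <- r) c j *: F j).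
Qed.

Lemma derive_coord f v : 'D_v f =
  \sum_j v ord0 j *: 'D_(delta_mx ord0 j) f :> ('rV[R]_n -> Y).
Proof.
have [/smoothP sf _] := testfunP f.
apply/funext => x; rewrite fct_sumE.
have df : differentiable f x := sf [::] x.
rewrite deriveE// [v in LHS]row_sum_delta linear_sum/=.
by apply: eq_bigr => j _; rewrite linearZ/= !fctE deriveE.
Qed.

Lemma coord_le_enorm v j : `|v ord0 j| <= enorm v.
Proof.
rewrite -sqrtr_sqr /enorm ler_sqrt ?sumr_ge0//; last first.
  by move=> *; exact: sqr_ge0.
by rewrite (bigD1 j)//= lerDl sumr_ge0// => *; exact: sqr_ge0.
Qed.

Lemma testfun_bounded f : exists M, forall x, `|f x| <= M.
Proof.
have [/smoothP sf cf] := testfunP f.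
have : compact (f @` spt f).
  apply: continuous_compact cf; apply: continuous_subspaceT => x.
  exact: (@differentiable_continuous _ _ _ _ _ (sf [::] x)).
move=> /compact_bounded/pinfty_ex_gt0[M M0 fM]; exists M => x.
have [->|fx] := eqVneq (f x) 0; first by rewrite normr0 ltW.
by apply: fM; exists x => //; exact: subset_closure.
Qed.

Lemma testfun_Dfull_bounded i f : exists M,
  forall (v : i.-tuple 'rV[R]_n), (forall j, enorm (tnth v j) <= 1) ->
  forall x, `|Dfull f x v| <= M.
Proof.
suff [M fM] : exists M, forall vs, size vs = i ->
    (forall v, v \in vs -> enorm v <= 1) ->
    forall x, `|iter_derive vs f x| <= M.
  exists M => v v1 x; apply: fM; first exact: size_tuple.
  by move=> w /tnthP[j ->].
elim: i f => [|i ih] f.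
  have [M fM] := testfun_bounded f.
  by exists M => vs /size0nil -> _ x; exact: fM.
pose F j : testfun n Y :=
  TestFun (testfun_iter_derive [:: delta_mx ord0 j] f).
have /choice[M FM] := fun j => ih (F j).
exists (\sum_j M j) => vs; elim/last_ind: vs => // vs v _.
rewrite size_rcons => -[svs] vs1 x.
rewrite -cats1 iter_derive_cat /=.
rewrite derive_coord.
have -> : \sum_j v ord0 j *: 'D_(delta_mx ord0 j) f =
    (\sum_j v ord0 j *: F j : testfun n Y) :> ('rV[R]_n -> Y).
  by apply/esym; rewrite -[LHS]/(iter_derive [::] _) iter_derive_lincomb.
rewrite iter_derive_lincomb fct_sumE (le_trans (ler_norm_sum _ _ _))//.
apply: ler_sum => j _; rewrite normrZ.
have M0 : `|iter_derive vs (F j) x| <= M j.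
  by apply: FM => // w wvs; apply: vs1; rewrite mem_rcons inE wvs orbT.
apply: le_trans M0; rewrite ler_piMl// (le_trans (coord_le_enorm _ _))//.
by apply: vs1; rewrite mem_rcons mem_head.
Qed.

End testfun_bounded.

Section test_function_topology.
Context {R : realType} {n : nat} {Y : normedModType R}.
Implicit Types (K : set 'rV[R]_n) (W U : set (testfun n Y)) (f g : testfun n Y).

(* W contains a neighbourhood of 0 of D_K for the topology of uniform
   convergence of all derivatives. *)
Definition DK_nbhs0 K W : Prop := exists (N : nat) (e : R), 0 < e /\
  forall f, spt f `<=` K ->
    (forall i (v : i.-tuple 'rV[R]_n), (i <= N)%N ->
       (forall j, enorm (tnth v j) <= 1) -> forall x, `|Dfull f x v| <= e) ->
  W f.

(* Basic neighbourhoods of 0 for the inductive limit topology, i.e. the finest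
   locally convex topology for which all inclusions D_K -> D, K compact, are
   continuous: absolutely convex sets whose traces on every D_K are
   neighbourhoods of 0. *)
Definition ind_nbhs0 W : Prop :=
  (forall (a b : R) f g, `|a| + `|b| <= 1 -> W f -> W g ->
     W (a *: f + b *: g)) /\
  (forall K, compact K -> DK_nbhs0 K W).

Definition testfun_nbhs f : set_system (testfun n Y) :=
  filter_from ind_nbhs0 (fun W => [set f + g | g in W]).

HB.instance Definition _ := hasNbhs.Build (testfun n Y) testfun_nbhs.

Lemma Dfull_lin i a b f g (v : i.-tuple 'rV[R]_n) x :
  Dfull (a *: f + b *: g : testfun n Y) x v = a *: Dfull f x v + b *: Dfull g x v.
Proof.
have [[sf _] [sg _]] := (testfunP f, testfunP g).
have [sbg _] := testfunP (b *: g).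
rewrite /Dfull (iter_derive_linear v a sf sbg).
have e : (b *: g : testfun n Y) = b *: (g : 'rV[R]_n -> Y) + 0
  :> ('rV[R]_n -> Y) by rewrite addr0.
by rewrite e (iter_derive_linear v b sg (@smooth0 _ _ _)) iter_derive0 addr0.
Qed.

Lemma ind_nbhs0_0 W : ind_nbhs0 W -> W 0.
Proof.
move=> [_ /(_ set0 compact0)[N [e [e0 WK]]]]; apply: WK.
  rewrite /spt (_ : [set x | _] = set0) ?closure0//.
  by rewrite -subset0 => x /=; rewrite eqxx.
by move=> i v _ _ x; rewrite /Dfull iter_derive0 normr0 ltW.
Qed.

Lemma ind_nbhs0T : ind_nbhs0 setT.
Proof. by split => // K _; exists 0%N, 1. Qed.

Lemma ind_nbhs0I W1 W2 : ind_nbhs0 W1 -> ind_nbhs0 W2 -> ind_nbhs0 (W1 `&` W2).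
Proof.
move=> [c1 n1] [c2 n2]; split.
  by move=> a b f g ab [? ?] [? ?]; split; [exact: c1|exact: c2].
move=> K cK; have [N1 [e1 [e10 H1]]] := n1 _ cK.
have [N2 [e2 [e20 H2]]] := n2 _ cK.
exists (maxn N1 N2), (Num.min e1 e2); split; first by rewrite lt_min e10.
move=> f fK fe; split.
- apply: H1 => // i v iN v1 x; rewrite (le_trans (fe _ _ _ v1 x))//.
    by rewrite (leq_trans iN)// leq_maxl.
  by rewrite ge_min lexx.
- apply: H2 => // i v iN v1 x; rewrite (le_trans (fe _ _ _ v1 x))//.
    by rewrite (leq_trans iN)// leq_maxr.
  by rewrite ge_min lexx orbT.
Qed.

Lemma ind_nbhs0Z W (c : R) : 0 < c -> ind_nbhs0 W ->
  ind_nbhs0 [set f | W (c *: f)].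
Proof.
move=> c0 [cW nW]; split.
  move=> a b f g ab /= Wf Wg; rewrite scalerDr !scalerA ![c * _]mulrC -!scalerA.
  exact: cW.
move=> K cK; have [N [e [e0 H]]] := nW _ cK.
exists N, (c^-1 * e); split; first by rewrite mulr_gt0 ?invr_gt0.
move=> f fK fe; apply: H.
  apply: subset_trans fK; apply: closureS => x /=; apply: contra_neq => fx.
  by rewrite !fctE fx scaler0.
move=> i v iN v1 x; rewrite -[c *: f]addr0 -[X in _ + X](scaler0 _ 0).
rewrite Dfull_lin scale0r addr0 normrZ gtr0_norm// -ler_pdivlMl//.
exact: fe.
Qed.

Lemma ind_nbhs0_half W : ind_nbhs0 W ->
  exists2 W', ind_nbhs0 W' & forall f g, W' f -> W' g -> W (f + g).
Proof.
move=> iW; exists [set f | W (2 *: f)]; first exact: ind_nbhs0Z.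
move=> f g /= Wf Wg.
have -> : f + g = 2^-1 *: (2 *: f) + 2^-1 *: (2 *: g).
  by rewrite !scalerA mulVf// !scale1r.
by apply: iW.1 => //; rewrite gtr0_norm ?invr_gt0// [leRHS](splitr 1) !div1r.
Qed.

Lemma testfun_nbhs_filter f : ProperFilter (nbhs f).
Proof.
apply: filter_from_proper; last first.
  by move=> W iW; exists (f + 0); exists 0 => //; exact: ind_nbhs0_0.
apply: filter_from_filter; first by exists setT; exact: ind_nbhs0T.
move=> W1 W2 i1 i2; exists (W1 `&` W2); first exact: ind_nbhs0I.
by move=> _ [g [W1g W2g] <-]; split; exists g.
Qed.

Lemma testfun_nbhs_singleton f U : nbhs f U -> U f.
Proof.
move=> [W iW]; apply; exists 0; last by rewrite addr0.
exact: ind_nbhs0_0.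
Qed.

Lemma testfun_nbhs_nbhs f U : nbhs f U -> nbhs f (nbhs^~ U).
Proof.
move=> [W iW WU]; have [W' iW' W'W] := ind_nbhs0_half iW.
exists W' => // _ [g W'g <-]; exists W' => // _ [h W'h <-].
by apply: WU; exists (g + h); [exact: W'W|rewrite addrA].
Qed.

HB.instance Definition _ := Nbhs_isNbhsTopological.Build (testfun n Y)
  testfun_nbhs_filter testfun_nbhs_singleton testfun_nbhs_nbhs.

Let testfun_add_continuous :
  continuous (fun p : testfun n Y * testfun n Y => p.1 + p.2).
Proof.
move=> [f g] U [W iW WU]; have [W' iW' W'W] := ind_nbhs0_half iW.
exists ([set f + h | h in W'], [set g + h | h in W']) => /=.
  by split; exists W'.
move=> _ [/= [h1 Wh1 <-] [h2 Wh2 <-]]; apply: WU.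
by exists (h1 + h2); [exact: W'W|rewrite addrACA].
Qed.

Lemma ind_nbhs0_absorb W f : ind_nbhs0 W ->
  exists2 d : R, 0 < d & forall c : R, `|c| <= d -> W (c *: f).
Proof.
move=> [cW nW]; have [_ cf] := testfunP f.
have [N [e [e0 H]]] := nW _ cf.
have /choice[M fM] := fun i => testfun_Dfull_bounded i f.
pose B := 1 + \sum_(i < N.+1) `|M i|.
have B0 : 0 < B by rewrite ltr_pwDl// sumr_ge0.
exists (e / B); first exact: divr_gt0.
move=> c cd; apply: H.
  apply: closureS => x /=; apply: contra_neq => fx.
  by rewrite !fctE fx scaler0.
move=> i v iN v1 x; rewrite -[c *: f]addr0 -[X in _ + X](scaler0 _ 0).
rewrite Dfull_lin scale0r addr0 normrZ.
rewrite (le_trans (ler_wpM2l _ (fM i v v1 x)))//.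
apply: (@le_trans _ _ (`|c| * B)); last by rewrite -ler_pdivlMr.
rewrite ler_wpM2l// (le_trans (ler_norm _))//.
rewrite /B (bigD1 (Ordinal (iN : (i < N.+1)%N)))//= addrCA lerDl.
by rewrite addr_ge0// sumr_ge0.
Qed.

Let testfun_scale_continuous :
  continuous (fun z : R^o * testfun n Y => z.1 *: z.2).
Proof.
move=> [r f] U [W iW WU]; have [W' iW' W'W] := ind_nbhs0_half iW.
have [d d0 Wd] := ind_nbhs0_absorb f iW'.
pose c := `|r| + d; have c0 : 0 < c by rewrite ltr_wpDl.
exists (ball (r : R^o) d, [set f + g | g in [set g | W' (c *: g)]]) => /=.
  split; first exact: nbhsx_ballx.
  by exists [set g | W' (c *: g)] => //; exact: ind_nbhs0Z.
move=> [s _] [/= rs [g Wg <-]]; apply: WU => /=.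
exists ((s - r) *: f + s *: g).
  apply: W'W.
    by apply: Wd; rewrite distrC; exact: ltW.
  have -> : s *: g = (s / c) *: (c *: g) + 0 *: (c *: g).
    by rewrite scale0r addr0 scalerA divfK// gt_eqF.
  apply: iW'.1 => //; rewrite normr0 addr0 normrM normfV (gtr0_norm c0).
  rewrite ler_pdivrMr// mul1r /c -[s](subrK r) addrC (le_trans (ler_normD _ _))//.
  by rewrite lerD// distrC; exact: ltW.
by rewrite scalerBl scalerDr addrA [_ + (_ - _)]addrC subrK.
Qed.

Let testfun_locally_convex : exists2 B : set_system (testfun n Y),
  (forall b, b \in B -> convex_set b) & basis B.
Proof.
exists [set U | open U /\ convex_set U].
  by move=> b; rewrite inE => -[].
split; first by move=> b [].
move=> f U [W iW WU].
pose V := [set f + g | g in W]; exists (V°); last first.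
  by move=> g /interior_subset; exact: WU.
split; last by exists W.
split; first exact: open_interior.
apply/convex_setW => g h; rewrite !inE => -[W1 i1 gV] [W2 i2 hV] l l0 l1.
rewrite inE; exists (W1 `&` W2); first exact: ind_nbhs0I.
move=> _ [w [W1w W2w] <-].
have [g' Wg' gE] : V (g + w) by apply: gV; exists w.
have [h' Wh' hE] : V (h + w) by apply: hV; exists w.
exists (l%:num *: g' + (1 - l%:num) *: h').
  apply: iW.1 => //.
  rewrite (ger0_norm (ltW l0)) (@ger0_norm _ (1 - _)) ?subr_ge0; last exact: ltW.
  by rewrite addrC subrK.
have lE (u : testfun n Y) : l%:num *: u + (1 - l%:num) *: u = u.
  by rewrite -scalerDl addrC subrK scale1r.
by rewrite -{1}(lE f) addrACA -!scalerDr gE hE !scalerDr addrACA lE.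
Qed.

HB.instance Definition _ := PreTopologicalLmod_isTvs.Build R (testfun n Y)
  testfun_add_continuous testfun_scale_continuous testfun_locally_convex.

End test_function_topology.

Definition distrD (R : realType) (n : nat) (Y : normedModType R)
    (xi : {ffun 'I_n -> nat}) (T : testfun n Y -> R) (phi : testfun n Y) : R :=
  (-1) ^+ (\sum_j xi j)%N * T (testfun_partialD xi phi).

Definition Gamma_const (R : realType) (n i k : nat) (r : R)
    (C : set 'rV[R]_n) (Phi : testfun n R^o) (m : nat) : R :=
  (n%:R * unit_ball_volume R n * supD i Phi) ^+ (k - m) *
  \prod_(1 <= mu < (k - m).+1) (2 * mu%:R * r + ediam C) ^+ (1 + n + i).

(* Main.v *)
(* Put E_xi = D^xi T - int <., D^xi P>.  Since Phi reproduces polynomials, the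
   choice of P gives E_xi (Phi (. - a) y) = 0 for every y, and D_j E_xi is
   E_(xi + e_j).  The bound for |xi| = m follows from that for m + 1 on the
   r-neighbourhood of the supporting set: with the two test functions
     F_w (z) = Phi (z - a) theta (z - w)   and   F_w (z + w) = Phi (z + w - a) theta (z),
   the mean value inequality in t for E_xi (F_w (. + t w)) bounds their difference
   under E_xi by n |w| lambda sup |D^i F_w|, and Leibniz' rule together with
   |D^l theta| <= d^(i - l) sup |D^i theta| (d a diameter of the support, and
   likewise for Phi with 2 r) bounds |D^i F_w| by L^i sup |D^i Phi| sup |D^i theta|
   for L = 2 r + d.  Both functions vanish unless |w| <= L, a set of volume
   alpha(n) L^n.  Integration over w turns the second one into theta, because
   int Phi = 1, and the first one into Phi (. - a) int theta, which E_xi kills.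

   No Y-valued integral is needed: the integral over w is replaced by lattice sums
   of mesh h, whose limit is controlled by the fact that the lattice sum of a
   derivative D_j f telescopes up to O(h).  The same fact yields translation
   invariance and integration by parts for integrals of test functions. *)
From HB Require Import structures.
Require Import Defs.
From mathcomp Require Import all_boot all_order all_algebra.
From mathcomp Require Import all_classical all_reals all_analysis.
From mathcomp Require Import measurable_realfun.
From mathcomp Require Import lra ring zify.

Set Implicit Arguments.
Unset Strict Implicit.
Unset Printing Implicit Defensive.

Import Order.TTheory GRing.Theory Num.Theory.
Import numFieldNormedType.Exports.

Local Open Scope classical_set_scope.
Local Open Scope ring_scope.

(** * Mean value inequality and second derivatives *)

(** E is known to be continuous only on each D_K, so lattice sums of test functions must converge
    together with their derivatives up to some order N. Write S_h f (z) for |h|^n times the sum of f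
    over the lattice shifted by z. Its derivatives are lattice sums of derivatives of f, hence O(h),
    so S_h f is constant up to O(h) in C^N on bounded sets. Summing over w, the second functions
    give S_h Phi (z - a) theta (z), where S_h Phi is close to 1. The first ones give Phi (z - a)
    S_{-h} theta (z), close to Phi (z - a) y for y = S_{-h} theta (0); E kills this product exactly,
    whatever y is, so nothing has to converge in Y.

    Each factor L^(1 + n + i) collects L from |w| <= L, L^n from the volume and L^i from Leibniz'
    rule. After s steps the supports lie in the s r neighbourhood of C, whose diameter is at most 2
    s r + diam C; thus L = 2 (s + 1) r + diam C. Convexity of C keeps the supports of F_w (. + t w)
    within distance r. *)

Section mean_value.
Context {R : realType} {Y : normedModType R}.

(** A supremum argument, valid in any normed space: with a slack [e] the bound can be carried past
    every point of [0, 1). The increments [s] have both signs, because the supremum is approached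
    from the left and left to the right. *)
Lemma local_lipschitz (g : R -> Y) (M : R) :
  (forall t : R, 0 <= t <= 1 -> forall e : R, 0 < e ->
    \forall s \near (0 : R), `|g (t + s) - g t| <= (M + e) * `|s|) ->
  `|g 1 - g 0| <= M.
Proof.
move=> gM; apply/ler_addgt0Pr => e e0.
pose A := [set t : R | 0 <= t <= 1 /\ `|g t - g 0| <= (M + e) * t].
have A0 : A 0 by split; rewrite ?lexx ?ler01// subrr normr0 mulr0.
have ubA : ubound A 1 by move=> t [/andP[]].
have hA : has_sup A by split; [exists 0 | exists 1].
set c := sup A.
have c0 : 0 <= c by apply: ub_le_sup => //; exact: hA.2.
have c1 : c <= 1 by apply: ge_sup => //; exists 0.
have c01 : 0 <= c <= 1 by rewrite c0.
have /nbhs_normP[d /= d0 gd] := gM c c01 e e0.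
have gd' s : `|s| < d -> `|g (c + s) - g c| <= (M + e) * `|s|.
  by move=> sd; apply: gd => /=; rewrite sub0r normrN.
have [t At] := sup_adherent d0 hA; rewrite -/c => ct.
have tc : t <= c by apply: ub_le_sup => //; exact: hA.2.
(* The local bound at [c] with the increment [t - c] extends the estimate to the supremum itself. *)
have Ac : `|g c - g 0| <= (M + e) * c.
  have gtc : `|g t - g c| <= (M + e) * (c - t).
    have := gd' (t - c); rewrite [c + _]addrC subrK distrC ger0_norm ?subr_ge0//.
    by apply; lra.
  have -> : (M + e) * c = (M + e) * (c - t) + (M + e) * t by ring.
  rewrite -(subrKA (g t)) (le_trans (ler_normD _ _))// lerD//; last exact: At.2.
  by rewrite distrC.
move: c1; rewrite le_eqVlt => /predU1P[c1|c1]; first by move: Ac; rewrite c1 mulr1.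
exfalso.
(* If c < 1, a step [s] to the right produces a point of [A] beyond its supremum. *)
pose s := Num.min (d / 2) (1 - c).
have s0 : 0 < s by rewrite lt_min subr_gt0 c1 divr_gt0.
have sd : s < d by rewrite gt_min; apply/orP; left; lra.
have s1 : s <= 1 - c by rewrite ge_min lexx orbT.
have : A (c + s).
  split; first by apply/andP; split; lra.
  rewrite -(subrKA (g c)) mulrDr addrC (le_trans (ler_normD _ _))// lerD//.
  by have := gd' s; rewrite (gtr0_norm s0); exact.
move=> /(ub_le_sup hA.2); rewrite -/c; lra.
Qed.

(** The reference slope [l] covers both the Lipschitz bound (l = 0) and the first Taylor remainder
    (l the derivative at [x]). It is absorbed by subtracting [t *: l] from the curve. *)
Lemma mean_value (V : normedModType R) (f : V -> Y) (x v : V) (l : Y) (M : R) :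
  (forall t : R, 0 <= t <= 1 -> derivable f (x + t *: v) v) ->
  (forall t : R, 0 <= t <= 1 -> `|'D_v f (x + t *: v) - l| <= M) ->
  `|f (x + v) - f x - l| <= M.
Proof.
move=> df fM; pose g (t : R) := f (x + t *: v) - t *: l.
have -> : f (x + v) - f x - l = g 1 - g 0.
  by rewrite /g !scale1r !scale0r addr0 subr0 addrAC.
apply: local_lipschitz => t t01 e e0.
have /= dft := df t t01.
have : h^-1 *: (f (h *: v + (x + t *: v)) - f (x + t *: v)) @[h --> 0^'] -->
  'D_v f (x + t *: v) by apply: dft.
move=> /cvgrPdist_lt/(_ e e0) /=; rewrite near_withinE /= => H.
apply: filterS H => s H.
have [->|s0] := eqVneq s 0; first by rewrite addr0 subrr !normr0 mulr0.
have {}H := H s0.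
rewrite /g; set u := s^-1 *: _ in H.
have -> : f (x + (t + s) *: v) - (t + s) *: l - (f (x + t *: v) - t *: l) =
    s *: (u - l).
  rewrite scalerBr /u scalerA mulfV// scale1r.
  rewrite (_ : s *: v + (x + t *: v) = x + (t + s) *: v); last first.
    by rewrite scalerDl addrC addrA.
  rewrite [(t + s) *: l]scalerDl opprB opprD [t *: l - _]addrC addrACA; congr (_ + _).
  by rewrite addrAC addNr add0r.
rewrite normrZ mulrC ler_wpM2r//.
rewrite -(subrKA ('D_v f (x + t *: v))) (le_trans (ler_normD _ _))// addrC lerD//.
  exact: fM.
by rewrite distrC ltW.
Qed.

End mean_value.

Section second_derivatives.
Context {R : realType} {V Y : normedModType R}.
Implicit Types (f : V -> Y) (x u v : V).

Lemma derive_dirZ f x v (s : R) : differentiable f x ->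
  'D_(s *: v) f x = s *: 'D_v f x.
Proof. by move=> df; rewrite !deriveE// linearZ. Qed.

Lemma derive_lipschitz f x v (s M : R) : (forall y, differentiable f y) ->
  (forall y, `|'D_v f y| <= M) -> `|f (x + s *: v) - f x| <= `|s| * M.
Proof.
move=> df fM; rewrite -[_ - f x]subr0; apply: mean_value => t _.
  exact: diff_derivable.
by rewrite subr0 derive_dirZ// normrZ ler_wpM2l.
Qed.

(** [mean_value] with slope [s *: 'D_v f x], whose deviation along the segment is controlled by the
    Lipschitz bound for ['D_v f]. The factor 1/2 is given up. *)
Lemma taylor1 f x v (s M : R) : (forall y, differentiable f y) ->
  (forall y, differentiable ('D_v f) y) -> (forall y, `|'D_v ('D_v f) y| <= M) ->
  `|f (x + s *: v) - f x - s *: 'D_v f x| <= s ^+ 2 * M.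
Proof.
move=> df ddf fM; apply: mean_value => t /andP[t0 t1].
  exact: diff_derivable.
rewrite derive_dirZ// -scalerBr normrZ scalerA -real_normK ?num_real//.
rewrite expr2 -mulrA ler_wpM2l//.
apply: (le_trans (derive_lipschitz _ _ ddf fM)).
rewrite normrM (ger0_norm t0) -mulrA ler_piMl// mulr_ge0//.
exact: le_trans (fM x).
Qed.

Lemma differentiable_shiftr f (c x : V) :
  (forall y, differentiable f y) -> differentiable (fun z => f (z + c)) x.
Proof.
by move=> df; exact: (@differentiable_comp _ _ _ _ (fun z => z + c) f).
Qed.

Lemma derive_shiftr f (c v x : V) : 'D_v (fun z => f (z + c)) x = 'D_v f (x + c).
Proof. by rewrite /derive /=; under [in LHS]eq_fun do rewrite -addrA. Qed.

(* Both mixed derivatives are limits of the same second difference quotient. *)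
Lemma derive_diff2 f x u v : (forall y, differentiable f y) ->
  (forall y, differentiable ('D_v f) y) -> forall e : R, 0 < e ->
  \forall h \near (0 : R),
  `|f (x + h *: v + h *: u) - f (x + h *: v) - (f (x + h *: u) - f x)
     - (h ^+ 2) *: 'D_u ('D_v f) x| <= h ^+ 2 * e.
Proof.
move=> df ddf e e0.
(* After scaling by |h|, [B] dominates the sum of the norms of the two increments at which ['D_v f]
   is linearised below; the 1 keeps it positive. *)
pose B := 2 * `|v| + `|u| + 1.
have B0 : 0 < B by rewrite ltr_wpDl// addr_ge0// mulr_ge0.
have eB0 : 0 < e / B by rewrite divr_gt0.
have /nbhs_normP[d /= d0 Hd] :
    \forall y \near (0 : V), `|'D_v f (y + x) - 'D_v f x - 'd ('D_v f) x y| <= e / B * `|y|.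
  have /eqaddoP/(_ _ eB0) := diff_locally (ddf x).
  by apply: filterS => y; rewrite !fctE /= opprD addrA.
have {}Hd y : `|y| < d -> `|'D_v f (x + y) - 'D_v f x - 'd ('D_v f) x y| <= e / B * `|y|.
  by move=> yd; rewrite [x + y]addrC; apply: Hd; rewrite /= sub0r normrN.
have dB0 : 0 < d / B by rewrite divr_gt0.
apply/nbhs_normP; exists (d / B) => // h /=; rewrite sub0r normrN => hd.
have hyd (t : R) : 0 <= t <= 1 -> `|t *: (h *: v)| <= `|h| * `|v|.
  by move=> /andP[t0 t1]; rewrite !normrZ ger0_norm// ler_piMl// mulr_ge0.
have hB : `|h| * B < d by rewrite -ltr_pdivlMr.
have hBE : `|h| * B = `|h| * `|v| + `|h| * `|v| + `|h| * `|u| + `|h| by rewrite /B; ring.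
have hv0 : 0 <= `|h| * `|v| by rewrite mulr_ge0.
have hu0 : 0 <= `|h| * `|u| by rewrite mulr_ge0.
have h0 : 0 <= `|h| by [].
(* The second difference is the increment of [g] over [h *: v], and the derivative of [g] along [v]
   is a first difference of ['D_v f]. *)
pose g y := f (y + h *: u) - f y.
have dg y : differentiable g y by apply: differentiableB => //; exact: differentiable_shiftr.
rewrite -[_ - f (x + h *: v)]/(g (x + h *: v)) -[_ - f x]/(g x).
apply: mean_value => t t01; first exact: diff_derivable.
rewrite derive_dirZ// /g deriveB; last 2 first.
- by apply: diff_derivable; exact: differentiable_shiftr.
- exact: diff_derivable.
rewrite derive_shiftr -addrA.
set p := t *: (h *: v).
have pE : `|p| <= `|h| * `|v| by exact: hyd.
have pd : `|p| < d by lra.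
have qE : `|p + h *: u| <= `|h| * `|v| + `|h| * `|u|.
  by rewrite (le_trans (ler_normD _ _))// lerD// normrZ.
have qd : `|p + h *: u| < d by lra.
have := Hd _ qd; have := Hd _ pd.
have -> : 'd ('D_v f) x (p + h *: u) = 'd ('D_v f) x p + h *: 'D_u ('D_v f) x.
  by rewrite linearD [X in _ + X = _]linearZ/= deriveE.
set a := 'D_v f (x + p); set b := 'D_v f (x + _); set c := 'D_v f x; set l := 'D_u _ _.
set dp := 'd _ _ _ => Hp Hq.
rewrite expr2 -scalerA -scalerBr normrZ -[h * h]expr2 -real_normK ?num_real// expr2 -mulrA.
rewrite ler_wpM2l//.
have -> : b - a - h *: l = (b - c - (dp + h *: l)) - (a - c - dp).
  rewrite opprB [- (dp + _)]opprD !addrA [b - c - dp - _]addrAC subrK.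
  by rewrite opprB addrA [b - c - _]addrAC subrK addrAC.
rewrite (le_trans (ler_normB _ _))// (le_trans (lerD Hq Hp))// -mulrDr.
have -> : `|h| * e = e / B * (`|h| * B) by field; rewrite gt_eqF.
by rewrite ler_wpM2l ?(ltW eB0)//; lra.
Qed.

Lemma deriveC f u v x : (forall y, differentiable f y) ->
  (forall y, differentiable ('D_u f) y) -> (forall y, differentiable ('D_v f) y) ->
  'D_u ('D_v f) x = 'D_v ('D_u f) x.
Proof.
move=> df du dv; apply/subr0_eq/eqP; rewrite -normr_le0.
apply/ler_addgt0Pr => e e0; rewrite add0r.
have e20 : 0 < e / 2 by lra.
have /nbhs_normP[d1 /= d10 H1] := @derive_diff2 f x u v df dv _ e20.
have /nbhs_normP[d2 /= d20 H2] := @derive_diff2 f x v u df du _ e20.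
pose h := Num.min d1 d2 / 2.
have d0 : 0 < Num.min d1 d2 by rewrite lt_min d10.
have h0 : 0 < h by rewrite divr_gt0.
have hd : h < Num.min d1 d2 by rewrite /h; lra.
have h1 : h < d1 by rewrite (lt_le_trans hd)// ge_min lexx.
have h2 : h < d2 by rewrite (lt_le_trans hd)// ge_min lexx orbT.
have {H1} := H1 h; rewrite /= sub0r normrN gtr0_norm// => /(_ h1) H1.
have {H2} := H2 h; rewrite /= sub0r normrN gtr0_norm// => /(_ h2).
rewrite [x + h *: u + h *: v]addrAC.
set A := f (x + h *: v + _) in H1 *; set B := f _ in H1 *; set C := f _ in H1 *.
set D := 'D_v _ _ => H2; set E := 'D_u _ _ in H1 *.
have ACE : A - C - (B - f x) = A - B - (C - f x).
  by rewrite !opprB ![_ - _ + (_ - _)]addrACA [- C - B]addrC.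
rewrite {}ACE in H2; set d := A - B - _ in H1 H2.
have h20 : 0 < h ^+ 2 by rewrite exprn_gt0.
rewrite -(ler_pM2l h20) -[X in X * `|_|](gtr0_norm h20) -normrZ scalerBr.
have -> : h ^+ 2 *: E - h ^+ 2 *: D = (d - h ^+ 2 *: D) - (d - h ^+ 2 *: E).
  by rewrite opprB [RHS]addrC addrA subrK.
rewrite (le_trans (ler_normB _ _))// (le_trans (lerD H2 H1))// -mulrDr.
by rewrite -splitr.
Qed.

End second_derivatives.

(** * Product rule and calculus of smooth functions *)

Section scale_product.
Context {R : realType} {Y : normedModType R}.

(** Named so that it can be registered as bilinear: the product rule is then the differential of a
    bilinear map. *)
Definition scale_op (a : R^o) (y : Y) : Y := a *: y.

Let scale_op_bilinear :
  bilinear_for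
    (GRing.Scale.Law.clone _ _ *:%R _) (GRing.Scale.Law.clone _ _ *:%R _) scale_op.
Proof.
split=> [u'|u] a x y; rewrite /scale_op /=.
- by rewrite scalerDl scalerA.
- by rewrite scalerDr !scalerA mulrC.
Qed.

HB.instance Definition _ :=
  bilinear_isBilinear.Build R R^o Y Y _ _ scale_op scale_op_bilinear.

Context {V : normedModType R}.
Implicit Types (p : V -> R^o) (f : V -> Y).

Lemma differentiable_scale p f x : differentiable p x -> differentiable f x ->
  differentiable (fun y => p y *: f y) x.
Proof.
move=> dp df.
apply: (@differentiable_comp _ _ _ _ (fun y => (p y, f y)) (fun q => scale_op q.1 q.2)).
  exact: differentiable_pair.
by apply: differentiable_bilin => q; exact: scale_continuous.
Qed.

Lemma derive_scale p f x v : differentiable p x -> differentiable f x ->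
  'D_v (fun y => p y *: f y) x = 'D_v p x *: f x + p x *: 'D_v f x.
Proof.
move=> dp df; rewrite !deriveE//; last exact: differentiable_scale.
rewrite (@diff_comp _ _ _ _ (fun y => (p y, f y)) (fun q => scale_op q.1 q.2)).
- rewrite (@diff_bilin _ _ _ _ scale_op) /=; last by move=> q; exact: scale_continuous.
  by rewrite (diff_pair dp df) /= addrC.
- exact: differentiable_pair.
- by apply: differentiable_bilin => q; exact: scale_continuous.
Qed.

End scale_product.

Section smooth_calculus.
Context {R : realType} {n : nat} {Y : normedModType R}.
Implicit Types (f g : 'rV[R]_n -> Y) (p : 'rV[R]_n -> R^o) (vs : seq 'rV[R]_n).

(** [deriveC] exchanges two neighbouring directions; repeated exchanges bring any direction to the
    front, and induction does the rest. *)
Lemma iter_derive_perm f vs ws : smooth f -> perm_eq vs ws ->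
  iter_derive vs f = iter_derive ws f.
Proof.
move=> /smoothP sf.
have cons u v us : iter_derive [:: u, v & us] f = iter_derive [:: v, u & us] f.
  by apply/funext => x; apply: deriveC; [exact: (sf us)|exact: (sf (u :: us))|exact: (sf (v
    :: us))].
have mv us v us' : iter_derive (us ++ v :: us') f = iter_derive (v :: us ++ us') f.
  elim: us => [//|u us ih] /=.
  by rewrite ih; exact: cons.
elim: vs ws => [|v vs ih] ws; first by rewrite perm_sym => /perm_nilP ->.
move=> vw; have vws : v \in ws by rewrite -(perm_mem vw) mem_head.
case/splitPr: vws vw => us us'; rewrite mv -[us ++ v :: us']/(us ++ [:: v] ++ us').
rewrite perm_sym perm_catCA perm_cons perm_sym => /ih /= -> //.
Qed.

Lemma differentiable_sum_seq (I : Type) (r : seq I) (F : I -> 'rV[R]_n -> Y) x :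
  (forall i, differentiable (F i) x) ->
  differentiable (fun y => \sum_(i <- r) F i y) x.
Proof.
move=> dF; elim: r => [|i r ih].
  under eq_fun do rewrite big_nil; exact: differentiable_cst.
by under eq_fun do rewrite big_cons; exact: differentiableD.
Qed.

Lemma derive_sum_seq (I : Type) (r : seq I) (F : I -> 'rV[R]_n -> Y) x v :
  (forall i, differentiable (F i) x) ->
  'D_v (fun y => \sum_(i <- r) F i y) x = \sum_(i <- r) 'D_v (F i) x.
Proof.
move=> dF; elim: r => [|i r ih].
  by rewrite big_nil; under eq_fun do rewrite big_nil; exact: derive_cst.
rewrite big_cons -ih; under eq_fun do rewrite big_cons.
by apply: deriveD; apply: diff_derivable => //; exact: differentiable_sum_seq.
Qed.

Lemma iter_derive_sum_seq (I : Type) (r : seq I) (F : I -> 'rV[R]_n -> Y) vs :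
  (forall i, smooth (F i)) ->
  iter_derive vs (fun y => \sum_(i <- r) F i y) =
  fun y => \sum_(i <- r) iter_derive vs (F i) y.
Proof.
move=> sF; elim: vs => [//|v vs /= ->]; apply/funext => x.
by rewrite derive_sum_seq// => i; move/smoothP: (sF i).
Qed.

Lemma smooth_sum_seq (I : Type) (r : seq I) (F : I -> 'rV[R]_n -> Y) :
  (forall i, smooth (F i)) -> smooth (fun y => \sum_(i <- r) F i y).
Proof.
move=> sF; apply/smoothP => vs x; rewrite iter_derive_sum_seq//.
by apply: differentiable_sum_seq => i; move/smoothP: (sF i).
Qed.

(** Only the shape of the Leibniz expansion is recorded, enough for smoothness of products;
    quantitative bounds come from [leibniz_bound]. *)
Lemma iter_derive_scale_sum vs p f : smooth p -> smooth f ->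
  exists l : seq (seq 'rV[R]_n * seq 'rV[R]_n),
  iter_derive vs (fun x => p x *: f x) =
  fun x => \sum_(us <- l) iter_derive us.1 p x *: iter_derive us.2 f x.
Proof.
move=> /smoothP sp /smoothP sf; elim: vs => [|v vs [l ih]].
  by exists [:: ([::], [::])]; apply/funext => x; rewrite big_seq1.
exists ([seq (v :: us.1, us.2) | us <- l] ++ [seq (us.1, v :: us.2) | us <- l]).
rewrite /= ih; apply/funext => x; rewrite big_cat !big_map /= -big_split /=.
rewrite derive_sum_seq; last by move=> us; exact: differentiable_scale.
by apply: eq_bigr => us _; exact: derive_scale.
Qed.

Lemma smooth_scale p f : smooth p -> smooth f -> smooth (fun x => p x *: f x).
Proof.
move=> sp sf; apply/smoothP => vs x.
have [l ->] := iter_derive_scale_sum vs sp sf.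
apply: differentiable_sum_seq => us; apply: differentiable_scale.
  by move/smoothP: sp.
by move/smoothP: sf.
Qed.

Lemma iter_derive_cst (v : 'rV[R]_n) vs (y : Y) :
  iter_derive (v :: vs) (fun _ : 'rV[R]_n => y) = cst 0.
Proof.
elim: vs v => [|w vs ih] v /=.
  by apply/funext => z; exact: derive_cst.
by rewrite [X in 'D_v X]ih; apply/funext => z; exact: derive_cst.
Qed.

Lemma smooth_cst (y : Y) : smooth (fun _ : 'rV[R]_n => y).
Proof.
by apply/smoothP => -[|v vs] x; rewrite ?iter_derive_cst; exact: differentiable_cst.
Qed.

Lemma iter_derive_scaler vs p (y : Y) : smooth p ->
  iter_derive vs (fun x => p x *: y) = fun x => iter_derive vs p x *: y.
Proof.
move=> /smoothP sp; elim: vs => [//|v vs /= ->]; apply/funext => x.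
by rewrite derive_scale// derive_cst scaler0 addr0.
Qed.

Lemma iter_derive_shiftr vs f (c : 'rV[R]_n) :
  iter_derive vs (fun x => f (x + c)) = fun x => iter_derive vs f (x + c).
Proof.
by elim: vs => [//|v vs /= ->]; apply/funext => x; exact: derive_shiftr.
Qed.

Lemma smooth_shiftr f (c : 'rV[R]_n) : smooth f -> smooth (fun x => f (x + c)).
Proof.
move=> /smoothP sf; apply/smoothP => vs x; rewrite iter_derive_shiftr.
exact: differentiable_shiftr.
Qed.

Lemma spt_shiftr f (c : 'rV[R]_n) :
  spt (fun x => f (x + c)) `<=` [set x | spt f (x + c)].
Proof.
rewrite {1}/spt closureE; apply: smallest_sub.
  apply: (@preimage_closed _ _ (fun x : 'rV[R]_n => x + c)).
    by move=> x _; exact: differentiable_continuous.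
  exact: closed_closure.
by move=> x /= fx; apply: subset_closure.
Qed.

Lemma spt_shiftr_compact f (c : 'rV[R]_n) :
  compact (spt f) -> compact (spt (fun x => f (x + c))).
Proof.
move=> cf; apply: (@subclosed_compact _ _ [set x - c | x in spt f]).
- exact: closed_closure.
- apply: continuous_compact => //; apply: continuous_subspaceT => x.
  exact: differentiable_continuous.
- by move=> x /spt_shiftr fx; exists (x + c) => //; rewrite addrK.
Qed.

Lemma spt_scalel p f : spt (fun x => p x *: f x) `<=` spt p.
Proof. by apply: closureS => x; apply: contra_neq => /= ->; rewrite scale0r. Qed.

Lemma spt_scaler p f : spt (fun x => p x *: f x) `<=` spt f.
Proof. by apply: closureS => x; apply: contra_neq => /= ->; rewrite scaler0. Qed.

Lemma notin_spt f x : ~ spt f x -> f x = 0.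
Proof. by apply: contra_notP => /eqP fx; exact: subset_closure. Qed.

Lemma spt_iter_derive f vs : spt (iter_derive vs f) `<=` spt f.
Proof. by elim: vs => //= v vs; apply: subset_trans; exact: spt_derive. Qed.

End smooth_calculus.

(** * Euclidean norm and derivative bounds *)

Section euclidean_norm.
Context {R : realType} {n : nat}.
Implicit Types (u v w x : 'rV[R]_n).

Lemma enorm_ge0 v : 0 <= enorm v.
Proof. exact: sqrtr_ge0. Qed.

Lemma enorm_sqr v : enorm v ^+ 2 = \sum_j v ord0 j ^+ 2.
Proof. by rewrite sqr_sqrtr// sumr_ge0// => j _; exact: sqr_ge0. Qed.

Lemma enormZ (a : R) v : enorm (a *: v) = `|a| * enorm v.
Proof.
apply/eqP; rewrite -(@eqrXn2 _ 2) ?mulr_ge0 ?enorm_ge0//.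
rewrite exprMn !enorm_sqr real_normK ?num_real// mulr_sumr.
by apply/eqP/eq_bigr => j _; rewrite mxE exprMn.
Qed.

Lemma enorm0 : enorm (0 : 'rV[R]_n) = 0.
Proof. by rewrite -(scale0r (0 : 'rV[R]_n)) enormZ normr0 mul0r. Qed.

Lemma enormN v : enorm (- v) = enorm v.
Proof. by rewrite -scaleN1r enormZ normrN1 mul1r. Qed.

Lemma enorm_distC u v : enorm (u - v) = enorm (v - u).
Proof. by rewrite -enormN opprB. Qed.

(** Lagrange's identity: the defect of the squared inequality is half a double sum of squares. *)
Lemma cauchy_schwarz u v : \sum_j u ord0 j * v ord0 j <= enorm u * enorm v.
Proof.
apply: le_trans (ler_norm _) _; rewrite -(@ler_pXn2r _ 2) ?nnegrE//; last first.
  by rewrite mulr_ge0 ?enorm_ge0.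
rewrite real_normK ?num_real// exprMn !enorm_sqr -subr_ge0.
have -> : (\sum_j u ord0 j ^+ 2) * (\sum_j v ord0 j ^+ 2)
    - (\sum_j u ord0 j * v ord0 j) ^+ 2 =
    2^-1 * \sum_i \sum_j (u ord0 i * v ord0 j - u ord0 j * v ord0 i) ^+ 2.
  have -> : \sum_i \sum_j (u ord0 i * v ord0 j - u ord0 j * v ord0 i) ^+ 2 =
      \sum_i \sum_j (u ord0 i ^+ 2 * v ord0 j ^+ 2) +
      \sum_i \sum_j (u ord0 j ^+ 2 * v ord0 i ^+ 2) -
      2 * \sum_i \sum_j (u ord0 i * v ord0 i * (u ord0 j * v ord0 j)).
    rewrite mulr_sumr -big_split /= -sumrB; apply: eq_bigr => i _.
    rewrite mulr_sumr -big_split /= -sumrB; apply: eq_bigr => j _; ring.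
  rewrite [X in _ + X - _]exchange_big /= expr2 !big_distrlr /=; lra.
by rewrite mulr_ge0// sumr_ge0// => i _; rewrite sumr_ge0// => j _; exact: sqr_ge0.
Qed.

Lemma enormD u v : enorm (u + v) <= enorm u + enorm v.
Proof.
rewrite -(@ler_pXn2r _ 2) ?nnegrE ?addr_ge0 ?enorm_ge0//.
rewrite sqrrD !enorm_sqr.
rewrite (eq_bigr (fun j => u ord0 j ^+ 2 + u ord0 j * v ord0 j *+ 2 + v ord0 j ^+ 2)); last first.
  by move=> j _; rewrite mxE sqrrD.
rewrite !big_split /= lerD2r lerD2l.
by rewrite mulr2n lerD ?cauchy_schwarz.
Qed.

Lemma enorm_delta (j : 'I_n) : enorm (delta_mx ord0 j : 'rV[R]_n) = 1.
Proof.
rewrite /enorm (bigD1 j)//= mxE !eqxx expr1n big1 ?addr0 ?sqrtr1// => l lj.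
by rewrite mxE (negbTE lj) andbF expr0n.
Qed.

Lemma norm_le_enorm v : `|v| <= enorm v.
Proof.
rewrite [leLHS]/Num.norm /= mx_normrE; apply/bigmax_leP; split; first exact: enorm_ge0.
move=> [i j] _ /=; rewrite (ord1 i); exact: coord_le_enorm.
Qed.

Lemma coord_le_norm v j : `|v ord0 j| <= `|v|.
Proof.
rewrite [leRHS]/Num.norm /= mx_normrE.
exact: (le_bigmax _ (fun ij => `|v ij.1 ij.2|) (ord0, j)).
Qed.

Lemma enorm_le_norm v : enorm v <= n%:R * `|v|.
Proof.
apply: (@le_trans _ _ (\sum_j `|v ord0 j|)); last first.
  rewrite (le_trans (ler_sum _ (fun j _ => coord_le_norm v j)))//.
  by rewrite sumr_const card_ord mulr_natl.
rewrite -(@ler_pXn2r _ 2) ?nnegrE ?enorm_ge0 ?sumr_ge0// enorm_sqr.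
suff [] : 0 <= \sum_j `|v ord0 j| /\ \sum_j v ord0 j ^+ 2 <= (\sum_j `|v ord0 j|) ^+ 2 by [].
apply: (big_ind2 (fun a b : R => 0 <= b /\ a <= b ^+ 2)) => [|a b c d [b0 ab] [d0 cd]|j _].
- by rewrite expr0n.
- split; first by rewrite addr_ge0.
  by have := mulr_ge0 b0 d0; rewrite sqrrD mulr2n; lra.
- by rewrite real_normK ?num_real.
Qed.

End euclidean_norm.

Section supD_bounds.
Context {R : realType} {n : nat} {Y : normedModType R}.
Implicit Types (f : testfun n Y) (vs : seq 'rV[R]_n).

Definition unit_vecs vs := all (fun v => enorm v <= 1) vs.

Lemma Dfull_le_supD i f x (v : i.-tuple 'rV[R]_n) :
  (forall j, enorm (tnth v j) <= 1) -> `|Dfull f x v| <= supD i f.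
Proof.
move=> v1; have [M fM] := testfun_Dfull_bounded i f.
have ubx y : ubound [set `|Dfull f y w| | w in
    [set w : i.-tuple 'rV[R]_n | forall j, enorm (tnth w j) <= 1]] M.
  by move=> _ [w w1 <-]; exact: fM.
apply: (@le_trans _ _ (multilinear_norm (Dfull (i := i) f x))).
  by apply: ub_le_sup; [exists M | exists v].
apply: ub_le_sup; last by exists x.
exists M => _ [y _ <-]; apply: ge_sup; last exact: ubx.
by exists `|Dfull f y v|; exists v.
Qed.

Lemma iter_derive_le_supD f vs x : unit_vecs vs ->
  `|iter_derive vs f x| <= supD (size vs) f.
Proof.
move=> /allP v1; apply: (@Dfull_le_supD _ f x (in_tuple vs)) => j.
by apply: v1; exact: mem_tnth.
Qed.

Lemma supD_le i f (M : R) :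
  (forall vs x, size vs = i -> unit_vecs vs -> `|iter_derive vs f x| <= M) ->
  supD i f <= M.
Proof.
move=> fM; apply: ge_sup; first by exists (multilinear_norm (Dfull (i := i) f 0)); exists 0.
move=> _ [x _ <-]; apply: ge_sup => [|_ [v /= v1 <-]].
  exists `|Dfull f x [tuple of nseq i 0]|, [tuple of nseq i 0] => //= j.
  have := mem_tnth j [tuple of nseq i (0 : 'rV[R]_n)].
  by rewrite mem_nseq => /andP[_ /eqP ->]; rewrite enorm0.
apply: fM; first exact: size_tuple.
by apply/allP => w /tnthP[j ->].
Qed.

Lemma supD_ge0 i f : 0 <= supD i f.
Proof.
apply: (@le_trans _ _ `|iter_derive (nseq i 0) f 0|) => //.
have := @iter_derive_le_supD f (nseq i 0) 0; rewrite size_nseq; apply.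
by apply/allP => v; rewrite mem_nseq => /andP[_ /eqP ->]; rewrite enorm0.
Qed.

Lemma iter_derive_le_sum f N vs x : (size vs <= N)%N -> unit_vecs vs ->
  `|iter_derive vs f x| <= \sum_(l < N.+1) supD l f.
Proof.
move=> vsN v1; rewrite (le_trans (iter_derive_le_supD f x v1))//.
rewrite (bigD1 (Ordinal (vsN : (size vs < N.+1)%N)))// lerDl sumr_ge0// => l _.
exact: supD_ge0.
Qed.

End supD_bounds.

Section testfun_operations.
Context {R : realType} {n : nat} {Y : normedModType R}.

Lemma testfun_predP (f : 'rV[R]_n -> Y) : smooth f -> compact (spt f) ->
  f \in testfun_pred n Y.
Proof. by move=> sf cf; apply/asboolP. Qed.

Lemma testfun_smooth (f : testfun n Y) : smooth f.
Proof. by case: (testfunP f). Qed.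

Lemma testfun_compact (f : testfun n Y) : compact (spt f).
Proof. by case: (testfunP f). Qed.

Lemma testfun_ext (f g : testfun n Y) : (forall x, f x = g x) -> f = g.
Proof. by move=> fg; apply: val_inj; apply/funext. Qed.

Lemma compact_spt_shift (f : testfun n Y) c : compact (spt (fun x => f (x + c))).
Proof. by apply: spt_shiftr_compact; exact: testfun_compact. Qed.

Definition testfun_shift (f : testfun n Y) (c : 'rV[R]_n) : testfun n Y :=
  TestFun (testfun_predP (smooth_shiftr c (testfun_smooth f))
    (@compact_spt_shift f c)).

Definition testfun_derive (f : testfun n Y) (v : 'rV[R]_n) : testfun n Y :=
  TestFun (testfun_iter_derive [:: v] f).

Lemma compact_spt_scaler (p : 'rV[R]_n -> R^o) (f : testfun n Y) :
  compact (spt (fun x => p x *: f x)).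
Proof.
by apply: (subclosed_compact (@closed_closure _ _) (@testfun_compact f)); exact: spt_scaler.
Qed.

Lemma compact_spt_scalel (p : testfun n R^o) (f : 'rV[R]_n -> Y) :
  compact (spt (fun x => p x *: f x)).
Proof.
by apply: (subclosed_compact (@closed_closure _ _) (testfunP p).2); exact: spt_scalel.
Qed.

Definition testfun_scaler (p : 'rV[R]_n -> R^o) (sp : smooth p) (f : testfun n Y) :
  testfun n Y :=
  TestFun (testfun_predP (smooth_scale sp (testfun_smooth f)) (@compact_spt_scaler p f)).

Definition testfun_scalel (p : testfun n R^o) (f : 'rV[R]_n -> Y) (sf : smooth f) :
  testfun n Y :=
  TestFun (testfun_predP (smooth_scale (testfunP p).1 sf) (@compact_spt_scalel p f)).

Lemma testfun_sumE (I : Type) (r : seq I) (F : I -> testfun n Y) x :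
  (\sum_(i <- r) F i) x = \sum_(i <- r) F i x.
Proof. by elim: r => [|i r ih]; rewrite ?big_nil// !big_cons -ih. Qed.

Lemma supD_shift i (f : testfun n Y) (c : 'rV[R]_n) :
  supD i (testfun_shift f c) <= supD i f.
Proof.
apply: supD_le => vs x <- v1; rewrite iter_derive_shiftr.
exact: iter_derive_le_supD.
Qed.

End testfun_operations.

Section product_bound.
Context {R : realType} {n : nat} {Y : normedModType R}.
Implicit Types (p : 'rV[R]_n -> R^o) (f : 'rV[R]_n -> Y) (us vs : seq 'rV[R]_n).

Lemma iter_derive_rcons_scale vs v p f : smooth p -> smooth f ->
  iter_derive (rcons vs v) (fun x => p x *: f x) =
  iter_derive vs (fun x => 'D_v p x *: f x) + iter_derive vs (fun x => p x *: 'D_v f x).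
Proof.
move=> sp sf; rewrite -cats1 iter_derive_cat.
have -> : iter_derive [:: v] (fun x => p x *: f x) =
    1 *: (fun x => 'D_v p x *: f x) + (fun x => p x *: 'D_v f x).
  apply/funext => x /=; rewrite !fctE scale1r derive_scale//.
    by move/smoothP: sp => /(_ [::]).
  by move/smoothP: sf => /(_ [::]).
rewrite iter_derive_linear ?scale1r//; apply: smooth_scale => //.
  exact: (@smooth_iter_derive _ _ _ [:: v]).
exact: (@smooth_iter_derive _ _ _ [:: v]).
Qed.

(* Each derivative falls on either factor, which costs a factor [alpha] or
   [beta]: this is how the binomial formula enters. *)
Lemma leibniz_bound i p f x (A B alpha beta : R) : smooth p -> smooth f ->
  0 <= A -> 0 <= B -> 0 <= alpha -> 0 <= beta ->
  (forall us, unit_vecs us -> (size us <= i)%N ->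
     `|iter_derive us p x| <= A * alpha ^+ (i - size us)) ->
  (forall us, unit_vecs us -> (size us <= i)%N ->
     `|iter_derive us f x| <= B * beta ^+ (i - size us)) ->
  forall vs, unit_vecs vs -> size vs = i ->
  `|iter_derive vs (fun x => p x *: f x) x| <= A * B * (alpha + beta) ^+ i.
Proof.
move=> sp sf A0 B0 a0 b0 pA fB.
(* The induction carries the derivatives already distributed: [us1] has fallen on [p] and [us2] on
   [f], while [j] directions remain. At j = 0 the exponents i - |us1| and i - |us2| are |us2| and
   |us1|. *)
suff H j us1 us2 vs : unit_vecs us1 -> unit_vecs us2 -> unit_vecs vs ->
    size vs = j -> (size us1 + size us2 + j)%N = i ->
    `|iter_derive vs (fun x => iter_derive us1 p x *: iter_derive us2 f x) x| <=
    A * B * (alpha ^+ size us2 * beta ^+ size us1 * (alpha + beta) ^+ j).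
  move=> vs v1 vsi.
  by have := H i [::] [::] vs isT isT v1 vsi erefl; rewrite !expr0 !mul1r.
elim: j us1 us2 vs => [|j ih] us1 us2 vs u1 u2 v1.
  move=> /size0nil -> /=; rewrite addn0 expr0 mulr1 => usi.
  rewrite normrZ mulrACA ler_pM//.
    by rewrite (le_trans (pA _ u1 _)) -?usi ?leq_addr// addKn.
  by rewrite (le_trans (fB _ u2 _)) -?usi ?leq_addl// addnK.
elim/last_ind: vs v1 => // vs v _; rewrite /unit_vecs all_rcons => /andP[v1 vs1].
rewrite size_rcons => -[vsj] usi.
rewrite iter_derive_rcons_scale; [|exact: smooth_iter_derive..].
rewrite (le_trans (ler_normD _ _))//.
have -> : A * B * (alpha ^+ size us2 * beta ^+ size us1 * (alpha + beta) ^+ j.+1) =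
  A * B * (alpha ^+ size us2 * beta ^+ (size (v :: us1)) * (alpha + beta) ^+ j) +
  A * B * (alpha ^+ (size (v :: us2)) * beta ^+ size us1 * (alpha + beta) ^+ j).
  by rewrite /= !exprS; ring.
apply: lerD.
  by apply: (ih (v :: us1)) => //=; rewrite ?v1// -usi; lia.
by apply: (ih us1 (v :: us2)) => //=; rewrite ?v1// -usi; lia.
Qed.

End product_bound.

Section support_bound.
Context {R : realType} {n : nat} {Y : normedModType R}.
Implicit Types (u x y : 'rV[R]_n) (us : seq 'rV[R]_n).

(** From a point of [A], a displacement by slightly more than [d] along the unit vector [u] leaves
    [A]; there [g] vanishes and the Lipschitz bound applies. *)
Lemma compact_support_bound (g : 'rV[R]_n -> Y) (A : set 'rV[R]_n) u (d M : R) :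
  (forall x, differentiable g x) -> spt g `<=` A ->
  (forall x y, A x -> A y -> enorm (x - y) <= d) -> enorm u = 1 -> 0 <= d ->
  (forall x, `|'D_u g x| <= M) -> forall x, `|g x| <= d * M.
Proof.
move=> dg gA Ad u1 d0 gM x.
have M0 : 0 <= M by exact: le_trans (gM 0).
have [Ax|Ax] := pselect (A x); last first.
  by rewrite (@notin_spt _ _ _ g x) ?normr0 ?mulr_ge0// => /gA.
apply/ler_addgt0Pr => e e0; have M10 : 0 < M + 1 by lra.
(* The length must exceed [d] strictly in order to leave [A]; the excess costs at most [e]. *)
pose s := d + e / (M + 1).
have s0 : 0 < e / (M + 1) by rewrite divr_gt0.
have xs : g (x + s *: u) = 0.
  apply: notin_spt => /gA Axs; have := Ad _ _ Axs Ax.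
  by rewrite [x + _]addrC addrK enormZ u1 mulr1 /s ger0_norm; lra.
have := @derive_lipschitz _ _ _ _ x u s M dg gM.
rewrite xs sub0r normrN => /le_trans; apply; rewrite ger0_norm; last by rewrite /s; lra.
rewrite /s mulrDl lerD2l -mulrA ler_piMr//; first exact: ltW.
by rewrite mulrC ler_pdivrMr//; lra.
Qed.

(** The missing [i - size us] derivatives are all taken along the same [u], each for one factor
    [d]. *)
Lemma spt_diam_bound (f : testfun n Y) (A : set 'rV[R]_n) u (d : R) i us x :
  spt f `<=` A -> (forall x y, A x -> A y -> enorm (x - y) <= d) ->
  enorm u = 1 -> 0 <= d -> unit_vecs us -> (size us <= i)%N ->
  `|iter_derive us f x| <= supD i f * d ^+ (i - size us).
Proof.
move=> fA Ad u1 d0.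
move: {2}(i - size us)%N (erefl (i - size us)%N) => j.
elim: j us x => [|j ih] us x usj us1 usi.
  have -> : i = size us by lia.
  by rewrite subnn expr0 mulr1 iter_derive_le_supD.
rewrite usj exprS mulrCA.
apply: (compact_support_bound (A := A) _ _ Ad u1) => //.
- by move/smoothP: (testfun_smooth f).
- exact: subset_trans (@spt_iter_derive _ _ _ _ _) fA.
- move=> y; have -> : j = (i - size (u :: us))%N by rewrite /=; lia.
  by apply: (ih (u :: us)); rewrite /= ?u1 ?lexx//; lia.
Qed.

End support_bound.

(** * Translation of test functions *)

Section translation_estimate.
Context {R : realType} {n : nat} {Y : normedModType R}.
Implicit Types (f g F : testfun n Y) (E : {linear testfun n Y -> R^o})
  (vs : seq 'rV[R]_n) (w x : 'rV[R]_n) (K : set 'rV[R]_n).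

Lemma iter_derive_testfunP vs (a : R) f g x :
  iter_derive vs (a *: f + g : testfun n Y) x = a *: iter_derive vs f x + iter_derive vs g x.
Proof.
have -> : iter_derive vs (a *: f + g : testfun n Y) =
  iter_derive vs (a *: (f : _ -> Y) + (g : _ -> Y)) by [].
by rewrite iter_derive_linear//; exact: testfun_smooth.
Qed.

Lemma iter_derive_testfunZ vs (a : R) f x :
  iter_derive vs (a *: f : testfun n Y) x = a *: iter_derive vs f x.
Proof. by rewrite -[a *: f]addr0 iter_derive_testfunP iter_derive0 addr0. Qed.

Lemma iter_derive_testfunB vs f g x :
  iter_derive vs (f - g : testfun n Y) x = iter_derive vs f x - iter_derive vs g x.
Proof. by rewrite addrC -scaleN1r iter_derive_testfunP scaleN1r addrC. Qed.

Lemma iter_derive_comm v vs f :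
  iter_derive vs ('D_v f) = 'D_v (iter_derive vs f).
Proof.
rewrite -[RHS]/(iter_derive (v :: vs) f) -[X in iter_derive vs X]/(iter_derive [:: v] f).
rewrite -iter_derive_cat; apply: iter_derive_perm; first exact: testfun_smooth.
by rewrite cats1 perm_rcons.
Qed.

Lemma compact_norm_ball (rho : R) : compact [set x : 'rV[R]_n | `|x| <= rho].
Proof.
apply: bounded_closed_compact.
  by exists rho; split=> [|M rM x /= xr]; rewrite ?num_real// (le_trans xr)// ltW.
apply: (@preimage_closed _ _ (fun x : 'rV[R]_n => `|x|) [set y | y <= rho]).
  by move=> x _; exact: norm_continuous.
exact: closed_le.
Qed.

Lemma closed_norm_ball (rho : R) : closed [set x : 'rV[R]_n | `|x| <= rho].
Proof. by apply: compact_closed; [exact: norm_hausdorff|exact: compact_norm_ball]. Qed.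

Lemma spt_sub (f : 'rV[R]_n -> Y) K : closed K -> (forall x, f x != 0 -> K x) -> spt f `<=` K.
Proof. by move=> cK fK; rewrite /spt closureE; apply: smallest_sub. Qed.

Lemma testfun_spt_bounded f : exists2 rho : R, 0 < rho & forall x, spt f x -> `|x| <= rho.
Proof.
by have /compact_bounded/pinfty_ex_gt0[rho r0 fr] := (testfunP f).2; exists rho.
Qed.

(* Continuity at 0 on every D_K, which is all that is used of the inductive
   limit topology. *)
Definition DK_continuous (E : testfun n Y -> R) : Prop :=
  forall K, compact K -> forall e : R, 0 < e -> exists (N : nat) (d : R), 0 < d /\
  forall f, spt f `<=` K ->
    (forall vs x, (size vs <= N)%N -> unit_vecs vs -> `|iter_derive vs f x| <= d) ->
  `|E f| <= e.

(** The curve t |-> E (F (. + t w)) has derivative E (D_w F (. + t w)), since by [taylor1] the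
    difference quotients converge uniformly with all derivatives up to order [N], within one compact
    set. [local_lipschitz] then gives the bound. *)
Lemma translation_bound E F w (M : R) : DK_continuous E ->
  (forall t : R, 0 <= t <= 1 ->
    `|E (testfun_derive (testfun_shift F (t *: w)) w)| <= M) ->
  `|E (testfun_shift F w) - E F| <= M.
Proof.
move=> cE EM.
have -> : E (testfun_shift F w) - E F =
    E (testfun_shift F (1 *: w)) - E (testfun_shift F (0 *: w)).
  by congr (E _ - E _); apply: testfun_ext => x /=; rewrite ?scale1r// scale0r addr0.
pose g (t : R) : R^o := E (testfun_shift F (t *: w)); rewrite -/(g 1) -/(g 0).
apply: local_lipschitz => t t01 e e0.
have [rho r0 Fr] := testfun_spt_bounded F.
(* Contains the supports of all translates of [F] by (t + s) w with 0 <= t <= 1 and |s| <= 1. *)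
pose K := [set x : 'rV[R]_n | `|x| <= rho + 2 * `|w|].
have [N [d [d0 Ed]]] := cE K (@compact_norm_ball _) e e0.
pose H := testfun_derive (testfun_derive F w) w.
pose c := \sum_(l < N.+1) supD l H.
have c0 : 0 <= c by rewrite sumr_ge0// => l _; exact: supD_ge0.
have Hc vs x : (size vs <= N)%N -> unit_vecs vs -> `|'D_w ('D_w (iter_derive vs F)) x| <= c.
  move=> vsN v1.
  rewrite -(iter_derive_comm w vs F).
  have -> : 'D_w (iter_derive vs ('D_w F)) x = iter_derive vs H x.
    by have /esym/(congr1 (fun h => h x)) := iter_derive_comm w vs (testfun_derive F w).
  exact: (@iter_derive_le_sum _ _ _ H).
pose G := testfun_shift F (t *: w).
have d10 : 0 < Num.min 1 (d / (c + 1)) by rewrite lt_min ltr01 divr_gt0//; lra.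
apply/nbhs_normP; exists (Num.min 1 (d / (c + 1))) => // s /=.
rewrite sub0r normrN lt_min => /andP[s1 sd].
have [->|s0] := eqVneq s 0; first by rewrite addr0 subrr normr0 mulr0.
(* The error of the difference quotient: its derivatives of order at most [N] are bounded by |s| c,
   hence by [d]. *)
pose rem := s^-1 *: (testfun_shift G (s *: w) - G) - testfun_derive G w.
have GE : g (t + s) - g t = s * (E rem + E (testfun_derive G w)).
  rewrite /rem linearB linearZ linearB /= subrK mulrA mulfV// mul1r; congr (E _ - _).
  by apply: testfun_ext => x /=; rewrite scalerDl addrA addrAC.
have sw : `|s *: w| <= `|w| by rewrite normrZ ler_piMl// ltW.
have tw : `|t *: w| <= `|w|.
  by case/andP: t01 => t0 t1; rewrite normrZ ger0_norm// ler_piMl.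
have GK (z x : 'rV[R]_n) : `|z| <= `|w| -> spt F (x + t *: w + z) -> `|x| <= rho + 2 * `|w|.
  move=> zw /Fr xr; rewrite -(addrK (t *: w + z) x) [x + _]addrA.
  rewrite (le_trans (ler_normB _ _))// lerD// (le_trans (ler_normD _ _))//.
  by rewrite mulr2n mulrDl mul1r lerD.
have GK0 (x : 'rV[R]_n) : spt F (x + t *: w) -> `|x| <= rho + 2 * `|w|.
  by have := GK 0 x; rewrite addr0 normr0 => H0 Fx; exact: H0.
have remE vs x : iter_derive vs rem x =
    s^-1 *: (iter_derive vs G (x + s *: w) - iter_derive vs G x
             - s *: 'D_w (iter_derive vs G) x).
  rewrite /rem iter_derive_testfunB iter_derive_testfunZ iter_derive_testfunB.
  rewrite (iter_derive_shiftr vs G) (iter_derive_comm w vs G).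
  by rewrite [RHS]scalerBr scalerA mulVf// scale1r.
have remK : `|E rem| <= e.
  apply: Ed => [|vs x vsN v1].
    apply: spt_sub; first exact: closed_norm_ball.
    move=> x; apply: contraPP => Kx; apply/negP; rewrite negbK; apply/eqP.
    rewrite -[LHS]/(iter_derive [::] rem x) remE.
    have -> : 'D_w (iter_derive [::] G) x = 0.
      apply: (@notin_spt _ _ _ ('D_w G)) => /spt_derive/spt_shiftr /= Fx; apply: Kx.
      exact: GK0.
    have -> : iter_derive [::] G (x + s *: w) = 0.
      by apply: (@notin_spt _ _ _ F); rewrite addrAC => Fx; apply: Kx; exact: (GK (s *: w)).
    have -> : iter_derive [::] G x = 0.
      apply: (@notin_spt _ _ _ F) => Fx; apply: Kx.
      exact: GK0.
    by rewrite subrr scaler0 subrr scaler0.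
  rewrite remE normrZ normfV ler_pdivrMl ?normr_gt0//.
  apply: (@le_trans _ _ (s ^+ 2 * c)).
    apply: taylor1.
    - by move=> y; move/smoothP: (testfun_smooth G).
    - by move=> y; move/smoothP: (testfun_smooth G) => /(_ (w :: vs)).
    - move=> y; rewrite -[X in `|X|]/(iter_derive [:: w, w & vs] G y).
      by rewrite (iter_derive_shiftr [:: w, w & vs] F); exact: Hc.
  rewrite -real_normK ?num_real// expr2 -mulrA ler_wpM2l//.
  move: sd; rewrite ltr_pdivlMr ?ltr_wpDl// => /ltW; apply: le_trans.
  by rewrite ler_wpM2l// lerDl.
rewrite GE normrM mulrC ler_wpM2r// (le_trans (ler_normD _ _))// addrC.
by rewrite lerD// EM.
Qed.

End translation_estimate.

(** * Lattice sums *)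

Section grid_sums.
Context {R : realType} {n : nat}.

(* h may be negative, which gives the reflected lattice. *)
Definition grid (h : R) (m : nat) (w : {ffun 'I_n -> 'I_m.*2}) : 'rV[R]_n :=
  \row_l (h * ((w l)%:R - m%:R)).

(** The cyclic successor makes the step a permutation of the lattice, so that sums can be reindexed;
    the wrap-around happens where test functions vanish. *)
Definition grid_step (m : nat) (j : 'I_n) (w : {ffun 'I_n -> 'I_m.*2}) :
  {ffun 'I_n -> 'I_m.*2} := [ffun l => if l == j then ordS (w l) else w l].

Lemma grid_step_inj m j : injective (@grid_step m j).
Proof.
move=> w1 w2 /ffunP w12; apply/ffunP => l; have := w12 l; rewrite !ffunE.
by case: ifP => // _; exact: ordS_inj.
Qed.

Lemma gridN h m w : @grid (- h) m w = - grid h w.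
Proof. by apply/rowP => l; rewrite !mxE mulNr. Qed.

Context {Y : normedModType R}.
Implicit Types (f : testfun n Y) (z v : 'rV[R]_n).

(** The two points coincide unless the index wraps around; then both differ from [z] by |h| m in
    coordinate [j], hence lie outside the support. *)
Lemma grid_step_shift h m f z j w (rho rho1 : R) :
  (forall x, spt f x -> `|x| <= rho) -> `|z| <= rho1 -> rho + rho1 < `|h| * m%:R ->
  f (z + grid h (grid_step j w)) = f (z + @grid h m w + h *: delta_mx ord0 j).
Proof.
move=> fr zr hm.
have f0 (y : 'rV[R]_n) l : `|h| * m%:R <= `|y ord0 l - z ord0 l| -> f y = 0.
  move=> yl; apply: notin_spt => /fr yr.
  have := coord_le_norm y l; have := coord_le_norm z l.
  have := ler_normB (y ord0 l) (z ord0 l); lra.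
have [wj|wj] := ltnP (w j).+1 m.*2.
  congr (f _); rewrite -addrA; congr (z + _); apply/rowP => l; rewrite !mxE ffunE eqxx.
  have [->|lj] := eqVneq l j; last by rewrite mulr0 addr0.
  by rewrite /= modn_small// -natr1 mulr1; ring.
have {}wj : (w j).+1 = m.*2 by apply/eqP; rewrite eqn_leq wj andbT.
rewrite (f0 _ j) ?(f0 _ j)// !mxE ?ffunE ?eqxx/=.
- rewrite mulr1 [X in _ <= `|X|](_ : _ = h * m%:R) ?normrM ?normr_nat//.
  have : (w j)%:R + 1 = m%:R + m%:R :> R by rewrite natr1 wj -addnn natrD.
  by move=> wjE; rewrite (_ : (w j)%:R = m%:R + m%:R - 1 :> R); [ring|rewrite -wjE addrK].
- by rewrite wj modnn sub0r mulrN addrAC subrr sub0r normrN normrM normr_nat.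
Qed.

(** Kept as a function of the offset [z] so that it can be differentiated: its near constancy in [z]
    stands in for convergence to a [Y]-valued integral. *)
Definition riemann_sum (h : R) (m : nat) (f : 'rV[R]_n -> Y) z : Y :=
  `|h| ^+ n *: \sum_(w : {ffun 'I_n -> 'I_m.*2}) f (z + grid h w).

Lemma riemann_sumE h m (f : 'rV[R]_n -> Y) : riemann_sum h m f =
  `|h| ^+ n *: (fun z => \sum_(w : {ffun 'I_n -> 'I_m.*2}) f (z + grid h w)) + 0.
Proof. by apply/funext => z; rewrite !fctE addr0. Qed.

Lemma smooth_grid_sum h m f :
  smooth (fun z => \sum_(w : {ffun 'I_n -> 'I_m.*2}) f (z + grid h w)).
Proof.
by apply: smooth_sum_seq => w; apply: smooth_shiftr; exact: testfun_smooth.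
Qed.

Lemma smooth_riemann_sum h m f : smooth (riemann_sum h m f).
Proof.
by rewrite riemann_sumE; apply: smooth_linear; [exact: smooth_grid_sum|exact: smooth0].
Qed.

Lemma iter_derive_riemann_sum h m f vs :
  iter_derive vs (riemann_sum h m f) = riemann_sum h m (iter_derive vs f).
Proof.
rewrite !riemann_sumE iter_derive_linear; [|exact: smooth_grid_sum|exact: smooth0].
rewrite iter_derive0; congr (_ *: _ + 0); rewrite iter_derive_sum_seq.
  by apply/funext => z; apply: eq_bigr => w _; rewrite iter_derive_shiftr.
by move=> w; apply: smooth_shiftr; exact: testfun_smooth.
Qed.

(** The increments of [f] over one lattice step sum to zero, by reindexing along [grid_step]. What
    remains of h times the sum of derivatives is one Taylor remainder of size h^2 c for each of the
    (2m)^n points. *)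
Lemma riemann_sum_partial h m f z j (rho rho1 c : R) : h != 0 ->
  (forall x, spt f x -> `|x| <= rho) -> `|z| <= rho1 -> rho + rho1 < `|h| * m%:R ->
  (forall x, `|iter_derive [:: delta_mx ord0 j; delta_mx ord0 j] f x| <= c) ->
  `|riemann_sum h m ('D_(delta_mx ord0 j) f) z| <= (m.*2%:R * `|h|) ^+ n * `|h| * c.
Proof.
move=> h0 fr zr hm fc; set e := delta_mx ord0 j : 'rV[R]_n.
pose t (w : {ffun 'I_n -> 'I_m.*2}) :=
  f (z + grid h w + h *: e) - f (z + grid h w) - h *: 'D_e f (z + grid h w).
have te : \sum_w t w = - (h *: \sum_(w : {ffun 'I_n -> 'I_m.*2}) 'D_e f (z + grid h w)).
  rewrite sumrB -scaler_sumr sumrB (eq_bigr (fun w => f (z + grid h (grid_step j w)))).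
    by rewrite [X in _ - X - _](reindex_inj (@grid_step_inj m j)) subrr sub0r.
  by move=> w _; rewrite (grid_step_shift j w fr zr hm).
have tb : `|\sum_w t w| <= (m.*2 ^ n)%:R * (h ^+ 2 * c).
  apply: (le_trans (ler_norm_sum _ _ _)).
  apply: (@le_trans _ _ (\sum_(w : {ffun 'I_n -> 'I_m.*2}) h ^+ 2 * c)).
    apply: ler_sum => w _; have /smoothP sf := testfun_smooth f.
    by apply: taylor1 => // y; [exact: (sf [::])|exact: (sf [:: e])].
  by rewrite sumr_const card_ffun !card_ord mulr_natl.
rewrite te normrN normrZ in tb.
rewrite /riemann_sum normrZ normrX normr_id -(@ler_pM2l _ `|h|) ?normr_gt0//.
rewrite mulrCA (le_trans (ler_wpM2l _ tb)) ?exprn_ge0//.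
rewrite -[h ^+ 2]real_normK ?num_real// exprMn natrX le_eqVlt; apply/orP; left; apply/eqP; ring.
Qed.

Lemma riemann_sum_derive h m f z v (rho rho1 c : R) : h != 0 ->
  (forall x, spt f x -> `|x| <= rho) -> `|z| <= rho1 -> rho + rho1 < `|h| * m%:R ->
  (forall j x, `|iter_derive [:: delta_mx ord0 j; delta_mx ord0 j] f x| <= c) ->
  `|riemann_sum h m ('D_v f) z| <= n%:R * `|v| * ((m.*2%:R * `|h|) ^+ n * `|h| * c).
Proof.
move=> h0 fr zr hm fc.
have -> : riemann_sum h m ('D_v f) z =
    \sum_j v ord0 j *: riemann_sum h m ('D_(delta_mx ord0 j) f) z.
  rewrite (derive_coord f v) /riemann_sum (eq_bigr (fun w => \sum_j v ord0 j *:
    'D_(delta_mx ord0 j) f (z + grid h w))); last by move=> w _; rewrite fct_sumE.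
  rewrite exchange_big scaler_sumr; apply: eq_bigr => j _ /=.
  by rewrite -scaler_sumr !scalerA mulrC.
rewrite (le_trans (ler_norm_sum _ _ _))//.
apply: (@le_trans _ _ (\sum_(j < n) `|v| * ((m.*2%:R * `|h|) ^+ n * `|h| * c))).
  apply: ler_sum => j _; rewrite normrZ ler_pM ?coord_le_norm//.
  exact: (riemann_sum_partial h0 fr zr hm (fc j)).
by rewrite sumr_const card_ord -[_ *+ _]mulr_natl [leRHS]mulrAC mulrA mulrAC.
Qed.

(** A derivative of positive order is a lattice sum of a derivative of [f], hence O(h); order zero
    follows from the mean value inequality on the segment from 0 to [z]. *)
Lemma riemann_sum_flat f (rho rho1 : R) N : (forall x, spt f x -> `|x| <= rho) -> 0 <= rho1 ->
  exists2 c : R, 0 <= c & forall h m, h != 0 -> rho + rho1 < `|h| * m%:R ->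
    forall vs z, (size vs <= N)%N -> unit_vecs vs -> `|z| <= rho1 ->
  `|iter_derive vs (fun x => riemann_sum h m f x - riemann_sum h m f 0) z| <=
    (m.*2%:R * `|h|) ^+ n * `|h| * c.
Proof.
(* Orders up to N + 2 occur: the Taylor remainders take two derivatives more. *)
move=> fr r0; pose c := \sum_(l < N.+3) supD l f.
have c0 : 0 <= c by rewrite sumr_ge0// => l _; exact: supD_ge0.
have fc us x : (size us < N.+3)%N -> unit_vecs us -> `|iter_derive us f x| <= c.
  exact: iter_derive_le_sum.
(* [rho1 + 1] bounds both kinds of direction used below, the segment [z] and a unit vector. *)
exists (n%:R * (rho1 + 1) * c) => [|h m h0 hm vs z vsN v1 zr].
  by rewrite !mulr_ge0// addr_ge0.
have B0 : 0 <= (m.*2%:R * `|h|) ^+ n * `|h| * c.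
  by rewrite !mulr_ge0// exprn_ge0// mulr_ge0.
have -> : (m.*2%:R * `|h|) ^+ n * `|h| * (n%:R * (rho1 + 1) * c) =
  n%:R * (rho1 + 1) * ((m.*2%:R * `|h|) ^+ n * `|h| * c) by ring.
have bnd us x v : (size us <= N)%N -> unit_vecs us -> `|v| <= rho1 + 1 -> `|x| <= rho1 ->
    `|riemann_sum h m ('D_v (iter_derive us f)) x| <=
    n%:R * (rho1 + 1) * ((m.*2%:R * `|h|) ^+ n * `|h| * c).
  move=> usN u1 vr xr.
  apply: (@le_trans _ _ (n%:R * `|v| * ((m.*2%:R * `|h|) ^+ n * `|h| * c))); last first.
    by rewrite ler_wpM2r// ler_wpM2l.
  apply: (@riemann_sum_derive h m
    (TestFun (testfun_iter_derive us f)) x v rho rho1 c h0 _ xr hm).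
  - by move=> y /spt_iter_derive; exact: fr.
  - move=> j y; rewrite -[X in `|X|]/(iter_derive [:: delta_mx ord0 j, delta_mx ord0 j & us] f y).
    by apply: fc; rewrite /= ?enorm_delta ?lexx.
case: vs vsN v1 => [_ _|v vs vsN /= /andP[v1 vs1]].
  rewrite -[iter_derive _ _ z]/(riemann_sum h m f z - riemann_sum h m f 0).
  rewrite -{1}[z]add0r -[X in `|X|]subr0.
  have sf := testfun_smooth f; have /smoothP sr := smooth_riemann_sum h m f.
  apply: mean_value => t /andP[t0 t1]; first by apply: diff_derivable; exact: (sr [::]).
  rewrite subr0 add0r.
  have -> : 'D_z (riemann_sum h m f) (t *: z) = riemann_sum h m ('D_z f) (t *: z).
    by have /(congr1 (fun g => g (t *: z))) := iter_derive_riemann_sum h m f [:: z].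
  apply: (bnd [::]) => //; first by rewrite ler_wpDr.
  by rewrite normrZ ger0_norm// (le_trans _ zr)// ler_piMl.
have -> : (fun x => riemann_sum h m f x - riemann_sum h m f 0) =
    1 *: riemann_sum h m f + (fun _ => - riemann_sum h m f 0).
  by apply/funext => x; rewrite !fctE scale1r.
rewrite -[X in `|X|]/(iter_derive (v :: vs) _ z).
rewrite iter_derive_linear; [|exact: smooth_riemann_sum|exact: smooth_cst].
rewrite iter_derive_cst (iter_derive_riemann_sum h m f (v :: vs)) scale1r addr0.
apply: bnd => //; first exact: ltnW.
by rewrite (le_trans (norm_le_enorm _))// (le_trans v1)// lerDr.
Qed.

End grid_sums.

(** * Lebesgue measure of cubes and balls *)

Section lebesgue_cubes.
Context {R : realType}.

(** Half-open, so that the cubes of a lattice are disjoint and leave no gaps. *)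
Definition cube n (q : 'rV[R]_n) (h : R) : set 'rV[R]_n :=
  [set x | forall l, q ord0 l <= x ord0 l < q ord0 l + h].

Lemma measurable_cube n (q : 'rV[R]_n) h : measurable (cube q h).
Proof.
rewrite (_ : cube q h =
    \bigcap_(l in [set: 'I_n]) ((fun x : 'rV[R]_n => x ord0 l) @^-1` `[q ord0 l, (q ord0 l
      + h)%R[)).
  apply: fin_bigcap_measurable => // l _.
  by rewrite -[X in measurable X]setTI; apply: measurable_coord_rV.
apply/seteqP; split=> x /=; first by move=> xq l _; rewrite /= in_itv; exact: xq.
by move=> xq l; have := xq l I; rewrite /= in_itv.
Qed.

Lemma lebesgue_cube n (q : 'rV[R]_n) (h : R) : 0 <= h ->
  lebesgue_rV n (cube q h) = (h ^+ n)%:E.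
Proof.
move=> h0; elim: n q => [|n ih] q.
  rewrite (_ : cube q h = setT) ?expr0; last by apply/seteqP; split=> // x _ [].
  by rewrite /= diracT.
pose q' : 'rV[R]_n := \row_l q ord0 (lift ord0 l).
have cE : (@rV_cons R n) @^-1` (cube q h) = `[q ord0 ord0, (q ord0 ord0 + h)%R[ `*` cube q' h.
  have c0 (p : R * 'rV[R]_n) : rV_cons p ord0 ord0 = p.1.
    rewrite (_ : ord0 = lshift n (ord0 : 'I_1)); last exact: val_inj.
    by apply: etrans (@row_mxEl _ _ 1 n _ _ _ _) _; rewrite mxE mulr1n.
  have cS (p : R * 'rV[R]_n) l : rV_cons p ord0 (lift ord0 l) = p.2 ord0 l.
    rewrite (_ : lift _ _ = rshift 1 l); last exact: val_inj.
    exact: (@row_mxEr _ _ 1 n).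
  apply/seteqP; split=> [p /= pq|p /= []].
    split; first by rewrite /= in_itv /=; have := pq ord0; rewrite c0.
    by move=> l; have := pq (lift ord0 l); rewrite cS mxE.
  rewrite /= in_itv /= => p1 p2 l; have [l'|] := unliftP ord0 l.
    by move=> ->; have := p2 l'; rewrite cS mxE.
  by move=> ->; rewrite c0.
rewrite /= /lebesgue_rVS /pushforward cE product_measure1E//; last exact: measurable_cube.
rewrite ih; have E1 : lebesgue_measure `[q ord0 ord0, q ord0 ord0 + h[%classic = h%:E.
  rewrite lebesgue_measure_itv /= lte_fin; case: ifPn => [_|].
    by rewrite -EFinB [_ + h]addrC addrK.
  by rewrite -leNgt => hle; congr EFin; lra.
by apply: etrans (congr1 (fun t => t * (h ^+ n)%:E)%E E1) _; rewrite -EFinM exprS.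
Qed.

Lemma norm_le_coord n (v : 'rV[R]_n) (M : R) : 0 <= M ->
  (forall l, `|v ord0 l| <= M) -> `|v| <= M.
Proof.
move=> M0 vM; rewrite [leLHS]/Num.norm /= mx_normrE; apply/bigmax_leP; split => //.
by move=> [i j] _ /=; rewrite (ord1 i).
Qed.

(* An open set is a countable union of cubes with rational corners. *)
Lemma open_measurable_rV n (A : set 'rV[R]_n) : open A -> measurable A.
Proof.
move=> oA.
pose Q (p : 'rV[rat]_n * nat) : set 'rV[R]_n :=
  cube (\row_l ratr (p.1 ord0 l)) p.2.+1%:R^-1.
rewrite (_ : A = \bigcup_p (if `[< Q p `<=` A >] then Q p else set0)); last first.
  apply/seteqP; split=> [x Ax|x [p _]]; last by case: asboolP => // QA /QA.
  have /nbhs_ballP[e /= e0 xe] : nbhs x A by apply: open_nbhs_nbhs.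
  have [k ke] : exists k : nat, k.+1%:R^-1 < e.
    by have [k _ kH] := near_infty_natSinv_lt (PosNum e0); exists k; exact: (kH k (leqnn k)).
  have d0 : 0 < k.+1%:R^-1 :> R by rewrite invr_gt0.
  have qx (l : 'I_n) : exists q : rat, x ord0 l - k.+1%:R^-1 < ratr q <= x ord0 l.
    have xl : x ord0 l - k.+1%:R^-1 < x ord0 l by rewrite ltrBlDr ltrDl.
    have [q] := rat_in_itvoo xl.
    by rewrite in_itv /= => /andP[q1 q2]; exists q; rewrite q1 ltW.
  have [q Hq] := choice qx.
  exists (\row_l q l, k) => //; case: asboolP => [_|[]] /=.
    by move=> l; rewrite !mxE; have /andP[q1 q2] := Hq l; rewrite q2 -ltrBlDr.
  move=> y yq; apply: xe; rewrite -ball_normE /=.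
  apply: le_lt_trans ke; apply: norm_le_coord => [|l]; first exact: ltW.
  have := Hq l; have := yq l; rewrite !mxE /=; set kk := k.+1%:R^-1.
  by move=> /andP[y1 y2] /andP[q1 q2]; rewrite ler_norml; lra.
apply: countable_bigcupT_measurable => [|p]; first exact: countableP.
by case: ifP => // _; exact: measurable_cube.
Qed.

Lemma closed_measurable_rV n (A : set 'rV[R]_n) : closed A -> measurable A.
Proof. by move=> cA; rewrite -(setCK A); apply: measurableC; apply: open_measurable_rV;
  exact: closed_openC. Qed.

Lemma continuous_measurable_rV n (f : 'rV[R]_n -> R) : continuous f ->
  measurable_fun setT f.
Proof.
move=> /continuousP cf; apply: (measurability _ (RGenOpens.measurableE R)).
move=> _ [_ [a [b ->]] <-]; rewrite setTI; apply: open_measurable_rV.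
exact/cf/interval_open.
Qed.


Lemma measurable_big_cubes n (I : Type) (s : seq I) (q : I -> 'rV[R]_n) (h : R) :
  measurable (\big[setU/set0]_(i <- s) cube (q i) h).
Proof. by apply: bigsetU_measurable => i _; exact: measurable_cube. Qed.

Lemma grid_cube_inj n (h : R) m (w1 w2 : {ffun 'I_n -> 'I_m.*2}) x : 0 < h ->
  cube (grid h w1) h x -> cube (grid h w2) h x -> w1 = w2.
Proof.
move=> h0 x1 x2; apply/ffunP => l; apply/val_inj => /=.
have := x1 l; have := x2 l; rewrite !mxE => /andP[a1 a2] /andP[b1 b2].
apply/eqP; rewrite eqn_leq; apply/andP; split.
  rewrite -ltnS -(ltr_nat R) -natr1 -(ltrD2r (- m%:R)) -(ltr_pM2l h0).
  rewrite (le_lt_trans b1)// (lt_le_trans a2)// le_eqVlt; apply/orP; left; apply/eqP; ring.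
rewrite -ltnS -(ltr_nat R) -natr1 -(ltrD2r (- m%:R)) -(ltr_pM2l h0).
rewrite (le_lt_trans a1)// (lt_le_trans b2)// le_eqVlt; apply/orP; left; apply/eqP; ring.
Qed.

Lemma trivIset_grid_cubes n (h : R) m (D : set {ffun 'I_n -> 'I_m.*2}) : 0 < h ->
  trivIset D (fun w => cube (grid h w) h).
Proof. by move=> h0 w1 w2 _ _ [x [x1 x2]]; exact: grid_cube_inj x1 x2. Qed.

Lemma grid_cube_cover n (h : R) m (x : 'rV[R]_n) : 0 < h -> `|x| < h * m%:R ->
  exists w : {ffun 'I_n -> 'I_m.*2}, cube (grid h w) h x.
Proof.
move=> h0 xm.
have xl l : 0 <= (x ord0 l + h * m%:R) / h < m.*2%:R.
  have := coord_le_norm x l; rewrite ler_norml => /andP[x1 x2].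
  rewrite divr_ge0 ?(ltW h0)//=; last lra.
  by rewrite ltr_pdivrMr// -addnn natrD; lra.
have kl l : (Num.truncn ((x ord0 l + h * m%:R) / h)%R < m.*2)%N.
  by have /andP[x0 x1] := xl l; rewrite -(ltr_nat R) (le_lt_trans _ x1)// truncn_le.
exists [ffun l => Ordinal (kl l)] => l; rewrite !mxE ffunE /=.
have /andP[x0 x1] := xl l; have /andP[] := truncn_itv x0.
set k := Num.truncn _; rewrite ler_pdivlMr// ltr_pdivrMr// -natr1; lra.
Qed.

Lemma grid_cube_norm n (h : R) m (w : {ffun 'I_n -> 'I_m.*2}) x : 0 < h ->
  cube (grid h w) h x -> `|x - grid h w| <= h.
Proof.
move=> h0 xw; apply: norm_le_coord => [|l]; first exact: ltW.
by have := xw l; rewrite !mxE ler_norml; lra.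
Qed.

Lemma lipschitz_continuous (V : normedModType R) (f : V -> R) (c : R) : 0 <= c ->
  (forall x y, `|f x - f y| <= c * `|x - y|) -> continuous f.
Proof.
move=> c0 fc x; apply/cvgrPdist_le => e e0; apply/nbhs_normP.
have c10 : 0 < c + 1 by rewrite ltr_wpDl.
exists (e / (c + 1)) => [|y /=]; first by rewrite /= divr_gt0.
rewrite ltr_pdivlMr// => /ltW xy; rewrite (le_trans (fc _ _))// mulrC (le_trans _ xy)//.
by rewrite ler_wpM2l// lerDl.
Qed.

Lemma enorm_continuous n : continuous (@enorm R n).
Proof.
apply: (@lipschitz_continuous _ _ n%:R) => // x y; apply: le_trans (enorm_le_norm _).
rewrite ler_norml; apply/andP; split.
  rewrite lerNl opprB lerBlDr -[X in enorm X <= _](subrK x) (le_trans (enormD _ _))//.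
  by rewrite lerD2r enorm_distC.
by rewrite lerBlDr -[X in enorm X <= _](subrK y) (le_trans (enormD _ _)).
Qed.

Lemma measurable_ecball n (r : R) : measurable (ecball (0 : 'rV[R]_n) r).
Proof.
apply: closed_measurable_rV.
apply: (@preimage_closed _ _ (fun x : 'rV[R]_n => enorm (x - 0)) [set y | y <= r]).
  move=> x _; under eq_fun do rewrite subr0; exact: enorm_continuous.
exact: closed_le.
Qed.

Lemma lebesgue_ecball_fin n (r : R) : (lebesgue_rV n (ecball 0 r) < +oo)%E.
Proof.
have [r0|r0] := ltP r 0.
  rewrite (_ : ecball 0 r = set0) ?measure0//; apply/seteqP; split=> // x /=.
  rewrite /ecball /= => xr; have := enorm_ge0 (x - 0); lra.
apply: (@le_lt_trans _ _ (lebesgue_rV n (cube (const_mx (- r)) (2 * r + 1)))).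
  apply: le_measure; rewrite ?inE; [exact: measurable_ecball|exact: measurable_cube|].
  move=> x; rewrite /ecball /= subr0 => xr l; rewrite mxE.
  by have := le_trans (coord_le_enorm x l) xr; rewrite ler_norml; lra.
by rewrite lebesgue_cube ?ltry//; lra.
Qed.

(** The cubes at the counted points are disjoint, of volume h^n, and lie in the enlarged ball: a sup
    norm distance of at most [h] is a Euclidean distance of at most n h. *)
Lemma grid_count_ball n (h : R) m : 0 < h ->
  h ^+ n * #|[set w : {ffun 'I_n -> 'I_m.*2} | enorm (grid h w) <= 1]%SET|%:R <=
  fine (lebesgue_rV n (ecball 0 (1 + n%:R * h))).
Proof.
move=> h0; set F := [set w | _]%SET.
pose D := \big[setU/set0]_(w <- enum F) cube (grid h w) h.
have -> : h ^+ n * #|F|%:R = fine (lebesgue_rV n D).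
  have tF := @trivIset_grid_cubes n h m [set` enum F] h0.
  have mD : measurable D by exact: measurable_big_cubes.
  have := @integral_bigsetU_EFin _ _ R (lebesgue_rV n) _ _ (cst 1) (enum F)
     (fun w => measurable_cube (grid h w) h) (enum_uniq _) tF.
  move=> /= H; have -> : lebesgue_rV n D = (\int[lebesgue_rV n]_(x in D) (cst 1%:E x))%E.
    by rewrite integral_cst// mul1e.
  rewrite H; last exact/measurable_EFinP.
  rewrite (eq_bigr (fun _ => (h ^+ n)%:E)); last first.
    move=> w _; rewrite integral_cst; last exact: measurable_cube.
    by rewrite mul1e; apply: lebesgue_cube; exact: ltW.
  rewrite sumEFin /= big_const_seq count_predT -cardE iter_addr_0 mulr_natr.
  by [].
have DB : D `<=` ecball 0 (1 + n%:R * h).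
  rewrite /D -bigcup_seq => x [w /= wF xw].
  have {}wF : enorm (grid h w) <= 1 by move: wF; rewrite mem_enum inE.
  rewrite /ecball /= subr0 -(subrK (grid h w) x) addrC (le_trans (enormD _ _))// lerD//.
  rewrite (le_trans (enorm_le_norm _))// ler_wpM2l//; exact: grid_cube_norm.
have DB' : (lebesgue_rV n D <= lebesgue_rV n (ecball 0 (1 + n%:R * h)))%E.
  by apply: le_measure; rewrite ?inE//; [exact: measurable_big_cubes|exact: measurable_ecball].
apply: fine_le => //; rewrite ge0_fin_numE//; last exact: lebesgue_ecball_fin.
by apply: le_lt_trans DB' _; exact: lebesgue_ecball_fin.
Qed.

Lemma ecball_measure_cvg n :
  fine (lebesgue_rV n (ecball 0 (1 + k.+1%:R^-1))) @[k --> \oo] --> unit_ball_volume R n.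
Proof.
have E : \bigcap_k ecball (0 : 'rV[R]_n) (1 + k.+1%:R^-1) = ecball 0 1.
  apply/seteqP; split=> x /=; last first.
    move=> x1 k _; rewrite /ecball /= in x1 *; apply: le_trans x1 _.
    by rewrite lerDl invr_ge0.
  move=> H; rewrite /ecball /=; apply/ler_addgt0Pr => e e0.
  have [k _ kH] := near_infty_natSinv_lt (PosNum e0).
  rewrite (le_trans (H k I))// lerD2l ltW//; exact: (kH k (leqnn k)).
apply: fine_cvg; rewrite fineK; last by rewrite ge0_fin_numE//; exact: lebesgue_ecball_fin.
rewrite -E; apply: nonincreasing_cvg_mu.
- exact: lebesgue_ecball_fin.
- by move=> k; exact: measurable_ecball.
- by rewrite E; exact: measurable_ecball.
- move=> a b ab; apply/subsetPset => x; rewrite /ecball /= => /le_trans; apply.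
  by rewrite lerD2l lef_pV2 ?posrE// ler_nat ltnS.
Qed.

(** The threshold is independent of [m]: however large the lattice box is, only its points in the
    unit ball count. Taking N >= n (k + 1) makes n / (N + 1) at most 1 / (k + 1), where
    [ecball_measure_cvg] applies. *)
Lemma grid_count_ball_limit n (e : R) : 0 < e -> exists N0 : nat, forall N m,
  (N0 <= N)%N ->
  N.+1%:R^-1 ^+ n *
    #|[set w : {ffun 'I_n -> 'I_m.*2} | enorm (grid (N.+1%:R^-1 : R) w) <= 1]%SET|%:R <=
  unit_ball_volume R n + e.
Proof.
move=> e0; have /cvgrPdist_le/(_ _ e0)[k _ kH] := @ecball_measure_cvg n.
exists (n * k.+1)%N => N m nN; have h0 : 0 < N.+1%:R^-1 :> R by rewrite invr_gt0.
apply: (le_trans (@grid_count_ball n _ m h0)).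
have := kH k (leqnn k); rewrite /= ler_norml => /andP[+ _].
rewrite lerNl opprB lerBlDl => H; apply: le_trans H.
apply: fine_le.
- by rewrite ge0_fin_numE//; exact: lebesgue_ecball_fin.
- by rewrite ge0_fin_numE//; exact: lebesgue_ecball_fin.
- apply: le_measure; rewrite ?inE; [exact: measurable_ecball..|].
  move=> x; rewrite /ecball /= => /le_trans; apply; rewrite lerD2l.
  rewrite ler_pdivrMr// mulrC ler_pdivlMr// -natrM ler_nat.
  by rewrite (leq_trans nN).
Qed.

End lebesgue_cubes.

(** * Integrals of scalar test functions as limits of lattice sums *)

Section riemann_integral.
Context {R : realType} {n : nat}.
Implicit Types (u : testfun n R^o).

Lemma testfun_lipschitz u (x y : 'rV[R]_n) : `|u x - u y| <= n%:R * supD 1 u * `|x - y|.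
Proof.
have -> : x = y + (x - y) by rewrite addrC subrK.
rewrite -[u _ - _]subr0 [y + _ - y]addrC addKr.
have /smoothP su := testfun_smooth u.
apply: mean_value => t _; first by apply: diff_derivable; exact: (su [::]).
have -> : 'D_(x - y) u (y + t *: (x - y)) =
    \sum_j (x - y) ord0 j *: 'D_(delta_mx ord0 j) u (y + t *: (x - y)).
  by have /(congr1 (fun g => g (y + t *: (x - y)))) := derive_coord u (x - y); rewrite fct_sumE.
rewrite subr0 (le_trans (ler_norm_sum _ _ _))//.
apply: (@le_trans _ _ (\sum_(j < n) `|x - y| * supD 1 u)).
  apply: ler_sum => j _; rewrite normrZ ler_pM ?coord_le_norm//.
  by apply: (@iter_derive_le_supD _ _ _ u [:: delta_mx ord0 j]); rewrite /= enorm_delta lexx.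
by rewrite sumr_const card_ord -[leLHS]mulr_natl [`|_| * _]mulrC mulrA.
Qed.

Lemma testfun_measurable u : measurable_fun [set: 'rV[R]_n] (u : 'rV[R]_n -> R).
Proof.
apply: continuous_measurable_rV; apply: (@lipschitz_continuous _ _ _ (n%:R * supD 1 u)).
  by rewrite mulr_ge0// supD_ge0.
exact: testfun_lipschitz.
Qed.

Lemma testfun_integrable u (A : set 'rV[R]_n) : measurable A ->
  (lebesgue_rV n A < +oo)%E -> (lebesgue_rV n).-integrable A (EFin \o (u : 'rV[R]_n -> R)).
Proof.
move=> mA Aoo; apply: measurable_bounded_integrable => //.
  by apply: measurable_funTS; exact: testfun_measurable.
have [M uM] := testfun_bounded u.
exists M; split=> [|M' MM' x _ /=]; first by rewrite num_real.
by rewrite (le_trans (uM x))// ltW.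
Qed.

(** Compared cube by cube: on a cube of side [h], the Lipschitz function [u] differs from its value
    at the corner by at most c h. *)
Lemma riemann_sum_integral u (rho : R) : (forall x, spt u x -> `|x| <= rho) ->
  exists2 c : R, 0 <= c & forall h m, 0 < h -> rho < h * m%:R ->
  `|riemann_sum h m u 0 - \int[lebesgue_rV n]_x (u x : R)| <= (m.*2%:R * `|h|) ^+ n * `|h| * c.
Proof.
move=> ur; pose c := n%:R * supD 1 u.
exists c => [|h m h0 hm]; first by rewrite mulr_ge0// supD_ge0.
pose Q (w : {ffun 'I_n -> 'I_m.*2}) : set 'rV[R]_n := cube (grid h w) h.
have mQ w : measurable (Q w) by exact: measurable_cube.
have Qh w : lebesgue_rV n (Q w) = (h ^+ n)%:E by apply: lebesgue_cube; exact: ltW.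
have Qoo w : (lebesgue_rV n (Q w) < +oo)%E by rewrite Qh ltry.
pose s := enum {: {ffun 'I_n -> 'I_m.*2}}.
pose D := \big[setU/set0]_(w <- s) Q w.
have mD : measurable D by exact: measurable_big_cubes.
have uD x : ~ D x -> u x = 0.
  move=> Dx; apply: notin_spt => /ur xr; apply: Dx.
  have [w xw] := grid_cube_cover h0 (le_lt_trans xr hm).
  by rewrite /D -bigcup_seq; exists w => //=; rewrite mem_enum.
have Doo : (lebesgue_rV n D < +oo)%E.
  apply: (@le_lt_trans _ _ (lebesgue_rV n (cube (const_mx (- (h * m%:R))) (2 * h * m%:R)))).
    apply: le_measure; rewrite ?inE//; first exact: measurable_cube.
    rewrite /D -bigcup_seq => x [w _ xw] l; have := xw l; rewrite !mxE => /andP[x1 x2].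
    have wm : (w l)%:R + 1 <= m%:R + m%:R :> R by rewrite natr1 -natrD addnn ler_nat.
    apply/andP; split; first by rewrite (le_trans _ x1)// mulrBr lerBrDl addrN mulr_ge0// ltW.
    rewrite (lt_le_trans x2)//.
    have := ler_wpM2l (ltW h0) wm; lra.
  by rewrite lebesgue_cube ?ltry// !mulr_ge0// ltW.
have uE : \int[lebesgue_rV n]_x (u x : R) = \int[lebesgue_rV n]_(x in D) (u x : R).
  rewrite [RHS]Rintegral_mkcond; apply: eq_Rintegral => x _; rewrite patchE.
  by case: ifPn => //; rewrite notin_setE => /uD.
have uQ w : (lebesgue_rV n).-integrable (Q w) (EFin \o (u : 'rV[R]_n -> R)).
  exact: testfun_integrable.
have uS : \int[lebesgue_rV n]_(x in D) (u x : R) = \sum_(w <- s) \int[lebesgue_rV n]_(x in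
  Q w) (u x : R).
  have tF := @trivIset_grid_cubes R n h m [set` s] h0.
  have := @integral_bigsetU_EFin _ _ R (lebesgue_rV n) _ _ (u : 'rV[R]_n -> R) s mQ
    (enum_uniq _) tF.
  move=> /= H; rewrite /Rintegral H; last first.
    by apply/measurable_EFinP; apply: measurable_funTS; exact: testfun_measurable.
  by rewrite -sum_fine// => w _; apply: integrable_fin_num => //; exact: uQ.
rewrite uE uS /riemann_sum (gtr0_norm h0) scaler_sumr big_enum /= -sumrB.
have Rcst w (a : R) : \int[lebesgue_rV n]_(x in Q w) a = a * h ^+ n.
  rewrite Rintegral_cst//; congr (_ * _); rewrite -[RHS]/(fine (h ^+ n)%:E).
  by congr fine; exact: Qh.
have icst w (a : R) : (lebesgue_rV n).-integrable (Q w) (EFin \o cst a : 'rV[R]_n -> _).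
  apply: measurable_bounded_integrable => //.
    exact: Qoo.
  by exists `|a|; split=> [|M' MM' x _ /=]; [rewrite num_real|exact: ltW].
have -> : (m.*2%:R * h) ^+ n * h * c = \sum_(w : {ffun 'I_n -> 'I_m.*2}) (h * c * h ^+ n).
  rewrite sumr_const card_ffun !card_ord exprMn -natrX -[RHS]mulr_natl; ring.
rewrite (le_trans (ler_norm_sum _ _ _))//; apply: ler_sum => w _.
have -> : h ^+ n *: (u (0 + grid h w) : R^o) = \int[lebesgue_rV n]_(x in Q w) (u (grid h w) : R).
  by rewrite Rcst add0r mulrC.
rewrite -RintegralB//; last exact: icst.
have iB : (lebesgue_rV n).-integrable (Q w) (EFin \o (fun x : 'rV[R]_n => u (grid h w) - u x : R)).
  rewrite (_ : EFin \o _ = ((EFin \o cst (u (grid h w) : R)) \- (EFin \o (u : 'rV[R]_n -> R)))%E).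
    exact: integrableB.
  by apply/funext => x.
apply: (le_trans (le_normr_Rintegral _ iB)) => //.
rewrite -(Rcst w); apply: le_Rintegral => //.
  exact: integrable_norm.
  exact: icst.
move=> x xw; rewrite (le_trans (testfun_lipschitz u _ _))// mulrC ler_wpM2r//.
  by rewrite mulr_ge0// supD_ge0.
by rewrite distrC; exact: grid_cube_norm xw.
Qed.

End riemann_integral.

Section testfun_integral.
Context {R : realType} {n : nat}.
Implicit Types (u v : testfun n R^o).

Definition testfun_int u : R := \int[lebesgue_rV n]_x (u x : R).

Lemma inv_succ_small (c e : R) : 0 <= c -> 0 < e ->
  exists N0 : nat, forall N : nat, (N0 <= N)%N -> N.+1%:R^-1 * c <= e.
Proof.
move=> c0 e0; have d0 : 0 < e / (c + 1) by rewrite divr_gt0// ltr_wpDl.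
have [N0 _ H] := near_infty_natSinv_lt (PosNum d0); exists N0 => N NN.
have /ltW /= := H N NN; rewrite ler_pdivlMr ?ltr_wpDl//; apply: le_trans.
by rewrite ler_wpM2l// ?invr_ge0// lerDl.
Qed.

(** The normalisation used from here on: with mesh s / (N + 1) and m = B (N + 1), the lattice box
    keeps the half width s B while the mesh tends to 0. *)
Lemma grid_extent (s : R) (B N : nat) : s / N.+1%:R * (B * N.+1)%:R = s * B%:R.
Proof. by rewrite natrM mulrCA mulfVK ?pnatr_eq0// mulrC. Qed.

Lemma grid_width (s : R) (B N : nat) : 0 <= s ->
  (B * N.+1).*2%:R * `|s / N.+1%:R| = 2 * s * B%:R.
Proof.
move=> s0; rewrite ger0_norm ?divr_ge0// -muln2 mulnC natrM -mulrA [_ * (s / _)]mulrC.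
by rewrite grid_extent mulrA.
Qed.

Lemma riemann_limit u (rho s : R) (B : nat) : 0 < s ->
  (forall x, spt u x -> `|x| <= rho) -> rho < s * B%:R ->
  exists2 c : R, 0 <= c & forall N,
  `|riemann_sum (s / N.+1%:R) (B * N.+1) u 0 - testfun_int u| <= N.+1%:R^-1 * c.
Proof.
move=> s0 ur rB; have [c c0 H] := riemann_sum_integral ur.
have s0' := ltW s0.
exists ((2 * s * B%:R) ^+ n * (s * c)) => [|N].
  by rewrite !mulr_ge0// exprn_ge0// !mulr_ge0.
have h0 : 0 < s / N.+1%:R by rewrite divr_gt0.
have := H _ (B * N.+1)%N h0; rewrite grid_extent grid_width// => /(_ rB) /le_trans; apply.
rewrite gtr0_norm// le_eqVlt; apply/orP; left; apply/eqP; ring.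
Qed.

Lemma eq0_of_small (a c : R) : 0 <= c -> (forall N : nat, `|a| <= N.+1%:R^-1 * c) -> a = 0.
Proof.
move=> c0 H; apply/eqP; rewrite -normr_le0; apply/ler_addgt0Pr => e e0.
have [N HN] := inv_succ_small c0 e0.
by rewrite add0r (le_trans (H N))// HN.
Qed.

Lemma nat_bound (rho : R) : exists B : nat, rho < B%:R.
Proof.
exists (Num.truncn `|rho|).+1; rewrite (le_lt_trans (ler_norm _))//.
by have /andP[] := truncn_itv (normr_ge0 rho).
Qed.

(** Read off the lattice sums, which are exactly linear, with one [B] serving all three supports. *)
Lemma testfun_int_linear (a : R) u v :
  testfun_int (a *: u + v) = a * testfun_int u + testfun_int v.
Proof.
have [r1 r10 u1] := testfun_spt_bounded u; have [r2 r20 v2] := testfun_spt_bounded v.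
have [r3 r30 w3] := testfun_spt_bounded (a *: u + v : testfun n R^o).
have [B HB] := nat_bound (r1 + r2 + r3).
have [c1 c10 H1] := riemann_limit (B := B) ltr01 u1 ltac:(rewrite mul1r; lra).
have [c2 c20 H2] := riemann_limit (B := B) ltr01 v2 ltac:(rewrite mul1r; lra).
have [c3 c30 H3] := riemann_limit (B := B) ltr01 w3 ltac:(rewrite mul1r; lra).
apply/subr0_eq/(@eq0_of_small _ (`|a| * c1 + c2 + c3)) => [|N].
  by rewrite !addr_ge0// mulr_ge0.
have {}H1 := H1 N; have {}H2 := H2 N; have {}H3 := H3 N.
have E : riemann_sum (1 / N.+1%:R) (B * N.+1) (a *: u + v : testfun n R^o) 0 =
  a *: riemann_sum (1 / N.+1%:R) (B * N.+1) u 0 + riemann_sum (1 / N.+1%:R) (B * N.+1) v 0.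
  rewrite /riemann_sum scalerA [a * _]mulrC -scalerA -scalerDr; congr (_ *: _).
  by rewrite scaler_sumr -big_split.
move: E H1 H2 H3; set x := riemann_sum _ _ _ _; set y := riemann_sum _ _ _ _.
set z := riemann_sum _ _ _ _ => -> H1 H2 H3.
set e := N.+1%:R^-1 in H1 H2 H3 *.
have {}H1 : `|a * (y - testfun_int u)| <= `|a| * (e * c1) by rewrite normrM ler_wpM2l.
rewrite (_ : _ - _ = a * (y - testfun_int u) + (z - testfun_int v)
   - (a *: y + z - testfun_int (a *: u + v))); last by rewrite -[a *: y]/(a * y); ring.
rewrite (_ : e * _ = `|a| * (e * c1) + e * c2 + e * c3); last ring.
by rewrite (le_trans (ler_normB _ _))// lerD// (le_trans (ler_normD _ _))// lerD.
Qed.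

HB.instance Definition _ :=
  GRing.isLinear.Build R (testfun n R^o) R^o *:%R (testfun_int : testfun n R^o -> R^o)
    testfun_int_linear.

Lemma testfun_int_derive u (v : 'rV[R]_n) : testfun_int (testfun_derive u v) = 0.
Proof.
have [r1 r10 u1] := testfun_spt_bounded u.
have [B HB] := nat_bound r1.
have v1 x : spt (testfun_derive u v) x -> `|x| <= r1 by move/spt_derive; exact: u1.
have HB1 : r1 < 1 * B%:R by rewrite mul1r.
have [c1 c10 H1] := riemann_limit ltr01 v1 HB1.
pose c2 := n%:R * `|v| * ((2 * B%:R) ^+ n * supD 2 u).
have c20 : 0 <= c2 by rewrite !mulr_ge0// ?exprn_ge0 ?mulr_ge0// supD_ge0.
apply: (@eq0_of_small _ (c1 + c2)) => [|N]; first by rewrite addr_ge0.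
have {}H1 := H1 N.
rewrite -(subrK (riemann_sum (1 / N.+1%:R) (B * N.+1) (testfun_derive u v) 0) (testfun_int _)).
rewrite (le_trans (ler_normD _ _))// mulrDr lerD//; first by rewrite distrC.
have h0 : 1 / N.+1%:R != 0 :> R by rewrite mul1r invr_eq0.
have z0 : `|0 : 'rV[R]_n| <= 0 by rewrite normr0.
have hB : r1 + 0 < `|1 / N.+1%:R| * (B * N.+1)%:R.
  by rewrite addr0 ger0_norm ?divr_ge0// grid_extent mul1r.
apply: (le_trans (riemann_sum_derive (c := supD 2 u) v h0 u1 z0 hB _)).
  move=> j x; apply: (@iter_derive_le_supD _ _ _ u [:: _; _]).
  by rewrite /= enorm_delta lexx.
rewrite grid_width// ger0_norm ?divr_ge0// mulr1 le_eqVlt; apply/orP; left; apply/eqP.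
rewrite /c2; ring.
Qed.

Lemma testfun_int_shift u (c : 'rV[R]_n) : testfun_int (testfun_shift u c) = testfun_int u.
Proof.
have [r1 r10 u1] := testfun_spt_bounded u.
have v1 x : spt (testfun_shift u c) x -> `|x| <= r1 + `|c|.
  move=> /spt_shiftr /u1 xc; rewrite -(addrK c x) (le_trans (ler_normB _ _))// lerD//.
have [B HB] := nat_bound (r1 + `|c|).
have c0 : 0 <= `|c| by [].
have HB1 : r1 < 1 * B%:R by rewrite mul1r; lra.
have HB2 : r1 + `|c| < 1 * B%:R by rewrite mul1r.
have [c1 c10 H1] := riemann_limit ltr01 u1 HB1.
have [c2 c20 H2] := riemann_limit ltr01 v1 HB2.
have [c3 c30 H3] := riemann_sum_flat 0 u1 c0.
pose c4 := (2 * B%:R) ^+ n * c3.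
have c40 : 0 <= c4 by rewrite mulr_ge0// exprn_ge0// mulr_ge0.
apply/subr0_eq/(@eq0_of_small _ (c2 + c4 + c1)) => [|N]; first by rewrite !addr_ge0.
have {}H1 := H1 N; have {}H2 := H2 N.
have h0 : 1 / N.+1%:R != 0 :> R by rewrite mul1r invr_eq0.
have hB : r1 + `|c| < `|1 / N.+1%:R| * (B * N.+1)%:R.
  by rewrite ger0_norm ?divr_ge0// grid_extent mul1r.
have {}H3 := H3 _ _ h0 hB [::] c isT isT (lexx _).
rewrite /= grid_width// [`|1 / _|]ger0_norm ?divr_ge0// mulr1 in H3.
(* Translating [u] amounts to moving the offset of the lattice, to which the sum is insensitive. *)
have E : riemann_sum (1 / N.+1%:R) (B * N.+1) (testfun_shift u c) 0 =
    riemann_sum (1 / N.+1%:R) (B * N.+1) u c.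
  by rewrite /riemann_sum; congr (_ *: _); apply: eq_bigr => w _ /=; rewrite add0r addrC.
rewrite {}E in H2; move: H1 H2 H3.
set x := riemann_sum _ _ _ _; set y := riemann_sum _ _ _ _ => H1 H2 H3.
rewrite (_ : _ - _ = - (y - testfun_int (testfun_shift u c)) + (y - x) + (x - testfun_int
  u)); last ring.
rewrite !mulrDr (le_trans (ler_normD _ _))// lerD// (le_trans (ler_normD _ _))// lerD ?normrN//.
rewrite (le_trans H3)// le_eqVlt; apply/orP; left; apply/eqP; rewrite /c4; ring.
Qed.

Lemma testfun_int_bound (rho : R) :
  exists2 c : R, 0 <= c & forall v M, (forall x, spt v x -> `|x| <= rho) ->
  (forall x, `|v x| <= M) -> `|testfun_int v| <= c * M.
Proof.
have [B HB] := nat_bound rho.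
(* The volume of the lattice box. *)
exists ((2 * B%:R) ^+ n) => [|v M vr vM]; first by rewrite exprn_ge0// mulr_ge0.
have HB1 : rho < 1 * B%:R by rewrite mul1r.
have [c1 c10 H1] := riemann_limit ltr01 vr HB1.
apply/ler_addgt0Pr => e e0; have [N HN] := inv_succ_small c10 e0.
have {}H1 := le_trans (H1 N) (HN N (leqnn N)).
rewrite -(subrK (riemann_sum (1 / N.+1%:R) (B * N.+1) v 0) (testfun_int _)).
rewrite addrC (le_trans (ler_normD _ _))// lerD//; last by rewrite distrC.
rewrite /riemann_sum normrZ normrX normr_id.
rewrite (le_trans (ler_wpM2l _ (ler_norm_sum _ _ _))) ?exprn_ge0//.
apply: (@le_trans _ _ (`|1 / N.+1%:R| ^+ n * \sum_(w : {ffun 'I_n -> 'I_(B * N.+1).*2}) M)).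
  by rewrite ler_wpM2l ?exprn_ge0//; apply: ler_sum.
rewrite sumr_const card_ffun !card_ord -[M *+ _]mulr_natl natrX mulrA -exprMn.
by rewrite [`|_| * _]mulrC grid_width// mulr1.
Qed.

End testfun_integral.

(** * The estimate for one derivative *)

Section transport.
Context {R : realType} {n : nat} {Y : normedModType R}.
Implicit Types (E : {linear testfun n Y -> R^o}) (K C : set 'rV[R]_n)
  (Phi : testfun n R^o) (theta phi : testfun n Y) (a w x : 'rV[R]_n).

(** Form of the continuity of [E] suited to both lattice sums: one factor is fixed and the other is
    O(h), so only the product of the two bounds has to be small. The loss 2^N is the binomial sum in
    Leibniz' rule. *)
Lemma product_small E K (e : R) : DK_continuous E -> compact K -> 0 < e ->
  exists (N : nat) (eta : R), 0 < eta /\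
  forall (A B : R) (p : 'rV[R]_n -> R^o) (f : 'rV[R]_n -> Y) phi,
  0 <= A -> 0 <= B -> A * B <= eta -> smooth p -> smooth f ->
  (forall x, phi x = p x *: f x) -> spt phi `<=` K ->
  (forall us x, (size us <= N)%N -> unit_vecs us -> K x ->
    `|iter_derive us p x| <= A /\ `|iter_derive us f x| <= B) ->
  `|E phi| <= e.
Proof.
move=> cE cK e0; have [N [d [d0 Ed]]] := cE K cK e e0.
exists N, (d / 2 ^+ N); split; first by rewrite divr_gt0// exprn_gt0.
move=> A B p f phi A0 B0 AB sp sf phiE phiK pf; apply: Ed => // vs x vsN v1.
have [Kx|Kx] := pselect (K x); last first.
  rewrite (@notin_spt _ _ _ (iter_derive vs phi) x) ?normr0 ?(ltW d0)//.
  by move/spt_iter_derive/phiK.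
have -> : (phi : 'rV[R]_n -> Y) = fun x => p x *: f x by exact/funext.
have pfx us : unit_vecs us -> (size us <= size vs)%N ->
    `|iter_derive us p x| <= A /\ `|iter_derive us f x| <= B.
  by move=> u1 usvs; apply: pf => //; exact: leq_trans usvs vsN.
apply: (@le_trans _ _ (A * B * (1 + 1) ^+ size vs)).
  apply: leibniz_bound => // us u1 us_vs; by have [] := pfx us u1 us_vs; rewrite expr1n mulr1.
apply: (@le_trans _ _ (A * B * 2 ^+ N)); last by rewrite -ler_pdivlMr// exprn_gt0.
rewrite ler_wpM2l ?mulr_ge0// ler_weXn2l//; lra.
Qed.

(* Translating [transport Phi theta a w] by [w] gives Phi (z + w - a) *: theta z:
   integrated over w, the former becomes Phi (z - a) times the integral of theta,
   the latter theta itself. *)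
Definition transport Phi theta a w : testfun n Y :=
  testfun_scalel (testfun_shift Phi (- a)) (smooth_shiftr (- w) (testfun_smooth theta)).

Lemma supD_transport Phi theta a w C i (r d : R) : (0 < n)%N -> 0 <= r -> 0 <= d ->
  spt Phi `<=` ecball 0 r -> spt theta `<=` C ->
  (forall x y, C x -> C y -> enorm (x - y) <= d) ->
  supD i (transport Phi theta a w) <= supD i Phi * supD i theta * (2 * r + d) ^+ i.
Proof.
move=> n0 r0 d0 Phir thetaC Cd; pose u := delta_mx ord0 (Ordinal n0) : 'rV[R]_n.
have u1 : enorm u = 1 by exact: enorm_delta.
have r20 : 0 <= 2 * r by rewrite mulr_ge0.
apply: supD_le => vs x vsi v1; apply: leibniz_bound => //; rewrite ?supD_ge0//.
- exact: testfun_smooth.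
- exact: smooth_shiftr (testfun_smooth theta).
- move=> us us1 usi; rewrite (iter_derive_shiftr us Phi).
  apply: (spt_diam_bound _ Phir _ u1) => // y z; rewrite /ecball /= !subr0 => yr zr.
  by rewrite (le_trans (enormD _ _))// enormN mulr2n mulrDl mul1r lerD.
- move=> us us1 usi; rewrite (iter_derive_shiftr us theta).
  exact: (spt_diam_bound _ thetaC Cd u1).
Qed.

Definition convex_vec C := forall (t : R) x y, 0 <= t <= 1 -> C x -> C y ->
  C (t *: x + (1 - t) *: y).

Lemma spt_transport_shift Phi theta a w C (r t : R) : 0 <= t <= 1 ->
  spt Phi `<=` ecball 0 r -> spt theta `<=` C -> convex_vec C -> C a ->
  spt (testfun_shift (transport Phi theta a w) (t *: w)) `<=` ethicken C r.
Proof.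
move=> t01 Phir thetaC convC Ca z /spt_shiftr /= zs.
have zPhi : ecball 0 r (z + t *: w - a).
  by apply: Phir; have /spt_shiftr := @spt_scalel _ _ _ (testfun_shift Phi (- a)) _ _ zs.
have zC : C (z + t *: w - w).
  by apply: thetaC; have /spt_shiftr := @spt_scaler _ _ _ _ (testfun_shift theta (- w)) _ zs.
(* The point of [C] near [z]: subtracting this convex combination from [z] leaves (1 - t) times the
   vector z + t w - a, which has length at most [r]. *)
exists (t *: (z + t *: w - w) + (1 - t) *: a); first exact: convC.
rewrite /ecball /= subr0 in zPhi *.
have -> : z - (t *: (z + t *: w - w) + (1 - t) *: a) = (1 - t) *: (z + t *: w - a).
  by apply/rowP => l; rewrite !mxE; ring.
case/andP: t01 => t0 t1; rewrite enormZ ger0_norm ?subr_ge0//.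
by rewrite (le_trans _ zPhi)// ler_piMl ?enorm_ge0//; lra.
Qed.

(** Origin of the factor n in the constant: each of the n coordinates of [w] is bounded by its
    Euclidean norm. *)
Lemma linear_derive_bound E phi w (M : R) : 0 <= M ->
  (forall j, `|E (testfun_derive phi (delta_mx ord0 j))| <= M) ->
  `|E (testfun_derive phi w)| <= n%:R * enorm w * M.
Proof.
move=> M0 EM.
have -> : testfun_derive phi w =
    \sum_j w ord0 j *: testfun_derive phi (delta_mx ord0 j).
  apply: testfun_ext => x; rewrite testfun_sumE /=.
  by have /(congr1 (fun g => g x)) := derive_coord phi w; rewrite fct_sumE.
rewrite linear_sum (le_trans (ler_norm_sum _ _ _))//.
apply: (@le_trans _ _ (\sum_(j < n) enorm w * M)).
  apply: ler_sum => j _; rewrite linearZ normrM ler_pM//; exact: coord_le_enorm.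
by rewrite sumr_const card_ord -[leLHS]mulr_natl mulrA.
Qed.

(** The truth value in front restricts the later sum over [w] to a ball. In the exponent 1 + i, the
    1 comes from |w| <= L and the i from Leibniz' rule. *)
Lemma transport_bound E Phi theta a w C i (r d lam : R) : (0 < n)%N -> 0 < r -> 0 <= d ->
  DK_continuous E -> 0 <= lam ->
  spt Phi `<=` ecball 0 r -> spt theta `<=` C -> convex_vec C -> C a ->
  (forall x y, C x -> C y -> enorm (x - y) <= d) ->
  (forall j phi, spt phi `<=` ethicken C r ->
    `|E (testfun_derive phi (delta_mx ord0 j))| <= lam * supD i phi) ->
  `|E (testfun_shift (transport Phi theta a w) w) - E (transport Phi theta a w)| <=
    (enorm w <= 2 * r + d)%R%:R *
    (n%:R * (2 * r + d) ^+ (1 + i) * lam * supD i Phi * supD i theta).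
Proof.
move=> n0 r0 d0 cE lam0 Phir thetaC convC Ca Cd EC.
have L0 : 0 < 2 * r + d by lra.
have [wL|wL] := leP (enorm w) (2 * r + d); last first.
  (* Where neither factor vanishes, |x - a| <= r and |x - w - a| <= d, hence |w| <= r + d, contrary
     to the choice of [w]. *)
  have F0 : transport Phi theta a w = 0.
    apply: testfun_ext => x /=; have [/Phir|/notin_spt ->] := pselect (spt Phi (x - a)); last first.
      by rewrite scale0r.
    rewrite /ecball /= subr0 => xr; rewrite (@notin_spt _ _ _ theta (x - w)) ?scaler0// =>
      /thetaC xC.
    have := Cd _ _ Ca xC; rewrite enorm_distC => xd.
    have := enormD (x - a) (- (x - w - a)).
    rewrite enormN (_ : x - a - (x - w - a) = w); first lra.
    by apply/rowP => l; rewrite !mxE; ring.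
  have -> : testfun_shift (transport Phi theta a w) w = 0.
    by apply: testfun_ext => x; rewrite F0.
  by rewrite F0 linear0 subr0 normr0 mul0r.
rewrite mul1r; apply: translation_bound => // t t01.
set G := testfun_shift _ _.
have GC : spt G `<=` ethicken C r by exact: spt_transport_shift.
have GD : supD i G <= supD i Phi * supD i theta * (2 * r + d) ^+ i.
  apply: (le_trans (supD_shift _ _ _)); apply: (supD_transport _ _ _ n0 (ltW r0) d0 Phir thetaC Cd).
apply: (le_trans (linear_derive_bound (M := lam * supD i G) _ _ _)).
- by rewrite mulr_ge0// supD_ge0.
- by move=> j; exact: EC.
have -> : n%:R * (2 * r + d) ^+ (1 + i) * lam * supD i Phi * supD i theta =
  n%:R * (2 * r + d) * (lam * (supD i Phi * supD i theta * (2 * r + d) ^+ i)).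
  by rewrite exprD expr1; ring.
rewrite ler_pM ?mulr_ge0 ?enorm_ge0 ?supD_ge0//; last exact: ler_wpM2l.
exact: ler_wpM2l.
Qed.

End transport.

Section local_estimate.
Context {R : realType} {n : nat} {Y : normedModType R}.
Implicit Types (E : {linear testfun n Y -> R^o}) (C : set 'rV[R]_n)
  (Phi : testfun n R^o) (theta phi : testfun n Y) (a w x : 'rV[R]_n).

Definition transported_sum Phi theta a (h : R) m : testfun n Y :=
  `|h| ^+ n *: \sum_(w : {ffun 'I_n -> 'I_m.*2})
    testfun_shift (transport Phi theta a (grid h w)) (grid h w).

Definition untransported_sum Phi theta a (h : R) m : testfun n Y :=
  `|h| ^+ n *: \sum_(w : {ffun 'I_n -> 'I_m.*2}) transport Phi theta a (grid h w).

Lemma transported_sumE Phi theta a h m x :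
  transported_sum Phi theta a h m x = riemann_sum h m Phi (x - a) *: theta x.
Proof.
rewrite /transported_sum /riemann_sum -[LHS]/(`|h| ^+ n *: (\sum_(w : {ffun 'I_n ->
  'I_m.*2}) _ : testfun n Y) x).
rewrite testfun_sumE -scalerA; congr (_ *: _); rewrite scaler_suml.
by apply: eq_bigr => w _ /=; rewrite addrK addrAC.
Qed.

Lemma untransported_sumE Phi theta a h m x :
  untransported_sum Phi theta a h m x = Phi (x - a) *: riemann_sum (- h) m theta x.
Proof.
rewrite /untransported_sum /riemann_sum -[LHS]/(`|h| ^+ n *: (\sum_(w : {ffun 'I_n ->
  'I_m.*2}) _ : testfun n Y) x).
rewrite testfun_sumE normrN scalerA [_ (x - a) * _]mulrC -scalerA; congr (_ *: _); rewrite
  scaler_sumr.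
by apply: eq_bigr => w _ /=; rewrite gridN.
Qed.

(** The difference is (1 - S(x - a)) theta(x) with S the lattice sum of [Phi]; the first factor is
    O(h) with its derivatives on the support of [theta]. *)
Lemma transported_sum_cvg E Phi theta a (L e : R) (B : nat) rho rhot : 0 < L -> 0 < e ->
  DK_continuous E ->
  testfun_int Phi = 1 ->
  (forall x, spt Phi x -> `|x| <= rho) -> (forall x, spt theta x -> `|x| <= rhot) ->
  0 <= rhot -> rho + (rhot + `|a|) < L * B%:R ->
  exists N0 : nat, forall N, (N0 <= N)%N ->
  `|E (theta - transported_sum Phi theta a (L / N.+1%:R) (B * N.+1))| <= e.
Proof.
move=> L0 e0 cE Phi1 Phir thetar rhot0 LB.
have a0 : 0 <= `|a| by [].
have [N1 [eta [eta0 H]]] := product_small cE (testfunP theta).2 e0.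
have [c1 c10 H1] := riemann_limit (B := B) L0 Phir ltac:(lra).
have [c2 c20 H2] := riemann_sum_flat N1 Phir (addr_ge0 rhot0 a0).
pose Bt := \sum_(l < N1.+1) supD l theta.
have Bt0 : 0 <= Bt by rewrite sumr_ge0// => l _; exact: supD_ge0.
pose c := c1 + (2 * L * B%:R) ^+ n * (L * c2).
have L0' := ltW L0.
have c0 : 0 <= c by rewrite addr_ge0// !mulr_ge0// exprn_ge0// !mulr_ge0.
have [N0 HN0] := inv_succ_small (mulr_ge0 c0 Bt0) eta0.
exists N0 => N NN; set h := L / N.+1%:R; set m := (B * N.+1)%N.
have h0 : 0 < h by rewrite divr_gt0.
pose g x := riemann_sum h m Phi x - riemann_sum h m Phi 0.
pose kap := 1 - riemann_sum h m Phi 0.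
(* The first factor, split into the oscillation [g], small by [riemann_sum_flat], and the constant
   [kap], small because [Phi] has integral 1. *)
pose p : 'rV[R]_n -> R^o := (-1) *: (fun x => g (x - a)) + (fun _ => kap).
have sg : smooth g.
  rewrite (_ : g = 1 *: riemann_sum h m Phi + (fun _ => - riemann_sum h m Phi 0)).
    by apply: smooth_linear; [exact: smooth_riemann_sum|exact: smooth_cst].
  by apply/funext => x; rewrite !fctE scale1r.
have sga : smooth (fun x => g (x - a)) by exact: smooth_shiftr.
have sp : smooth p by apply: smooth_linear => //; exact: smooth_cst.
have pE x : p x = 1 - riemann_sum h m Phi (x - a).
  by rewrite /p !fctE /g /kap scaleN1r opprB addrC addrA subrK.
have Ac0 : 0 <= N.+1%:R^-1 * c by rewrite mulr_ge0.
apply: (H (N.+1%:R^-1 * c) Bt p theta) => //.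
- by rewrite -mulrA HN0.
- exact: testfun_smooth.
- move=> x; rewrite -[LHS]/(theta x - transported_sum Phi theta a h m x) transported_sumE.
  by rewrite pE scalerBl scale1r.
- apply: subset_trans (@spt_scaler _ _ _ p theta).
  rewrite /spt; apply: closureS => x /=; apply: contra_neq => px.
  rewrite -[LHS]/(theta x - transported_sum Phi theta a h m x) transported_sumE.
  by rewrite -[X in X - _]scale1r -scalerBl -pE.
move=> us x usN u1 /thetar xr; split; last exact: iter_derive_le_sum.
rewrite iter_derive_linear//; last exact: smooth_cst.
rewrite !fctE scaleN1r (iter_derive_shiftr us g) /c mulrDr addrC.
rewrite (le_trans (ler_normB _ _))// lerD//.
  case: us {usN u1} => [|u us]; last by rewrite iter_derive_cst normr0 mulr_ge0.
  by have := H1 N; rewrite Phi1 distrC.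
have xar : `|x - a| <= rhot + `|a| by rewrite (le_trans (ler_normB _ _))// lerD.
have hB : rho + (rhot + `|a|) < `|h| * m%:R.
  by rewrite gtr0_norm// grid_extent.
apply: (le_trans (H2 h m (lt0r_neq0 h0) hB us (x - a) usN u1 xar)).
rewrite grid_width// gtr0_norm// le_eqVlt; apply/orP; left; apply/eqP; rewrite /h; ring.
Qed.

(** The value y of the lattice sum of [theta] at 0 can be subtracted at no cost, since [E] vanishes
    on Phi (. - a) y for every y. Only the oscillation of that sum remains, and it is O(h). *)
Lemma untransported_sum_cvg E Phi theta a (L e : R) (B : nat) rho rhot : 0 < L -> 0 < e ->
  DK_continuous E ->
  (forall y, E (testfun_shift_scale Phi a y) = 0) ->
  (forall x, spt Phi x -> `|x| <= rho) -> (forall x, spt theta x -> `|x| <= rhot) ->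
  0 <= rho -> rhot + (rho + `|a|) < L * B%:R ->
  exists N0 : nat, forall N, (N0 <= N)%N ->
  `|E (untransported_sum Phi theta a (L / N.+1%:R) (B * N.+1))| <= e.
Proof.
move=> L0 e0 cE EPhi Phir thetar rho0 LB.
have a0 : 0 <= `|a| by [].
have [N1 [eta [eta0 H]]] := product_small cE (testfunP (testfun_shift Phi (- a))).2 e0.
have [c2 c20 H2] := riemann_sum_flat N1 thetar (addr_ge0 rho0 a0).
pose Bt := \sum_(l < N1.+1) supD l (testfun_shift Phi (- a)).
have Bt0 : 0 <= Bt by rewrite sumr_ge0// => l _; exact: supD_ge0.
pose c := (2 * L * B%:R) ^+ n * (L * c2).
have L0' := ltW L0.
have c0 : 0 <= c by rewrite !mulr_ge0// exprn_ge0// !mulr_ge0.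
have [N0 HN0] := inv_succ_small (mulr_ge0 c0 Bt0) eta0.
exists N0 => N NN; set h := L / N.+1%:R; set m := (B * N.+1)%N.
have h0 : 0 < h by rewrite divr_gt0.
pose g x := riemann_sum (- h) m theta x - riemann_sum (- h) m theta 0.
have sg : smooth g.
  rewrite (_ : g = 1 *: riemann_sum (- h) m theta + (fun _ => - riemann_sum (- h) m theta 0)).
    by apply: smooth_linear; [exact: smooth_riemann_sum|exact: smooth_cst].
  by apply/funext => x; rewrite !fctE scale1r.
have Ac0 : 0 <= N.+1%:R^-1 * c by rewrite mulr_ge0.
have -> : E (untransported_sum Phi theta a h m) =
    E (testfun_scalel (testfun_shift Phi (- a)) sg).
  rewrite -[LHS]subr0 -(EPhi (riemann_sum (- h) m theta 0)) -linearB; congr (E _).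
  apply: testfun_ext => x.
  rewrite -[LHS]/(untransported_sum Phi theta a h m x - testfun_shift_scale Phi a
    (riemann_sum (- h) m theta 0) x).
  by rewrite untransported_sumE /= /g scalerBr.
apply: (H Bt (N.+1%:R^-1 * c) (testfun_shift Phi (- a)) g) => //.
- by rewrite mulrC -mulrA HN0.
- exact: testfun_smooth.
- exact: spt_scalel.
move=> us x usN u1 /spt_shiftr xs; have xr : `|x - a| <= rho := Phir _ xs; split; first
  exact: iter_derive_le_sum.
have xar : `|x| <= rho + `|a|.
  by rewrite -(subrK a x) (le_trans (ler_normD _ _))// lerD.
have hB : rhot + (rho + `|a|) < `|- h| * m%:R.
  by rewrite normrN gtr0_norm// grid_extent.
have h0' : - h != 0 by rewrite oppr_eq0 lt0r_neq0.
apply: (le_trans (H2 (- h) m h0' hB us x usN u1 xar)).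
rewrite normrN grid_width// gtr0_norm// le_eqVlt; apply/orP; left; apply/eqP; rewrite /h /c; ring.
Qed.

Lemma local_estimate E Phi theta a C i (r d lam : R) : (0 < n)%N -> 0 < r -> 0 <= d ->
  DK_continuous E -> 0 <= lam -> testfun_int Phi = 1 ->
  spt Phi `<=` ecball 0 r -> spt theta `<=` C -> convex_vec C -> C a ->
  (forall x y, C x -> C y -> enorm (x - y) <= d) ->
  (forall j phi, spt phi `<=` ethicken C r ->
    `|E (testfun_derive phi (delta_mx ord0 j))| <= lam * supD i phi) ->
  (forall y, E (testfun_shift_scale Phi a y) = 0) ->
  `|E theta| <= n%:R * unit_ball_volume R n * supD i Phi * (2 * r + d) ^+ (1 + n + i)
    * lam * supD i theta.
Proof.
move=> n0 r0 d0 cE lam0 Phi1 Phir thetaC convC Ca Cd EC EPhi.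
pose L := 2 * r + d; have L0 : 0 < L by rewrite /L; lra.
have L0' := ltW L0.
pose M := n%:R * L ^+ (1 + i) * lam * supD i Phi * supD i theta.
have M0 : 0 <= M by rewrite !mulr_ge0 ?supD_ge0// exprn_ge0.
have [rho rho0 Phirho] := testfun_spt_bounded Phi.
have [rhot rhot0 thetarho] := testfun_spt_bounded theta.
have [B HB] := nat_bound ((rho + rhot + `|a|) / L).
have {}HB : rho + rhot + `|a| < L * B%:R by rewrite mulrC -ltr_pdivrMr.
have HB1 : rho + (rhot + `|a|) < L * B%:R by rewrite addrA.
have HB2 : rhot + (rho + `|a|) < L * B%:R by rewrite addrA [rhot + _]addrC.
suff main e : 0 < e -> `|E theta| <= e + (L ^+ n * (unit_ball_volume R n + e) * M + e).
  have -> : n%:R * unit_ball_volume R n * supD i Phi * (2 * r + d) ^+ (1 + n + i)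
    * lam * supD i theta = L ^+ n * unit_ball_volume R n * M.
    by rewrite /M -/L -addnA [(n + i)%N]addnC addnA exprD; ring.
  (* The coefficient of [e] in [main]; dividing by it makes the total excess exactly [e]. *)
  have K0 : 0 < 2 + L ^+ n * M by rewrite ltr_pwDl// mulr_ge0// exprn_ge0.
  apply/ler_addgt0Pr => e e0; have := main (e / (2 + L ^+ n * M)) (divr_gt0 e0 K0).
  move/le_trans; apply; rewrite le_eqVlt; apply/orP; left; apply/eqP.
  field; exact: lt0r_neq0.
move=> e0.
have [N1 HN1] := transported_sum_cvg L0 e0 cE Phi1 Phirho thetarho (ltW rhot0) HB1.
have [N2 HN2] := untransported_sum_cvg L0 e0 cE EPhi Phirho thetarho (ltW rho0) HB2.
have [N3 HN3] := @grid_count_ball_limit R n e e0.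
pose N := maxn N1 (maxn N2 N3).
have {}HN1 := HN1 N (leq_maxl _ _).
have {}HN2 : `|E (untransported_sum Phi theta a (L / N.+1%:R) (B * N.+1))| <= e.
  by apply: HN2; rewrite /N maxnCA leq_maxl.
have {}HN3 := HN3 N (B * N.+1)%N ltac:(by rewrite /N maxnA leq_maxr).
move: HN1 HN2 HN3; set h := L / N.+1%:R; set m := (B * N.+1)%N => HN1 HN2 HN3.
have h0 : 0 < h by rewrite divr_gt0.
have -> : E theta = E (theta - transported_sum Phi theta a h m) +
  (E (transported_sum Phi theta a h m) - E (untransported_sum Phi theta a h m) +
   E (untransported_sum Phi theta a h m)).
  by rewrite subrK linearB subrK.
rewrite (le_trans (ler_normD _ _))// lerD// (le_trans (ler_normD _ _))// lerD//.
have EZ (F : {ffun 'I_n -> 'I_m.*2} -> testfun n Y) :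
    E (`|h| ^+ n *: \sum_w F w) = `|h| ^+ n * \sum_w E (F w).
  by rewrite linearZ linear_sum.
rewrite /transported_sum /untransported_sum !EZ -mulrBr -sumrB.
rewrite normrM normrX normr_id (gtr0_norm h0).
rewrite (le_trans (ler_wpM2l _ (ler_norm_sum _ _ _))) ?exprn_ge0 ?(ltW h0)//.
apply: (@le_trans _ _ (h ^+ n * \sum_(w : {ffun 'I_n -> 'I_m.*2})
   ((enorm (grid h w) <= L)%R%:R * M))).
  rewrite ler_wpM2l ?exprn_ge0 ?(ltW h0)//; apply: ler_sum => w _.
  exact: (transport_bound _ n0 r0 d0 cE lam0 Phir thetaC convC Ca Cd EC).
rewrite -mulr_suml mulrA ler_wpM2r//.
(* Dividing the lattice by [L] turns the count in the ball of radius [L] into one in the unit ball,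
   with L^n in front. *)
have -> : h ^+ n = L ^+ n * N.+1%:R^-1 ^+ n by rewrite exprMn.
rewrite -mulrA ler_wpM2l ?exprn_ge0//; apply: le_trans HN3.
rewrite ler_wpM2l ?exprn_ge0 ?invr_ge0//.
rewrite -sum1_card natr_sum [leRHS]big_mkcond /=; apply: ler_sum => w _.
rewrite inE (_ : grid h w = L *: grid (N.+1%:R^-1 : R) w); last first.
  by apply/rowP => l; rewrite !mxE mulrA.
by rewrite enormZ gtr0_norm// ger_pMr//; case: ifP.
Qed.

End local_estimate.

(** * Polynomial functions *)

Section polynomial_functions.
Context {R : realType} {n : nat}.
Implicit Types (f g : 'rV[R]_n -> R^o) (s : seq 'I_n) (x v a : 'rV[R]_n).

Definition monomial s x : R^o := \prod_(j <- s) x ord0 j.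

(** Monomials are words in the coordinates instead of exponent vectors, so that closure under sums,
    derivatives and reflection follows by plain induction. *)
Inductive is_poly (d : nat) : ('rV[R]_n -> R^o) -> Prop :=
| is_poly0 : is_poly d (fun _ => 0)
| is_polyD (c : R) s f : (size s <= d)%N -> is_poly d f ->
    is_poly d (fun x => c * monomial s x + f x).

Lemma is_poly_add d f g : is_poly d f -> is_poly d g -> is_poly d (fun x => f x + g x).
Proof.
move=> pf pg; elim: pf => [|c s h sd ph ih].
  by under eq_fun do rewrite add0r.
under eq_fun do rewrite -addrA; exact: is_polyD.
Qed.

Lemma is_poly_scale d (c : R) f : is_poly d f -> is_poly d (fun x => c * f x).
Proof.
elim=> [|b s h sd ph ih]; first by under eq_fun do rewrite mulr0; exact: is_poly0.
by under eq_fun do rewrite mulrDr mulrA; exact: is_polyD.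
Qed.

Lemma is_poly_monomial d s : (size s <= d)%N -> is_poly d (monomial s).
Proof.
move=> sd; rewrite (_ : monomial s = fun x => 1 * monomial s x + 0).
  by apply: is_polyD => //; exact: is_poly0.
by apply/funext => x; rewrite mul1r addr0.
Qed.

Lemma is_poly_leq d e f : (d <= e)%N -> is_poly d f -> is_poly e f.
Proof.
move=> de; elim=> [|c s h sd ph ih]; first exact: is_poly0.
by apply: is_polyD => //; exact: leq_trans de.
Qed.

Lemma is_poly_coord d j f : is_poly d f -> is_poly d.+1 (fun x => x ord0 j * f x).
Proof.
elim=> [|c s h sd ph ih]; first by under eq_fun do rewrite mulr0; exact: is_poly0.
rewrite (_ : (fun x => _) = fun x => c * monomial (j :: s) x + x ord0 j * h x).
  exact: is_polyD.
by apply/funext => x; rewrite /monomial big_cons; ring.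
Qed.

Lemma is_poly_sum d (I : Type) (r : seq I) (F : I -> 'rV[R]_n -> R^o) :
  (forall i, is_poly d (F i)) -> is_poly d (fun x => \sum_(i <- r) F i x).
Proof.
move=> pF; elim: r => [|i r ih].
  by under eq_fun do rewrite big_nil; exact: is_poly0.
by under eq_fun do rewrite big_cons; exact: is_poly_add.
Qed.

Lemma is_poly_prod (xi : 'I_n -> nat) d : (\sum_j xi j <= d)%N ->
  is_poly d (fun x => \prod_j x ord0 j ^+ xi j).
Proof.
move=> xid; pose s := flatten [seq nseq (xi j) j | j <- enum 'I_n].
rewrite (_ : (fun x => _) = monomial s).
  apply: is_poly_monomial; apply: leq_trans xid; rewrite size_flatten /shape -map_comp.
  rewrite sumnE big_map big_enum /= leq_sum// => j _ /=; by rewrite size_nseq.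
apply/funext => x; rewrite /monomial /s big_flatten big_map big_enum /=.
by apply: eq_bigr => j _; rewrite big_nseq -[LHS]mulr1 iter_mulr.
Qed.

Lemma derive_coord_fun j v x : 'D_v (fun x : 'rV[R]_n => x ord0 j : R^o) x = v ord0 j.
Proof.
apply: cvg_lim => //.
have : (fun _ : R => v ord0 j : R^o) @ 0^' --> (v ord0 j : R^o) by exact: cvg_cst.
apply: cvg_trans; apply: near_eq_cvg; near=> h.
have h0 : h != 0 by near: h; exact: nbhs_dnbhs_neq.
by rewrite /= !mxE addrK -[RHS]/(h^-1 * (h * v ord0 j)) mulKf.
Unshelve. all: by end_near. Qed.

Lemma smooth_coord j : smooth (fun x : 'rV[R]_n => x ord0 j : R^o).
Proof.
have dc (x : 'rV[R]_n) : differentiable (fun x : 'rV[R]_n => x ord0 j : R^o) x.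
  exact: differentiable_coord.
apply/smoothP => vs x; elim/last_ind: vs => [|vs v _]; first exact: dc.
rewrite -cats1 iter_derive_cat (_ : iter_derive [:: v] _ = fun _ => v ord0 j).
  by move/smoothP: (@smooth_cst R n R^o (v ord0 j)); exact.
by apply/funext => y; exact: derive_coord_fun.
Qed.

Lemma smooth_monomial s : smooth (monomial s).
Proof.
elim: s => [|j s ih].
  rewrite (_ : monomial [::] = fun _ => 1); first exact: smooth_cst.
  by apply/funext => x; rewrite /monomial big_nil.
rewrite (_ : monomial (j :: s) = fun x => (x ord0 j : R^o) *: monomial s x).
  exact: (smooth_scale (smooth_coord j) ih).
by apply/funext => x; rewrite /monomial big_cons.
Qed.

Lemma is_poly_smooth d f : is_poly d f -> smooth f.
Proof.
elim=> [|c s g _ _ sg]; first exact: smooth_cst.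
by apply: (smooth_linear c (smooth_monomial s) sg).
Qed.

Lemma derive_monomial d s v : (size s <= d.+1)%N -> is_poly d ('D_v (monomial s)).
Proof.
elim: s d => [|j s ih] d sd.
  rewrite (_ : 'D_v (monomial [::]) = fun _ => 0); first exact: is_poly0.
  apply/funext => x; rewrite (_ : monomial [::] = fun _ => 1); first exact: derive_cst.
  by apply/funext => y; rewrite /monomial big_nil.
have -> : 'D_v (monomial (j :: s)) =
    fun x => v ord0 j * monomial s x + x ord0 j * 'D_v (monomial s) x.
  apply/funext => x.
  rewrite (_ : monomial (j :: s) = fun x => (x ord0 j : R^o) *: monomial s x); last first.
    by apply/funext => y; rewrite /monomial big_cons.
  rewrite derive_scale; last 2 first.
  - by move/smoothP: (smooth_coord j) => /(_ [::]).
  - by move/smoothP: (smooth_monomial s) => /(_ [::]).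
  by rewrite derive_coord_fun.
apply: is_polyD; first by move: sd; rewrite /= ltnS.
case: d sd => [|d] sd; last by apply: is_poly_coord; exact: ih.
have -> : s = [::] by apply: size0nil; move: sd => /=; lia.
rewrite (_ : (fun x => _) = fun _ => 0); first exact: is_poly0.
apply/funext => x; rewrite (_ : monomial [::] = fun _ => 1).
  by rewrite derive_cst mulr0.
by apply/funext => y; rewrite /monomial big_nil.
Qed.

Lemma is_poly_derive d f v : is_poly d.+1 f -> is_poly d ('D_v f).
Proof.
elim=> [|c s g sd pg ih].
  rewrite (_ : 'D_v _ = fun _ => 0); first exact: is_poly0.
  by apply/funext => x; exact: derive_cst.
rewrite (_ : 'D_v _ = fun x => c * 'D_v (monomial s) x + 'D_v g x).
  by apply: is_poly_add => //; apply: is_poly_scale; exact: derive_monomial.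
exact: (iter_derive_linear [:: v] c (smooth_monomial s) (is_poly_smooth pg)).
Qed.

Lemma is_poly_const f : is_poly 0 f -> exists c : R, f = fun _ => c.
Proof.
elim=> [|c s g sd pg [b ->]]; first by exists 0.
exists (c + b); apply/funext => x; have -> : s = [::] by apply: size0nil; lia.
by rewrite /monomial big_nil mulr1.
Qed.

Lemma is_poly_iter_derive d f vs : is_poly d f -> is_poly d (iter_derive vs f).
Proof.
move=> pf; elim: vs => [//|v vs ih] /=.
by apply: is_poly_derive; exact: is_poly_leq ih.
Qed.

(** Starts the main induction: at order k the polynomial term of the error disappears. *)
Lemma is_poly_iter_derive0 d f vs : is_poly d f -> size vs = d.+1 ->
  iter_derive vs f = fun _ => 0.
Proof.
elim/last_ind: vs d f => [//|vs v ih] d f pf; rewrite size_rcons => -[vsd].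
rewrite -cats1 iter_derive_cat /=; case: d pf vsd => [|d] pf vsd.
  have [c ->] := is_poly_const pf; rewrite (size0nil vsd) /=.
  by apply/funext => x; exact: derive_cst.
exact: ih (is_poly_derive v pf) vsd.
Qed.

(** A convolution evaluates its second factor at x - b, so the reproducing property of [Phi] is
    applied to a reflected polynomial. *)
Lemma is_poly_reflect d f a : is_poly d f -> is_poly d (fun z => f (a - z)).
Proof.
elim=> [|c s g sd pg ih]; first exact: is_poly0.
apply: is_poly_add => //; apply: is_poly_scale.
elim: s d sd {pg ih} => [|j s ih] d sd.
  by rewrite (_ : (fun z => _) = monomial [::]); [exact: is_poly_monomial|apply/funext =>
    x; rewrite /monomial !big_nil].
case: d sd => [//|d] sd.
rewrite (_ : (fun z => _) = fun z => a ord0 j * monomial s (a - z)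
     + -1 * (z ord0 j * monomial s (a - z))).
  have ps := ih d sd.
  apply: is_poly_add; apply: is_poly_scale; first exact: is_poly_leq ps.
  exact: is_poly_coord.
by apply/funext => z; rewrite /monomial big_cons !mxE; ring.
Qed.

Lemma monomial_count d s x : (size s <= d)%N ->
  monomial s x = \prod_j x ord0 j ^+ ([ffun j => inord (count_mem j s)] : {ffun 'I_n -> 'I_d.+1}) j.
Proof.
move=> sd.
rewrite (eq_bigr (fun j => x ord0 j ^+ count_mem j s)); last first.
  by move=> j _; rewrite ffunE inordK// ltnS (leq_trans (count_size _ _)).
elim: s {sd} => [|j s ih]; rewrite /monomial ?big_nil ?big_cons.
  by rewrite big1.
rewrite -/(monomial s x) ih (bigD1 j)//= [RHS](bigD1 j)//= eqxx exprS mulrA.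
congr (_ * _); apply: eq_bigr => l lj; by rewrite eq_sym (negbTE lj).
Qed.

Lemma sum_count_mem s : (\sum_j count_mem j s)%N = size s.
Proof.
elim: s => [|j s ih] /=; first by rewrite big1.
rewrite big_split /= ih (bigD1 j)//= eqxx big1// => l lj.
by rewrite eq_sym (negbTE lj).
Qed.

(** Returns to the coefficient form in which the reproducing property is assumed. *)
Lemma is_poly_polynomial_fun d f : is_poly d f -> polynomial_fun d f.
Proof.
elim=> [|c s g sd pg [b bg]].
  by exists (fun _ => 0) => x; rewrite big1// => xi _; rewrite scaler0.
pose xis : {ffun 'I_n -> 'I_d.+1} := [ffun j => inord (count_mem j s)].
have xisd : (\sum_j xis j <= d)%N.
  rewrite (eq_bigr (fun j => count_mem j s)) ?sum_count_mem// => j _.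
  by rewrite ffunE inordK// ltnS (leq_trans (count_size _ _)).
exists (fun xi => (if xi == xis then c else 0) + b xi) => x.
under eq_bigr do rewrite scalerDr.
rewrite big_split /= -bg (bigD1 xis)//= eqxx [X in _ = _ + X + _]big1 ?addr0.
  by rewrite (monomial_count x sd) -/xis [c * _]mulrC.
by move=> xi /andP[_ /negbTE ->]; rewrite scaler0.
Qed.

End polynomial_functions.

(** * Pairing of test functions with dual-valued polynomials *)

Section dual_composition.
Context {R : realType} {n : nat} {Y : normedModType R}.
Implicit Types (c : dual_space Y) (theta : testfun n Y).

Definition dual_linear c : {linear Y -> R^o} :=
  HB.pack (c : Y -> R^o) (GRing.isLinear.Build R Y R^o *:%R c (dualP c).1).

Lemma dual_bounded c : exists2 M : R, 0 < M & forall y, `|c y| <= M * `|y|.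
Proof.
have : bounded_near (dual_linear c) (nbhs 0).
  exact/(linear_bounded_continuous (dual_linear c))/(dualP c).2.
by move=> /linear_boundedP/pinfty_ex_gt0[M M0 cM]; exists M.
Qed.

Lemma dual_differentiable c y : differentiable (c : Y -> R^o) y.
Proof. exact: (@linear_differentiable _ _ _ (dual_linear c) y (dualP c).2). Qed.

Lemma iter_derive_dual c vs (f : 'rV[R]_n -> Y) : smooth f ->
  iter_derive vs (fun x => c (f x)) = fun x => c (iter_derive vs f x).
Proof.
move=> /smoothP sf; elim: vs => [//|v vs /= ->]; apply/funext => x.
have df : differentiable (iter_derive vs f) x by exact: sf.
rewrite !deriveE//; last first.
  by apply: (@differentiable_comp _ _ _ _ (iter_derive vs f) c) => //; exact: dual_differentiable.
rewrite (@diff_comp _ _ _ _ (iter_derive vs f) c)//; last exact: dual_differentiable.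
by rewrite /= (@diff_lin _ _ _ (dual_linear c) _ (dualP c).2).
Qed.

Lemma smooth_dual c (f : 'rV[R]_n -> Y) : smooth f -> smooth (fun x => c (f x)).
Proof.
move=> sf; apply/smoothP => vs x; rewrite iter_derive_dual//.
apply: (@differentiable_comp _ _ _ _ (iter_derive vs f) c); last exact: dual_differentiable.
by move/smoothP: sf.
Qed.

Lemma dual0 c : c 0 = 0.
Proof. by rewrite -[c 0]/(dual_linear c 0) linear0. Qed.

Lemma spt_dual c (f : 'rV[R]_n -> Y) : spt (fun x => c (f x)) `<=` spt f.
Proof. by apply: closureS => x /=; apply: contra_neq => ->; exact: dual0. Qed.

Lemma compact_spt_dual c theta : compact (spt (fun x => c (theta x))).
Proof.
by apply: (subclosed_compact (@closed_closure _ _) (testfunP theta).2); exact: spt_dual.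
Qed.

Definition dual_testfun c theta : testfun n R^o :=
  TestFun (testfun_predP (smooth_dual c (testfun_smooth theta)) (@compact_spt_dual c theta)).

Lemma dual_sumE (I : Type) (r : seq I) (a : I -> R) (c : I -> dual_space Y) y :
  (\sum_(i <- r) a i *: c i) y = \sum_(i <- r) a i * c i y.
Proof. by elim: r => [|i r ih]; rewrite ?big_nil// !big_cons -ih. Qed.

End dual_composition.

Section polynomial_pairing.
Context {R : realType} {n : nat} {Y : normedModType R} (I : Type) (r : seq I) (d : nat)
  (p : I -> 'rV[R]_n -> R^o) (pp : forall i, is_poly d (p i)) (c : I -> dual_space Y).
Implicit Types (theta : testfun n Y) (vs : seq 'rV[R]_n).

Definition poly_sum : 'rV[R]_n -> dual_space Y := fun x => \sum_(i <- r) p i x *: c i.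

Lemma smooth_poly_sum : smooth poly_sum.
Proof.
apply: smooth_sum_seq => i; apply: smooth_scale; last exact: smooth_cst.
exact: is_poly_smooth (pp i).
Qed.

Lemma iter_derive_poly_sum vs :
  iter_derive vs poly_sum = fun x => \sum_(i <- r) iter_derive vs (p i) x *: c i.
Proof.
rewrite /poly_sum iter_derive_sum_seq => [|i]; last first.
  by apply: smooth_scale; [exact: is_poly_smooth (pp i)|exact: smooth_cst].
apply/funext => x; apply: eq_bigr => i _.
by rewrite iter_derive_scaler//; exact: is_poly_smooth (pp i).
Qed.

Lemma smooth_iter_poly vs i : smooth (iter_derive vs (p i)).
Proof. by apply: smooth_iter_derive; exact: is_poly_smooth (pp i). Qed.

(** A finite sum of scalar polynomials times the scalar test functions c_i o theta, so that the
    integrand is visibly a test function and the scalar calculus applies termwise. *)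
Definition pairing vs theta : testfun n R^o :=
  \sum_(i <- r) testfun_scaler (smooth_iter_poly vs i) (dual_testfun (c i) theta).

Lemma pairing_sumE vs theta x :
  pairing vs theta x = \sum_(i <- r) iter_derive vs (p i) x * c i (theta x).
Proof. by rewrite /pairing testfun_sumE. Qed.

Lemma pairingE vs theta x : pairing vs theta x = iter_derive vs poly_sum x (theta x).
Proof. by rewrite pairing_sumE iter_derive_poly_sum dual_sumE. Qed.

Lemma pairing_linear vs (a : R) (f g : testfun n Y) :
  pairing vs (a *: f + g) = a *: pairing vs f + pairing vs g.
Proof.
apply: testfun_ext => x; rewrite -[RHS]/(a * pairing vs f x + pairing vs g x) !pairing_sumE.
rewrite mulr_sumr -big_split; apply: eq_bigr => i _ /=.
by rewrite (dualP (c i)).1 mulrDr -[a *: _]/(a * _); congr (_ + _); rewrite mulrCA.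
Qed.

Lemma pairing_derive vs v theta :
  pairing (v :: vs) theta + pairing vs (testfun_derive theta v) =
  testfun_derive (pairing vs theta) v.
Proof.
apply: testfun_ext => x.
rewrite -[LHS]/(pairing (v :: vs) theta x + pairing vs (testfun_derive theta v) x) !pairing_sumE.
rewrite -big_split /= (_ : (pairing vs theta : 'rV[R]_n -> R^o) =
  fun y => \sum_(i <- r) iter_derive vs (p i) y *: (dual_testfun (c i) theta y)); last first.
  by apply/funext => y; rewrite pairing_sumE.
have dp i y : differentiable (iter_derive vs (p i)) y.
  by move/smoothP: (smooth_iter_poly vs i) => /(_ [::]).
have dc i y : differentiable (dual_testfun (c i) theta) y.
  by move/smoothP: (testfun_smooth (dual_testfun (c i) theta)) => /(_ [::]).
rewrite derive_sum_seq => [|i]; last exact: differentiable_scale.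
apply: eq_bigr => i _; rewrite derive_scale//; congr (_ + _ * _).
by have /esym/(congr1 (fun h => h x)) := iter_derive_dual (c i) [:: v] (testfun_smooth theta).
Qed.

Lemma spt_pairing vs theta : spt (pairing vs theta) `<=` spt theta.
Proof.
apply: closureS => x /=; apply: contra_neq => tx; rewrite pairing_sumE big1// => i _.
by rewrite tx dual0 mulr0.
Qed.

(** Integration by parts: the two terms of the product rule add up to a derivative, whose integral
    is 0. *)
Lemma pairing_int_derive vs v theta :
  testfun_int (pairing vs (testfun_derive theta v)) = - testfun_int (pairing (v :: vs) theta).
Proof.
apply/eqP; rewrite -addr_eq0 addrC -linearD pairing_derive.
by rewrite -[X in X == _]/(testfun_int _) testfun_int_derive.
Qed.

(** Gives the continuity on D_K of the polynomial part of the error. *)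
Lemma pairing_int_bound vs (K : set 'rV[R]_n) : compact K ->
  exists2 M : R, 0 < M & forall theta (e : R), spt theta `<=` K ->
  (forall x, `|theta x| <= e) -> `|testfun_int (pairing vs theta)| <= M * e.
Proof.
move=> cK.
have /compact_bounded/pinfty_ex_gt0[rho rho0 Krho] := cK.
have [M1 M10 HM1] := @testfun_int_bound R n rho.
have : exists2 M2 : R, 0 <= M2 & forall x y, K x ->
    `|\sum_(i <- r) iter_derive vs (p i) x * c i y| <= M2 * `|y|.
  elim: r => [|i l [M2 M20 ih]].
    by exists 0 => // x y _; rewrite big_nil normr0 mul0r.
  have [M3 M30 H3] := dual_bounded (c i).
  have : compact (iter_derive vs (p i) @` K).
    apply: continuous_compact cK; apply: continuous_subspaceT => x.
    by apply: differentiable_continuous; move/smoothP: (smooth_iter_poly vs i) => /(_ [::]).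
  move=> /compact_bounded/pinfty_ex_gt0[M4 M40 H4].
  exists (M4 * M3 + M2) => [|x y Kx]; first by rewrite addr_ge0// mulr_ge0// ltW.
  rewrite big_cons mulrDl (le_trans (ler_normD _ _))// lerD ?ih// normrM -mulrA.
  by rewrite ler_pM//; apply: H4; exists x.
(* The 1 makes the constant positive, so that it can be divided by later. *)
move=> [M2 M20 H2]; exists (M1 * M2 + 1) => [|theta e thetaK te]; first by rewrite
  ltr_wpDl// mulr_ge0.
have e0 : 0 <= e by exact: le_trans (te 0).
apply: (@le_trans _ _ (M1 * (M2 * e))); last by rewrite mulrDl mulrA lerDl mul1r.
apply: HM1 => [x /spt_pairing/thetaK/Krho //|x].
have [Kx|Kx] := pselect (K x); last first.
  by rewrite (@notin_spt _ _ _ (pairing vs theta) x) ?normr0 ?mulr_ge0// => /spt_pairing/thetaK.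
by rewrite pairing_sumE (le_trans (H2 _ _ Kx))// ler_wpM2l.
Qed.

End polynomial_pairing.

(** * Thickenings and distributional derivatives *)

Section thickening.
Context {R : realType} {n : nat}.
Implicit Types (C : set 'rV[R]_n).

Lemma convex_set_vec C : convex_set C -> convex_vec C.
Proof.
move=> cC t x y /andP[t0 t1] Cx Cy.
have := cC x y (Itv01 t0 t1); rewrite !inE => /(_ Cx Cy).
by [].
Qed.

Lemma convex_ethicken C (s : R) : convex_vec C -> convex_vec (ethicken C s).
Proof.
move=> cC t x y t01 [c Cc xc] [c' Cc' yc']; exists (t *: c + (1 - t) *: c'); first exact: cC.
rewrite /ecball /= in xc yc' *.
have -> : t *: x + (1 - t) *: y - (t *: c + (1 - t) *: c') = t *: (x - c) + (1 - t) *: (y - c').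
  by apply/rowP => l; rewrite !mxE; ring.
case/andP: t01 => t0 t1; have t1' : 0 <= 1 - t by lra.
rewrite (le_trans (enormD _ _))// !enormZ (ger0_norm t0) (ger0_norm t1').
have -> : s = t * s + (1 - t) * s by ring.
by rewrite lerD// ler_wpM2l.
Qed.

Lemma ethicken_ethicken C (s r : R) : ethicken (ethicken C s) r `<=` ethicken C (s + r).
Proof.
move=> x [y [c Cc yc] xy]; exists c => //; rewrite /ecball /= in yc xy *.
by rewrite -(subrKA y) (le_trans (enormD _ _))// addrC lerD.
Qed.

Lemma ethicken_mono C (s r : R) : s <= r -> ethicken C s `<=` ethicken C r.
Proof. by move=> sr x [c Cc xc]; exists c => //; apply: le_trans xc sr. Qed.

Lemma sub_ethicken C (s : R) : 0 <= s -> C `<=` ethicken C s.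
Proof. by move=> s0 x Cx; exists x => //; rewrite /ecball /= subrr enorm0. Qed.

Lemma enorm_le_ediam C x y : compact C -> C x -> C y -> enorm (x - y) <= ediam C.
Proof.
move=> /compact_bounded/pinfty_ex_gt0[M M0 CM] Cx Cy.
apply: ub_le_sup; last by exists (x, y).
exists (n%:R * (M + M)) => _ [[p q] /= [Cp Cq] <-].
rewrite (le_trans (enorm_le_norm _))// ler_wpM2l// (le_trans (ler_normB _ _))//.
by rewrite lerD//; exact: CM.
Qed.

Lemma ediam_ge0 C x : compact C -> C x -> 0 <= ediam C.
Proof. by move=> cC Cx; have := enorm_le_ediam cC Cx Cx; rewrite subrr enorm0. Qed.

Lemma ethicken_diam C (s : R) x y : compact C -> ethicken C s x -> ethicken C s y ->
  enorm (x - y) <= 2 * s + ediam C.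
Proof.
move=> cC [c Cc xc] [c' Cc' yc']; rewrite /ecball /= in xc yc'.
have := enormD (x - c) (c - c'); rewrite subrKA => H1.
have := enormD (x - c') (c' - y); rewrite subrKA [enorm (c' - y)]enorm_distC => H2.
have := enorm_le_ediam cC Cc Cc'; lra.
Qed.

End thickening.

Section distributions.
Context {R : realType} {n : nat} {Y : normedModType R}.
Implicit Types (xi : {ffun 'I_n -> nat}) (f : testfun n Y).

Lemma continuous_DK (T : {linear testfun n Y -> R^o}) : continuous T -> DK_continuous T.
Proof.
move=> cT K cK e e0.
have : nbhs (0 : testfun n Y) (T @^-1` (ball (T 0) e)) by apply: cT; exact: nbhsx_ballx.
move=> [W [_ nW] WT]; have [N [d [d0 H]]] := nW K cK.
exists N, d; split=> // f fK fd.
have Wf : W f.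
  apply: H => // i v iN v1 x; apply: fd; first by rewrite size_tuple.
  by apply/allP => w /tnthP[j ->].
have /WT : [set 0 + g | g in W] f by exists f => //; rewrite add0r.
by rewrite /= linear0 -ball_normE /= sub0r normrN => /ltW.
Qed.

Definition dirs xi : seq 'rV[R]_n :=
  flatten [seq nseq (xi j) (delta_mx ord0 j) | j <- enum 'I_n].

Lemma size_dirs xi : size (dirs xi) = (\sum_j xi j)%N.
Proof.
rewrite size_flatten /shape -map_comp sumnE big_map big_enum /=.
by apply: eq_bigr => j _; rewrite /= size_nseq.
Qed.

Lemma unit_dirs xi : unit_vecs (dirs xi).
Proof.
apply/allP => v /flattenP[s /mapP[j _ ->]]; rewrite mem_nseq => /andP[_ /eqP ->].
by rewrite enorm_delta.
Qed.

Definition incr xi (j : 'I_n) : {ffun 'I_n -> nat} := [ffun l => (xi l + (l == j))%N].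

Lemma sum_incr xi j : (\sum_l incr xi j l)%N = (\sum_l xi l).+1.
Proof.
rewrite (eq_bigr (fun l => (xi l + (l == j))%N)); last by move=> l _; rewrite ffunE.
rewrite big_split /= -[RHS]addn1; congr addn.
by rewrite (bigD1 j)//= eqxx big1// => l /negbTE ->.
Qed.

Lemma count_dirs a xi : count a (dirs xi) = (\sum_j a (delta_mx ord0 j) * xi j)%N.
Proof.
rewrite count_flatten -map_comp sumnE big_map big_enum /=.
by apply: eq_bigr => j _; rewrite /= count_nseq.
Qed.

(** [partialD] lists its directions coordinate by coordinate, so raising [xi] inserts the new one
    inside the list; symmetry of derivatives absorbs the permutation. *)
Lemma perm_dirs_incr xi j : perm_eq (dirs (incr xi j)) (delta_mx ord0 j :: dirs xi).
Proof.
apply/permP => a; rewrite /= !count_dirs addnC.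
rewrite (eq_bigr (fun l => (a (delta_mx ord0 l) * xi l + (l == j) * a (delta_mx ord0
  l))%N)); last first.
  by move=> l _; rewrite ffunE mulnDr [(_ * (l == j))%N]mulnC.
rewrite big_split /=; congr addn.
by rewrite (bigD1 j)//= eqxx mul1n big1 ?addn0// => l /negbTE ->.
Qed.

Lemma partialD_incr (Z : normedModType R) xi j (f : 'rV[R]_n -> Z) : smooth f ->
  partialD (incr xi j) f = iter_derive (delta_mx ord0 j :: dirs xi) f.
Proof. by move=> sf; apply: iter_derive_perm => //; exact: perm_dirs_incr. Qed.

Lemma distrD_incr xi j (T : testfun n Y -> R) f :
  distrD (incr xi j) T f = - distrD xi T (testfun_derive f (delta_mx ord0 j)).
Proof.
rewrite /distrD sum_incr exprS mulN1r mulNr; congr (- (_ * T _)).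
apply: val_inj => /=; rewrite (partialD_incr _ _ (testfun_smooth f)) /=.
by rewrite -iter_derive_comm.
Qed.

Lemma distrD_linear xi (T : {linear testfun n Y -> R^o}) : linear (distrD xi T : testfun n
  Y -> R^o).
Proof.
move=> a f g; rewrite /distrD.
rewrite (_ : testfun_partialD xi (a *: f + g) =
  a *: testfun_partialD xi f + testfun_partialD xi g).
  by rewrite linearP mulrDr -[a *: _]/(a * _) mulrCA.
by apply: testfun_ext => x; exact: iter_derive_testfunP.
Qed.

Lemma distrD_DK xi (T : {linear testfun n Y -> R^o}) : DK_continuous T ->
  DK_continuous (distrD xi T).
Proof.
move=> cT K cK e e0; have [N [d [d0 H]]] := cT K cK e e0.
exists (N + size (dirs xi))%N, d; split=> // f fK fd.
rewrite /distrD normrM normrX normrN1 expr1n mul1r; apply: H => [|vs x vsN v1].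
  by apply: subset_trans fK; exact: spt_iter_derive.
rewrite -[X in `|X|]/(iter_derive vs (iter_derive (dirs xi) f) x) -iter_derive_cat.
apply: fd; first by rewrite size_cat leq_add2r.
by rewrite [unit_vecs _]all_cat -!/(unit_vecs _) v1 unit_dirs.
Qed.

End distributions.

(** * Descending induction on the order of the derivative *)

Theorem mainTheorem10 (R : realType) (n i k : nat)
    (n_ge1 : (1 <= n)%N) (k_ge1 : (1 <= k)%N)
    (Y : completeNormedModType R)
    (T : {linear testfun n Y -> R^o}) (T_continuous : continuous T)
    (r : R) (r_gt0 : 0 < r)
    (Phi : testfun n R^o) (spt_Phi : spt Phi `<=` ecball 0 r)
    (Phi_repr : forall Q : 'rV[R]_n -> R^o, polynomial_fun k.-1 Q ->
       convolution Phi Q = Q)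
    (kappa : R) (kappa_ge0 : 0 <= kappa)
    (C : set 'rV[R]_n) (C_compact : compact C) (C_convex : convex_set C)
    (T_bound : forall (o : {ffun 'I_n -> nat}) (phi : testfun n Y),
       Xi n k o -> spt phi `<=` ethicken C (k%:R * r) ->
       `|distrD o T phi| <= kappa * supD i phi)
    (a : 'rV[R]_n) (Ca : C a)
    (P : 'rV[R]_n -> dual_space Y) (P_poly : polynomial_fun k.-1 P)
    (P_jet : forall (m : nat) (xi : {ffun 'I_n -> nat}) (y : Y),
       (m < k)%N -> Xi n m xi ->
       partialD xi P a y = distrD xi T (testfun_shift_scale Phi a y)) :
  forall (m : nat) (xi : {ffun 'I_n -> nat}), (m < k)%N -> Xi n m xi ->
  forall theta : testfun n Y, spt theta `<=` C ->
  `|distrD xi T theta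
     - \int[lebesgue_rV n]_x (partialD xi P x (theta x))|
  <= Gamma_const i k r C Phi m * kappa * supD i theta.
Proof.
have [c Pc] := P_poly.
(* Exponents of too large total degree get the zero polynomial, so that [P] becomes an unrestricted
   sum of polynomials of degree at most k - 1. *)
pose p (eta : {ffun 'I_n -> 'I_k.-1.+1}) (x : 'rV[R]_n) : R^o :=
  if (\sum_j eta j <= k.-1)%N then \prod_j x ord0 j ^+ eta j else 0.
have pp eta : is_poly k.-1 (p eta).
  rewrite /p; case: (boolP (\sum_j eta j <= k.-1)%N) => [etak|_]; last exact: is_poly0.
  exact: (is_poly_prod (xi := fun j => eta j)).
pose r0 := index_enum {ffun 'I_n -> 'I_k.-1.+1}.
have PE : P = poly_sum r0 p c.
  apply/funext => x; rewrite Pc /poly_sum big_mkcond; apply: eq_bigr => eta _.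
  by rewrite /p; case: ifP => // _; rewrite scale0r.
have DP xi : partialD xi P = iter_derive (dirs xi) (poly_sum r0 p c) by rewrite PE.
pose err xi (f : testfun n Y) : R^o :=
  distrD xi T f - testfun_int (pairing r0 pp c (dirs xi) f).
have int_err xi (f : testfun n Y) : \int[lebesgue_rV n]_x (partialD xi P x (f x)) =
    testfun_int (pairing r0 pp c (dirs xi) f).
  by apply: eq_Rintegral => x _; rewrite pairingE DP.
have err_linear xi : linear (err xi).
  move=> b f g; rewrite /err (distrD_linear xi T) pairing_linear testfun_int_linear.
  by rewrite scalerBr -[b *: testfun_int _]/(b * _) opprD addrACA.
have [errL errE] : exists errL : {ffun 'I_n -> nat} -> {linear testfun n Y -> R^o},
    forall xi f, errL xi f = err xi f.
  pose L xi : {linear testfun n Y -> R^o} := HB.pack (err xi)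
    (GRing.isLinear.Build R (testfun n Y) R^o *:%R (err xi) (err_linear xi)).
  by exists L.
have err_DK xi : DK_continuous (errL xi).
  move=> K cK e e0; have e20 : 0 < e / 2 by lra.
  have [N [d [d0 Hd]]] := distrD_DK xi (continuous_DK T_continuous) cK e20.
  have [M M0 HM] := pairing_int_bound r0 pp c (dirs xi) cK.
  exists N, (Num.min d (e / 2 / M)); split; first by rewrite lt_min d0 divr_gt0.
  move=> f fK fd; rewrite errE /err (le_trans (ler_normB _ _))//.
  rewrite [e]splitr lerD//.
    by apply: Hd => // vs x vsN v1; rewrite (le_trans (fd vs x vsN v1))// ge_min lexx.
  apply: (le_trans (HM f (e / 2 / M) fK _)) => [x|].
    by rewrite (le_trans (fd [::] x isT isT))// ge_min lexx orbT.
  by rewrite mulrC divfK// lt0r_neq0.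
have err_derive xi j (f : testfun n Y) :
    err xi (testfun_derive f (delta_mx ord0 j)) = - err (incr xi j) f.
  rewrite /err distrD_incr pairing_int_derive opprB !opprK addrC; congr (_ + _).
  congr testfun_int; apply: testfun_ext => x; rewrite !pairingE; congr (_ (f x)).
  have := partialD_incr xi j (smooth_poly_sum r0 pp c).
  by rewrite -[iter_derive (dirs _) _]/(partialD (incr xi j) _) => ->.
(* The reproducing property for the constant 1, evaluated at 0. *)
have Phi1 : testfun_int Phi = 1.
  have /Phi_repr/(congr1 (fun h => h 0)) : polynomial_fun k.-1 (fun _ : 'rV[R]_n => 1 : R^o).
    apply: is_poly_polynomial_fun; rewrite (_ : (fun _ => _) = monomial [::]).
      exact: is_poly_monomial.
    by apply/funext => x; rewrite /monomial big_nil.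
  by rewrite /convolution => <-; apply: eq_Rintegral => x _; rewrite mulr1.
(* For Q(z) = q(a - z), the value of the convolution at 0 is the integral of Phi(b) q(a + b), which
   is the left side after translation by [a]; it equals Q(0) = q(a). *)
have jet_int (xi : {ffun 'I_n -> nat}) (y : Y) :
    testfun_int (pairing r0 pp c (dirs xi) (testfun_shift_scale Phi a y)) = partialD xi P a y.
  set u := pairing _ _ _ _ _.
  pose q (x : 'rV[R]_n) : R^o := partialD xi P x y.
  have qpoly : is_poly k.-1 q.
    rewrite (_ : q = fun x => \sum_(eta <- r0) c eta y * iter_derive (dirs xi) (p eta) x).
      apply: is_poly_sum => eta; apply: is_poly_scale; exact: is_poly_iter_derive.
    apply/funext => x; rewrite /q DP (iter_derive_poly_sum r0 pp) dual_sumE.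
    by apply: eq_bigr => eta _; rewrite mulrC.
  have /Phi_repr/(congr1 (fun h => h 0)) :=
    is_poly_polynomial_fun (is_poly_reflect a qpoly).
  rewrite subr0 -/(q a) => <-; rewrite -(testfun_int_shift u a).
  apply: eq_Rintegral => x _.
  rewrite -[LHS]/(u (x + a)) /u pairingE -DP sub0r opprK [a + x]addrC /q.
  rewrite -[testfun_shift_scale _ _ _ _]/(Phi (x + a - a) *: y) addrK.
  by rewrite -[LHS]/(dual_linear (partialD xi P (x + a)) (Phi x *: y)) linearZ.
have err_jet (xi : {ffun 'I_n -> nat}) (y : Y) : (\sum_j xi j < k)%N -> errL xi
  (testfun_shift_scale Phi a y) = 0.
  by move=> xik; rewrite errE /err jet_int (P_jet _ xi y xik erefl) subrr.
have convC := convex_set_vec C_convex.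
pose A := n%:R * unit_ball_volume R n * supD i Phi.
(* The constant for supports in the s r thickening of [C], with [q] orders left up to k;
   [Gam 0 (k - m)] is [Gamma_const] at [m]. *)
pose Gam (s q : nat) : R := A ^+ q * \prod_(s.+1 <= mu < (s + q).+1) (2 * mu%:R * r + ediam
  C) ^+ (1 + n + i).
have dC0 : 0 <= ediam C by exact: ediam_ge0 Ca.
have alpha0 : 0 <= unit_ball_volume R n by exact: fine_ge0.
have A0 : 0 <= A by rewrite !mulr_ge0// supD_ge0.
have Gam0 s q : 0 <= Gam s q.
  rewrite mulr_ge0 ?exprn_ge0// big_seq_cond prodr_ge0// => mu _.
  by rewrite exprn_ge0// addr_ge0// !mulr_ge0// ltW.
(* Induction on the distance q to the top order k; each step uses up one
   neighbourhood of radius r. *)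
suff main q s xi (f : testfun n Y) : (s + q <= k)%N -> Xi n (k - q) xi ->
    spt f `<=` ethicken C (s%:R * r) -> `|err xi f| <= Gam s q * kappa * supD i f.
  move=> m xi mk xim theta thetaC; rewrite int_err.
  have km : (m = k - (k - m))%N by lia.
  have := main (k - m)%N 0 xi theta; rewrite add0n leq_subr -km => /(_ isT xim).
  apply; apply: subset_trans thetaC _; apply: sub_ethicken; by rewrite mul0r.
elim: q s xi f => [|q ih] s xi f sqk xik fC.
  rewrite subn0 in xik.
  (* A polynomial of degree at most k - 1 has no derivative of order k, so the hypothesis on [T] is
     the base case. *)
  have -> : err xi f = distrD xi T f.
    have int0 : testfun_int (0 : testfun n R^o) = 0 by exact: linear0.
    rewrite /err (_ : pairing _ _ _ _ _ = 0) ?int0 ?subr0//.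
    apply: testfun_ext => x; rewrite pairing_sumE big1// => eta _.
    rewrite (is_poly_iter_derive0 (pp eta)) ?mul0r// size_dirs.
    by rewrite [LHS]xik prednK.
  rewrite /Gam expr0 mul1r big_geq ?addn0// mul1r; apply: T_bound => //.
  apply: subset_trans fC _; apply: ethicken_mono; rewrite ler_wpM2r ?(ltW r_gt0)//.
  by rewrite ler_nat; lia.
have xik1 : (\sum_j xi j).+1 = (k - q)%N by rewrite xik subnSK// (leq_trans _ sqk)// leq_addl.
(* The thickened set has diameter at most 2 s r + diam C; adding the 2 r of the support of [Phi]
   gives the factor mu = s + 1 of the product. *)
have := @local_estimate R n Y (errL xi) Phi f a (ethicken C (s%:R * r)) i r
  (2 * (s%:R * r) + ediam C) (Gam s.+1 q * kappa) n_ge1 r_gt0.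
have s0 : 0 <= s%:R * r by rewrite mulr_ge0// ltW.
have d0 : 0 <= 2 * (s%:R * r) + ediam C by rewrite addr_ge0// mulr_ge0.
move=> /(_ d0 (err_DK xi) (mulr_ge0 (Gam0 _ _) kappa_ge0) Phi1 spt_Phi fC
  (convex_ethicken convC) (sub_ethicken s0 Ca)) H.
have {}H := H (fun x y => @ethicken_diam _ _ _ _ x y C_compact).
rewrite errE in H; apply: (le_trans (H _ _)).
(* Up to sign, a derivative of the test function raises the order of [xi] by one; the larger support
   is paid for by passing from [s] to s + 1. *)
- move=> j phi phiC; rewrite errE err_derive normrN; apply: ih; first by rewrite addSnnS.
    by rewrite /Xi /= sum_incr.
  apply: subset_trans phiC _; apply: subset_trans (@ethicken_ethicken _ _ _ _ _) _.
  by apply: ethicken_mono; rewrite -natr1 mulrDl mul1r.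
- by move=> y; apply: err_jet; rewrite xik1 leq_subr.
rewrite le_eqVlt; apply/orP; left; apply/eqP.
rewrite /Gam [(s.+1 + q)%N]addSnnS [in RHS]big_ltn; last by rewrite addnS !ltnS leq_addr.
rewrite exprS -/A (_ : 2 * r + (2 * (s%:R * r) + ediam C) = 2 * s.+1%:R * r + ediam C).
  by ring.
by rewrite -natr1; ring.
Qed.
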